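(* Let $G = KL$ be a finite Frobenius group with Frobenius kernel $K$ and complement $L$, and assume $K$ is abelian. Then $G$ is a $\mathbf{GC}^*$-group if and only if $K$ is a minimal normal subgroup of $G$, $|K| = q^n$ for a prime $q$, and either (a) $G \cong (C_3 \times C_3) \rtimes Q_8$, or (b) $L$ is cyclic and $|L| = (q^n-1)/d$, where $d$ is a divisor of $q-1$ and $\gcd(d,n) = 1$.
   Context: $C_3$ is the cyclic group of order 3 and $Q_8$ the quaternion group of order 8. Galois automorphisms act on characters by $\chi^\alpha(g)=\chi(g)^\alpha$; two irreducible characters of $G$ are Galois conjugate if one is the image of the other under some element of $\mathrm{Gal}(\mathbb{Q}_n|\mathbb{Q})$ with $|G|$ dividing $n$. A finite group is a $\mathbf{GC}^*$-group if any two of its non-linear irreducible characters of the same degree are Galois conjugate. *)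

(* Defs.v *)
From mathcomp Require Import all_boot all_order all_algebra all_fingroup all_solvable all_field all_character.
Set Implicit Arguments. Unset Strict Implicit. Unset Printing Implicit Defensive.
Import GRing.Theory Num.Theory.

Local Open Scope ring_scope.

Definition Galois_conjugate (gT : finGroupType) (G : {group gT})
  (chi psi : 'CF(G)) : Prop :=
  exists u : {rmorphism algC -> algC}, psi = cfAut u chi.

Definition GCstar (gT : finGroupType) (G : {group gT}) : Prop :=
  forall i j : Iirr G,
    'chi_i 1%g != 1 -> 'chi_j 1%g != 1 ->
    'chi_i 1%g = 'chi_j 1%g -> Galois_conjugate 'chi_i 'chi_j.

(* Main.v *)
Require Import Defs.
From mathcomp Require Import all_boot all_order all_algebra all_fingroup all_solvable all_field all_character.
From mathcomp Require Import zify ring.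
Set Implicit Arguments. Unset Strict Implicit. Unset Printing Implicit Defensive.

(** By Clifford theory every irreducible character of [G] is either inflated from [G / K], which is
    isomorphic to [L], or induced from a nontrivial character of [K].  The induced ones have equal
    degree, and a Fourier argument on [K] shows that they are all Galois conjugate exactly when any
    two nontrivial elements of [K] are related by [y = (x ^ l) ^+ k].  This forces [K] to be
    elementary abelian and minimal normal, and for cyclic [L] counting orbits of [L] times the
    scalars turns it into the condition on [d].

    It remains to see that a GC*-group [L] acting freely on [K] is cyclic or [Q_8].  Twisting by
    linear characters shows that central elements of prime order outside [L'] make [L] abelian;
    with the transfer this settles odd order and cyclic Sylow 2-subgroups.  If the Sylow
    2-subgroups are quaternion, the characters that are odd at the central involution [z] are
    nonlinear, and determinants show that [L / L'] has order 1 or 4; order 4 gives [Q_8].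

    The perfect case is excluded without the classification of Frobenius complements.  In the ring
    generated by [L] on [K], where [z] is [-1], the trace [t] of a product of two noncommuting
    elements of order 3 satisfies [t = 0], [t = 1] or [t ^ 2 = t + 1] (class equation of the group
    they generate).  Coordinates with respect to a quaternion frame then bound the number of
    subgroups of order 3 by 10, so [L] has a quotient of order 60 and a GC*-quotient of order 120
    that both have a subgroup of index 5.  Such a group has an even character of degree 4, hence no
    odd one, which contradicts the number of its classes. *)

(** The model is SL(2,5) inside the quaternions: the elements [2 y + 1] with y of order 3 are the
    twenty vertices of a regular dodecahedron, and its ten axes are the subgroups of order 3. A
    quaternion frame is an inscribed cube, with four of the axes; the other six have golden ratios
    as coordinates. The obstacle is that the ring at hand is a matrix ring over a prime field and
    not a quaternion algebra over a field: it has zero divisors, the traces of different pairs need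
    not commute, coordinates are known to commute only with the frame, and the characteristic is
    arbitrary. The substitute for a division ring is that [rho x - 1] is a unit for every nontrivial
    x of L; this also makes 2, 3 and sometimes 5 invertible. So identities are checked by rewriting
    noncommutative words, and false cases end in an integer that is zero although its prime factors
    are units. SL(2,5) itself is not GC* because it has an even and an odd irreducible character of
    degree 4, whose kernels differ; the final count turns this into a contradiction from the order
    120 and the index 5. *)

Module NcRing.
Import GRing.Theory.
Local Open Scope ring_scope.

(* Normalisation of noncommutative integer polynomials modulo a list of word
   rewriting rules. *)
Inductive ncexp : Type :=
  | NCvar of nat | NCint of int | NCadd of ncexp & ncexp
  | NCmul of ncexp & ncexp | NCopp of ncexp.

Definition ncpoly := seq (int * seq nat).

Definition ncscale (c : int) (u : seq nat) (p : ncpoly) (v : seq nat) : ncpoly :=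
  [seq (c * m.1, u ++ m.2 ++ v) | m <- p].

Definition ncmulp (p q : ncpoly) : ncpoly :=
  flatten [seq ncscale m.1 m.2 q [::] | m <- p].

Fixpoint ncflat (e : ncexp) : ncpoly :=
  match e with
  | NCvar n => [:: (1, [:: n])]
  | NCint c => [:: (c, [::])]
  | NCadd a b => ncflat a ++ ncflat b
  | NCmul a b => ncmulp (ncflat a) (ncflat b)
  | NCopp a => ncscale (-1) [::] (ncflat a) [::]
  end.

Fixpoint ncstrip (l w : seq nat) : option (seq nat) :=
  match l, w with
  | [::], _ => Some w
  | a :: l', b :: w' => if a == b then ncstrip l' w' else None
  | _, _ => None
  end.

Fixpoint nctry (rules : seq (seq nat * ncpoly)) (w : seq nat) :
    option (ncpoly * seq nat) :=
  match rules with
  | [::] => None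
  | r :: rs => match ncstrip r.1 w with
               | Some t => Some (r.2, t)
               | None => nctry rs w
               end
  end.

Fixpoint ncstep rules (pre w : seq nat) : option ncpoly :=
  match nctry rules w with
  | Some (p, t) => Some (ncscale 1 (rev pre) p t)
  | None => match w with
            | [::] => None
            | a :: w' => ncstep rules (a :: pre) w'
            end
  end.

Fixpoint ncins (c : int) (w : seq nat) (p : ncpoly) : ncpoly :=
  match p with
  | [::] => [:: (c, w)]
  | m :: p' => if m.2 == w then (c + m.1, w) :: p' else m :: ncins c w p'
  end.

(** Out of fuel the pending terms are kept, so the value is preserved whether or not the rules
    terminate; termination and confluence only affect how often [nccheck] succeeds. *)
Fixpoint ncnorm rules (fuel : nat) (todo acc : ncpoly) : ncpoly :=
  match fuel with
  | 0 => todo ++ acc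
  | fuel'.+1 =>
    match todo with
    | [::] => acc
    | m :: t =>
      match ncstep rules [::] m.2 with
      | Some p => ncnorm rules fuel' (ncscale m.1 [::] p [::] ++ t) acc
      | None => ncnorm rules fuel' t (ncins m.1 m.2 acc)
      end
    end
  end.

(** A hypothesis becomes a rule only when its left side flattens to a single word with coefficient
    1; [pmap] drops the others, which can make [nccheck] fail but never unsound. *)
Definition ncrule (h : ncexp * ncexp) : option (seq nat * ncpoly) :=
  match ncflat h.1 with
  | [:: m] => if m.1 == 1 then Some (m.2, ncflat h.2) else None
  | _ => None
  end.

Definition nccheck (n : nat) (hs : seq (ncexp * ncexp)) (a b : ncexp) : bool :=
  all (fun m => m.1 == 0)
    (ncnorm (pmap ncrule hs) n (ncflat (NCadd a (NCopp b))) [::]).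

Section NCSound.
Variables (R : nzRingType) (v : seq R).

Fixpoint nceval (e : ncexp) : R :=
  match e with
  | NCvar n => nth 0 v n
  | NCint c => c%:~R
  | NCadd a b => nceval a + nceval b
  | NCmul a b => nceval a * nceval b
  | NCopp a => - nceval a
  end.

Definition ncw (w : seq nat) : R := foldr (fun n a => nth 0 v n * a) 1 w.
Definition ncp (p : ncpoly) : R := \sum_(m <- p) m.1%:~R * ncw m.2.

Lemma ncw_cat u w : ncw (u ++ w) = ncw u * ncw w.
Proof. by elim: u => [|a u IH] /=; rewrite ?mul1r // IH mulrA. Qed.

Lemma ncp_cat p q : ncp (p ++ q) = ncp p + ncp q.
Proof. exact: big_cat. Qed.

Lemma ncp_scale c u p w : ncp (ncscale c u p w) = c%:~R * (ncw u * ncp p * ncw w).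
Proof.
rewrite /ncp /ncscale big_map mulr_sumr mulr_suml mulr_sumr; apply: eq_bigr => m _.
rewrite /= !ncw_cat intrM -!mulrA; congr (_ * _); rewrite !mulrA; congr (_ * _ * _).
by rewrite commr_int.
Qed.

Lemma ncp_mul p q : ncp (ncmulp p q) = ncp p * ncp q.
Proof.
rewrite /ncmulp; elim: p => [|m p IH] /=; first by rewrite /ncp !big_nil mul0r.
by rewrite ncp_cat IH ncp_scale mulr1 /ncp big_cons mulrDl mulrA.
Qed.

Lemma ncflatE e : ncp (ncflat e) = nceval e.
Proof.
elim: e => [n|c|a Ha b Hb|a Ha b Hb|a Ha] /=.
- by rewrite /ncp big_seq1 /= mulr1 mul1r.
- by rewrite /ncp big_seq1 /= mulr1.
- by rewrite ncp_cat Ha Hb.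
- by rewrite ncp_mul Ha Hb.
- by rewrite ncp_scale Ha mul1r mulr1 mulrN1z mulN1r.
Qed.

Fixpoint nchold (hs : seq (ncexp * ncexp)) : Prop :=
  if hs is h :: hs' then nceval h.1 = nceval h.2 /\ nchold hs' else True.

Lemma ncstripE l w t : ncstrip l w = Some t -> w = l ++ t.
Proof.
elim: l w => [|a l IH] [|b w] //=; try by case=> ->.
by case: eqP => // -> /IH ->.
Qed.

Lemma nctryE hs w p t : nchold hs -> nctry (pmap ncrule hs) w = Some (p, t) ->
  ncw w = ncp p * ncw t.
Proof.
elim: hs => //= h hs IH [Eh Hhs]; rewrite /ncrule.
case E: (ncflat h.1) => [|m [|? ?]] /=; try exact: IH.
case: eqP => /= [m1|_]; last exact: IH.
case Es: (ncstrip m.2 w) => [t'|]; last exact: IH.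
case=> <- <-; rewrite (ncstripE Es) ncw_cat ncflatE -Eh -ncflatE E.
by rewrite /ncp big_seq1 m1 mul1r.
Qed.

Lemma ncstepE hs pre w p : nchold hs -> ncstep (pmap ncrule hs) pre w = Some p ->
  ncp p = ncw (rev pre ++ w).
Proof.
move=> Hhs; elim: w pre => [|a w IH] pre /=; case E: nctry => [[q t]|] //.
- by case=> <-; rewrite ncp_scale ncw_cat (nctryE Hhs E) mul1r !mulrA.
- by case=> <-; rewrite ncp_scale ncw_cat (nctryE Hhs E) mul1r !mulrA.
- by move/IH->; rewrite rev_cons cat_rcons.
Qed.

Lemma ncinsE c w p : ncp (ncins c w p) = c%:~R * ncw w + ncp p.
Proof.
elim: p => [|m p IH] /=; first by rewrite /ncp big_seq1 big_nil addr0.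
by rewrite /ncp; case: eqP => [<-|_]; rewrite !big_cons /=;
  [rewrite intrD mulrDl addrA | rewrite -/(ncp _) IH addrCA].
Qed.

Lemma ncnormE hs n p q : nchold hs ->
  ncp (ncnorm (pmap ncrule hs) n p q) = ncp p + ncp q.
Proof.
move=> Hhs; elim: n p q => [|n IH] p q /=; first exact: ncp_cat.
case: p => [|m p]; first by rewrite /ncp big_nil add0r.
have Em : ncp (m :: p) = m.1%:~R * ncw m.2 + ncp p by rewrite /ncp big_cons.
case E: ncstep => [r|]; rewrite IH Em.
  by rewrite ncp_cat ncp_scale (ncstepE Hhs E) mul1r mulr1.
by rewrite ncinsE addrCA addrA.
Qed.

Lemma nccheckP n hs a b : nchold hs -> nccheck n hs a b -> nceval a = nceval b.
Proof.
move=> Hhs /allP chk; apply/eqP; rewrite -subr_eq0 -/(nceval (NCadd a (NCopp b))).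
rewrite -ncflatE; set p := ncflat _.
have -> : ncp p = ncp p + ncp [::] by rewrite /ncp big_nil addr0.
rewrite -(ncnormE n _ _ Hhs) /ncp big_seq big1 // => m /chk /eqP ->.
by rewrite mul0r.
Qed.

End NCSound.

(** * Reification of ring equalities *)

Ltac nc_index a l :=
  match l with
  | ?x :: _ => let _ := match goal with _ => unify a x end in constr:(0%N)
  | _ :: ?l' => let n := nc_index a l' in constr:(S n)
  end.

Ltac nc_add a l :=
  match l with
  | _ => let _ := nc_index a l in l
  | _ => constr:(a :: l)
  end.

Ltac nc_atoms t l :=
  lazymatch t with
  | @GRing.add _ ?a ?b => let l1 := nc_atoms a l in nc_atoms b l1
  | @GRing.mul _ ?a ?b => let l1 := nc_atoms a l in nc_atoms b l1
  | @GRing.opp _ ?a => nc_atoms a l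
  | @GRing.one _ => l
  | @GRing.zero _ => l
  | @GRing.natmul _ ?a ?n => nc_atoms a l
  | @GRing.exp _ ?a ?n => nc_atoms a l
  | _ => nc_add t l
  end.

Fixpoint ncnat (e : ncexp) (n : nat) :=
  if n is n'.+1 then if n' is 0 then e else NCadd e (ncnat e n') else NCint 0.
Fixpoint ncpow (e : ncexp) (n : nat) :=
  if n is n'.+1 then if n' is 0 then e else NCmul e (ncpow e n') else NCint 1.

Ltac nc_reify t l :=
  lazymatch t with
  | @GRing.add _ ?a ?b =>
      let x := nc_reify a l in let y := nc_reify b l in constr:(NCadd x y)
  | @GRing.mul _ ?a ?b =>
      let x := nc_reify a l in let y := nc_reify b l in constr:(NCmul x y)
  | @GRing.opp _ ?a => let x := nc_reify a l in constr:(NCopp x)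
  | @GRing.one _ => constr:(NCint 1)
  | @GRing.zero _ => constr:(NCint 0)
  | @GRing.natmul _ (@GRing.one _) ?n => constr:(NCint (Posz n))
  | @GRing.natmul _ ?a ?n => let x := nc_reify a l in
      let r := eval cbv [ncnat] in (ncnat x n) in r
  | @GRing.exp _ ?a ?n => let x := nc_reify a l in
      let r := eval cbv [ncpow] in (ncpow x n) in r
  | _ => let n := nc_index t l in constr:(NCvar n)
  end.

Ltac nc_hyps hs l :=
  lazymatch hs with
  | (?hs', ?h) => let l1 := nc_hyps hs' l in
      let T := type of h in
      lazymatch T with @eq _ ?a ?b => let l2 := nc_atoms a l1 in nc_atoms b l2 end
  | tt => l
  end.

Ltac nc_rules hs l acc :=
  lazymatch hs with
  | (?hs', ?h) => let T := type of h in
      lazymatch T with @eq _ ?a ?b =>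
        let x := nc_reify a l in let y := nc_reify b l in
        nc_rules hs' l constr:((x, y) :: acc) end
  | tt => acc
  end.

Ltac nc_prove hs :=
  lazymatch goal with |- @eq ?T ?a ?b =>
    let l0 := nc_atoms a constr:(@nil T) in
    let l1 := nc_atoms b l0 in
    let l := nc_hyps hs l1 in
    let x := nc_reify a l in let y := nc_reify b l in
    let rs := nc_rules hs l constr:(@nil (ncexp * ncexp)) in
    refine (@nccheckP _ l (20 * 20 * 20) rs x y _ _);
    [ cbn [nchold nceval nth fst snd]; repeat split; nc_assump hs
    | vm_compute; reflexivity ]
  end
with nc_assump hs :=
  lazymatch hs with
  | (?hs', ?h) => first [exact h | nc_assump hs']
  | tt => idtac
  end.
End NcRing.

(** * The class equation of a group with abelian centralisers *)

Module ClassEquation.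
Import GroupScope.

(** Here a is the order of A, k the index of an abelian centraliser C, and f the number of elements
    outside [<[z]>] in conjugates of C. The two forms of f belong to C having index 1 or 2 in the
    normaliser of [C :\: <[z]>]; the last clause says that the order of C, even and above 2, is 4 or
    at least 6. *)
Definition class_size (a k f : nat) : Prop :=
  (f + 2 * k = a \/ 2 <= k /\ 2 * f + 2 * k = a)%N /\ (a = 4 * k \/ 6 * k <= a)%N.

(** In this lemma and the next three the first centraliser has order at least 12, so f0 is at least
    5a/6 or 5a/12, while any other family has at least a/4 elements. *)
Lemma class_size_full a k0 f0 k1 f1 : 12 * k0 <= a -> 0 < k0 -> (f0 + 2 * k0 = a)%N ->
  0 < k1 -> class_size a k1 f1 -> f0 + f1 <= a - 2 -> False.
Proof. by move=> h0 h1 h2 h3 [[h4|[h4 h5]] [h6|h6]] h7; lia. Qed.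

Lemma class_size2 a k0 f0 k1 f1 : 12 * k0 <= a -> 2 < k0 -> (2 * f0 + 2 * k0 = a)%N ->
  0 < k1 -> class_size a k1 f1 -> f0 + f1 = a - 2 -> False.
Proof. by move=> h0 h1 h2 h3 [[h4|[h4 h5]] [h6|h6]] h7; lia. Qed.

(** The value 2 of k0, excluded by [2 < k0], is the dicyclic case, where two further families of
    size a/4 fill up A. *)
Lemma class_size3 a k0 f0 k1 f1 k2 f2 : 12 * k0 <= a -> 2 < k0 ->
  (2 * f0 + 2 * k0 = a)%N -> 0 < k1 -> class_size a k1 f1 -> 0 < k2 ->
  class_size a k2 f2 -> f0 + f1 + f2 = a - 2 -> False.
Proof.
by move=> h0 h1 h2 h3 [[h4|[h4 h5]] [h6|h6]] g3 [[g4|[g4 g5]] [g6|g6]] h7; lia.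
Qed.

Lemma class_size4 a k0 f0 k1 f1 k2 f2 k3 f3 : 12 * k0 <= a -> 2 < k0 ->
  (2 * f0 + 2 * k0 = a)%N -> 0 < k1 -> class_size a k1 f1 -> 0 < k2 ->
  class_size a k2 f2 -> 0 < k3 -> class_size a k3 f3 ->
  f0 + f1 + f2 + f3 <= a - 2 -> False.
Proof.
move=> h0 h1 h2 h3 [h4 h5] g3 [g4 g5] l3 [l4 l5].
have q1 : a <= 4 * f1 by case: h4 h5 => [?|[? ?]] [?|?]; lia.
have q2 : a <= 4 * f2 by case: g4 g5 => [?|[? ?]] [?|?]; lia.
have q3 : a <= 4 * f3 by case: l4 l5 => [?|[? ?]] [?|?]; lia.
lia.
Qed.

Section ClassEquation.
Variables (gT : finGroupType) (A : {group gT}) (z : gT).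
Hypotheses (zA : z \in A) (oz : #[z] = 2) (cz : A \subset 'C[z]).
Hypothesis cent_ab : forall x, x \in A :\: <[z]> -> abelian 'C_A[x].
Hypothesis norm_cent : forall x b, x \in A :\: <[z]> -> b \in A ->
  x ^ b \in 'C_A[x] -> x ^ b = x \/ x ^ b = x^-1.

Let T x := 'C_A[x] :\: <[z]>.
Let N x := 'N_A(T x).

Let zC x : x \in A -> <[z]> \subset 'C_A[x].
Proof.
move=> Ax; rewrite cycle_subG inE zA cent1C.
exact: (subsetP cz).
Qed.

Let Tx x : x \in A :\: <[z]> -> x \in T x.
Proof. by case/setDP=> Ax nx; rewrite inE nx inE Ax cent1id. Qed.

Let cent_eq x w : x \in A :\: <[z]> -> w \in T x -> 'C_A[w] = 'C_A[x].
Proof.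
move=> Ax; case/setDP=> /setIP[Aw cw] nw.
have Aw' : w \in A :\: <[z]> by rewrite inE nw.
case/setDP: (Ax) => xA _.
apply/eqP; rewrite eqEsubset !subsetI !subsetIl /=; apply/andP; split.
  apply/subsetP=> v /(subsetP (cent_ab Aw'))/centP cv.
  by apply/cent1P/cv; rewrite inE xA cent1C.
apply/subsetP=> v /(subsetP (cent_ab Ax))/centP cv.
by apply/cent1P/cv; rewrite inE Aw.
Qed.

Let T_eq x w : x \in A :\: <[z]> -> w \in T x -> T w = T x.
Proof. by move=> Ax Tw; rewrite /T (cent_eq Ax Tw). Qed.

Let zJ b : b \in A -> z ^ b = z.
Proof. by move=> Ab; rewrite conjgE -(cent1P (subsetP cz b Ab)) mulKg. Qed.

Let TJ x b : b \in A -> T x :^ b = T (x ^ b).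
Proof.
move=> Ab; rewrite /T conjDg conjIg conjGid // -cent1J; congr (_ :\: _).
by rewrite -cycleJ zJ.
Qed.

(** Two sets [T x] that meet are equal, because centralisers outside [<[z]>] are abelian. *)
Let TI x : x \in A :\: <[z]> -> normedTI (T x) A (N x).
Proof.
move=> Ax; apply/normedTI_memJ_P; split; first by apply/set0Pn; exists x; apply: Tx.
  exact: subsetIl.
move=> a g Ta Ag; rewrite in_setI Ag /=; apply/idP/normP => [Tag|<-]; last by rewrite memJ_conjg.
by rewrite -(T_eq Ax Ta) TJ // (T_eq Ax Tag) (T_eq Ax Ta).
Qed.

Let k x := #|A : 'C_A[x]|.
Let f x := #|class_support (T x) A|.

Let facts x : x \in A :\: <[z]> ->
  [/\ exists2 c, #|'C_A[x]| = (c * 2)%N & #|A| = (k x * (c * 2))%N, 0 < k x,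
      class_size #|A| (k x) (f x) & 0 < k x].
Proof.
move=> Ax; case/setDP: (Ax) => xA nx.
have eA : #|A| = (k x * #|'C_A[x]|)%N by rewrite mulnC Lagrange // subsetIl.
have sCN : 'C_A[x] \subset N x.
  apply/subsetP=> b Cb; rewrite inE; case/setIP: (Cb) => Ab cb; rewrite Ab /=.
  by apply/normP; rewrite TJ // /conjg -(cent1P cb) mulKg.
have eC : 'C_(N x)[x] = 'C_A[x].
  apply/eqP; rewrite eqEsubset setSI ?subsetIl //= subsetI sCN.
  exact: subsetIr.
have le2 : #|N x : 'C_A[x]| <= 2.
  rewrite -eC index_cent1 -[2]/(1.+1) -(cards1 x).
  apply: leq_trans (subset_leq_card (B := [set x; x^-1]) _) _; last by rewrite cards2 cards1; case: eqP.
  apply/subsetP=> _ /imsetP[b /setIP[Ab /normP Tb] ->]; rewrite !inE.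
  have : x ^ b \in T x by rewrite -Tb memJ_conjg Tx.
  by case/setDP=> Cb _; case: (norm_cent Ax Ab Cb) => ->; rewrite eqxx ?orbT.
have eN : k x = (#|A : N x| * #|N x : 'C_A[x]|)%N by rewrite /k (Lagrange_index (subsetIl _ _) sCN).
have ef : f x = ((#|'C_A[x]| - 2) * #|A : N x|)%N.
  rewrite /f (card_support_normedTI (TI Ax)) /T cardsD (setIidPr (zC xA)) -orderE oz //.
have gt0 : 0 < #|N x : 'C_A[x]| by rewrite indexg_gt0.
have gt0' : 0 < #|A : N x| by rewrite indexg_gt0.
have ev : 2 %| #|'C_A[x]| by rewrite -oz order_dvdG // -cycle_subG zC.
have gt2 : 2 < #|'C_A[x]|.
  rewrite -oz orderE; apply: proper_card; rewrite properE zC //=.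
  by apply: contra nx => /subsetP; apply; rewrite inE xA cent1id.
case/dvdnP: ev gt2 => c ec; rewrite ec in eA ef * => c2.
split; first by exists c; rewrite // -ec.
- by rewrite indexg_gt0.
- split; first have [e1|e2] : #|N x : 'C_A[x]| = 1%N \/ #|N x : 'C_A[x]| = 2 by lia.
      by left; rewrite eA ef eN e1; nia.
    by right; rewrite eA ef eN e2; nia.
  have [c3|e3] : 3 <= c \/ c = 2 by lia.
    by right; rewrite eA; nia.
  by left; rewrite eA e3; nia.
- by rewrite indexg_gt0.
Qed.

Let supp_sub x : class_support (T x) A \subset A :\: <[z]>.
Proof.
apply/subsetP=> _ /imset2P[w g /setDP[/setIP[Aw _] nw] Ag ->].
rewrite in_setD; apply/andP; split; last exact: groupJ.
apply: contra nw => wz.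
by rewrite -(memJ_conjg _ g) -cycleJ zJ.
Qed.

Let supp_disj x x' : x \in A :\: <[z]> -> x' \in A :\: <[z]> ->
  x' \notin class_support (T x) A ->
  [disjoint class_support (T x) A & class_support (T x') A].
Proof.
move=> Ax Ax' nx'; apply/pred0P=> w /=; apply/negP=> /andP[].
case/imset2P=> u g Tu Ag -> /imset2P[u' g' Tu' Ag' e].
case/negP: nx'; have e' : u' = u ^ (g * g'^-1) by rewrite conjgM e conjgK.
have : x' \in T x :^ (g * g'^-1).
  rewrite -(T_eq Ax Tu) TJ ?groupM ?groupV // -e' (T_eq Ax' Tu').
  exact: Tx.
by case/imsetP=> v Tv ->; apply/imset2P; exists v (g * g'^-1); rewrite ?groupM ?groupV.
Qed.

Hypothesis ncA : ~~ abelian A.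
Hypothesis no_index2 : forall H : {group gT},
  H \subset A -> #|A : H| = 2 -> abelian H -> False.

(** The conjugates of the sets [T x] partition [A :\: <[z]>]. Centralisers have even order, so one
    of order above 10 has order at least 12, and adding families one at a time contradicts the
    estimates above. SL(2,5) attains the bound. *)
Lemma class_equation_bound x : x \in A :\: <[z]> -> #|'C_A[x]| <= 10.
Proof.
move=> Ax; rewrite leqNgt; apply/negP=> gt10.
have [[c ec eA] kgt0 [fx _] _] := facts Ax.
have c6 : 6 <= c by lia.
have a12 : 12 * k x <= #|A| by rewrite eA; nia.
have cardAz : #|A :\: <[z]>| = (#|A| - 2)%N.
  by rewrite cardsD (setIidPr _) ?cycle_subG // -orderE oz.
have kx1 : k x <> 1%N.
  move=> k1; case/negP: ncA; have /eqP/setIidPl sAC : 'C_A[x] == A.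
    by rewrite eqEcard subsetIl; move: eA; rewrite k1 ec; lia.
  by rewrite -(setIidPl sAC) cent_ab.
have kx2 : k x <> 2.
  move=> k2; apply: (no_index2 _ k2 (cent_ab Ax)); exact: subsetIl.
have pick1 (S : {set gT}) : S \subset A :\: <[z]> -> #|S| < #|A| - 2 ->
    exists2 x', x' \in A :\: <[z]> & x' \notin S.
  move=> sS; rewrite -cardAz => lt; have : ~~ (A :\: <[z]> \subset S).
    by apply: contraL lt => /subset_leq_card; rewrite -leqNgt.
  by case/subsetPn=> x' ? ?; exists x'.
have step (S : {set gT}) x' : x' \in A :\: <[z]> -> [disjoint S & class_support (T x') A] ->
    S \subset A :\: <[z]> ->
    S :|: class_support (T x') A \subset A :\: <[z]> /\
    (#|S :|: class_support (T x') A| = #|S| + f x')%N.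
  move=> Ax' dS sS; split; first by rewrite subUset sS supp_sub.
  by rewrite cardsU disjoint_setI0 // cards0 subn0.
have le (S : {set gT}) : S \subset A :\: <[z]> -> #|S| <= #|A| - 2.
  by rewrite -cardAz; apply: subset_leq_card.
have ltA : 12 <= #|A| by lia.
have s0 := supp_sub x; have le0 := le _ s0.
have [fx0|[k2 fx0]] := fx.
  have [|x' Ax' nx'] := pick1 _ s0; first by rewrite -/(f x) -fx0; lia.
  have [_ k'0 f' _] := facts Ax'.
  have [s1 c1] := step _ _ Ax' (supp_disj Ax Ax' nx') s0.
  by have := le _ s1; rewrite c1; apply: class_size_full a12 kgt0 fx0 k'0 f'.
have k3 : 2 < k x by move: kx2 k2; clear; lia.
have [|x' Ax' nx'] := pick1 _ s0; first by rewrite -/(f x) -fx0; move: k3; clear; lia.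
have [_ k'0 f' _] := facts Ax'.
have [s1 c1] := step _ _ Ax' (supp_disj Ax Ax' nx') s0.
have le1 := le _ s1; move: (le1); rewrite c1 leq_eqVlt => /predU1P[|].
  exact: class_size2 a12 k3 fx0 k'0 f'.
rewrite -c1 => /(pick1 _ s1)[x2 Ax2]; rewrite inE negb_or => /andP[nx2 nx2'].
have [_ k20 f2 _] := facts Ax2.
have d2 : [disjoint class_support (T x) A :|: class_support (T x') A & class_support (T x2) A].
  by rewrite -setI_eq0 setIUl setU_eq0 !setI_eq0 !supp_disj.
have [s2 c2] := step _ _ Ax2 d2 s1.
have le2 := le _ s2; move: (le2); rewrite c2 c1 leq_eqVlt => /predU1P[|].
  exact: class_size3 a12 k3 fx0 k'0 f' k20 f2.
rewrite -c1 -c2 => /(pick1 _ s2)[x3 Ax3].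
rewrite !inE !negb_or -andbA => /and3P[nx3 nx3' nx3''].
have [_ k30 f3 _] := facts Ax3.
have d3 : [disjoint class_support (T x) A :|: class_support (T x') A :|: class_support (T x2) A & class_support (T x3) A].
  by rewrite -setI_eq0 !setIUl !setU_eq0 !setI_eq0 !supp_disj.
have [s3 c3] := step _ _ Ax3 d3 s2.
have := le _ s3; rewrite c3 c2 c1.
exact: class_size4 a12 k3 fx0 k'0 f' k20 f2 k30 f3.
Qed.
End ClassEquation.
End ClassEquation.

(** * Units and traces of a fixed-point-free action *)

Module FpfRings.
Import NcRing ClassEquation.
Import GroupScope GRing.Theory.
Local Open Scope ring_scope.

(** The action of L on K seen in an endomorphism ring: a nontrivial element fixes no nonzero vector,
    so [rho x - 1] is invertible. *)
Definition fpf_rep (gT : finGroupType) (L : {group gT}) (R : unitRingType)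
    (rho : gT -> R) :=
  [/\ rho 1%g = 1, {in L &, {morph rho : x y / (x * y)%g >-> x * y}}
    & {in L^#, forall x, rho x - 1 \is a GRing.unit}].

Section FPF.
Variables (gT : finGroupType) (L : {group gT}) (R : unitRingType).
Variable rho : gT -> R.
Hypothesis rep : fpf_rep L rho.

Lemma rho1 : rho 1%g = 1. Proof. by case: rep. Qed.
Lemma rhoM x y : x \in L -> y \in L -> rho (x * y)%g = rho x * rho y.
Proof. by case: rep => _ rM _ Lx Ly; rewrite rM. Qed.

Lemma rhoVl x : x \in L -> rho x^-1%g * rho x = 1.
Proof. by move=> Lx; rewrite -rhoM ?groupV // mulVg rho1. Qed.

Lemma rhoVr x : x \in L -> rho x * rho x^-1%g = 1.
Proof. by move=> Lx; rewrite -rhoM ?groupV // mulgV rho1. Qed.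

Lemma rho_eq1 x : x \in L -> rho x = 1 -> x = 1%g.
Proof.
move=> Lx e; apply/eqP; apply: contraT => ntx; case: rep => _ _ /(_ x).
by rewrite e subrr unitr0 !inE ntx Lx => /(_ isT).
Qed.

Lemma rho_inj : {in L &, injective rho}.
Proof.
move=> x y Lx Ly e; apply/eqP; rewrite eq_mulgV1; apply/eqP.
by apply: rho_eq1; rewrite ?groupM ?groupV // rhoM ?groupV // e rhoVr.
Qed.

(** The substitute for cancellation in a domain. Equations such as [rho y ^+ 2 + rho y + 1 = 0] come
    from power relations by removing the factor [rho y - 1]. *)
Lemma rho_fix x a : x \in L -> x != 1%g -> rho x * a = a -> a = 0.
Proof.
move=> Lx ntx e; case: rep => _ _ /(_ x); rewrite !inE ntx Lx => /(_ isT) u.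
by apply: (mulrI u); rewrite mulr0 mulrBl e mul1r subrr.
Qed.

Lemma rho_conj x y : x \in L -> y \in L -> rho (x ^ y)%g = rho y^-1%g * rho x * rho y.
Proof. by move=> Lx Ly; rewrite conjgE !rhoM ?groupM ?groupV // mulrA. Qed.

Lemma rho_order3 y : y \in L -> #[y]%g = 3%N ->
  rho y * rho y = - 1 - rho y /\ rho y^-1%g = - 1 - rho y.
Proof.
move=> Ly oy; have y3 : (y * y * y = 1)%g by rewrite -mulgA -(expg_order y) oy.
have ey : rho y * rho y = - 1 - rho y.
  apply/eqP; rewrite -subr_eq0; apply/eqP; apply: (rho_fix Ly).
    by rewrite -order_eq1 oy.
  have := rho1; rewrite -y3 !rhoM ?groupM // => e.
  have e' : rho y * (rho y * rho y) = 1 by rewrite mulrA.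
  nc_prove (tt, e').
split=> //; rewrite (_ : y^-1 = y * y)%g ?rhoM //.
by apply/(mulIg y); rewrite mulVg.
Qed.

Variable z : gT.
Hypotheses (Lz : z \in L) (oz : #[z]%g = 2%N).

Lemma rho_z : rho z = - 1.
Proof.
apply/eqP; rewrite -addr_eq0; apply/eqP; apply: (rho_fix Lz); first by rewrite -order_eq1 oz.
have e : rho z * rho z = 1 by rewrite -rhoM // -rho1 -(expg_order z) oz.
nc_prove (tt, e).
Qed.

Lemma rho_zM x : x \in L -> rho (z * x)%g = - rho x.
Proof. by move=> Lx; rewrite rhoM // rho_z mulN1r. Qed.

Lemma unit2 : (2%:R : R) \is a GRing.unit.
Proof.
case: rep => _ _ /(_ z); rewrite !inE Lz -order_eq1 oz => /(_ isT).
by rewrite rho_z -opprD unitrN -mulr2n.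
Qed.

Lemma z_central : L \subset 'C[z]%g.
Proof.
apply/subsetP=> x Lx; apply/cent1P; apply: rho_inj; rewrite ?groupM //.
by rewrite !rhoM // rho_z mulN1r mulrN1.
Qed.

Lemma sq1 x : x \in L -> (x ^+ 2 = 1)%g -> x \in <[z]>%g.
Proof.
move=> Lx e; have [->|ntx] := eqVneq x 1%g; first exact: group1.
have ox : #[x]%g = 2%N by apply: nt_prime_order.
rewrite (_ : x = z) ?cycle_id //; apply: rho_inj => //.
apply/eqP; rewrite rho_z -addr_eq0; apply/eqP; apply: (rho_fix Lx) => //.
have e' : rho x * rho x = 1 by rewrite -rhoM // -[(x * x)%g]/(x ^+ 2)%g e rho1.
nc_prove (tt, e').
Qed.

(** For a 2 by 2 matrix of determinant 1 this is the trace; here it is an element of the ring, which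
    need not be central. *)
Definition tr x := rho x + rho x^-1%g.

Lemma tr_sq x : x \in L -> tr x * tr x = tr (x * x)%g + 2%:R.
Proof.
move=> Lx; rewrite /tr invMg !rhoM ?groupV //.
have e1 := rhoVl Lx; have e2 := rhoVr Lx; nc_prove (tt, e1, e2).
Qed.

Lemma tr_zM x : x \in L -> tr (z * x)%g = - tr x.
Proof.
move=> Lx; rewrite /tr invMg rho_zM // (_ : x^-1 * z^-1 = z * x^-1)%g.
  by rewrite rho_zM ?groupV // opprD.
rewrite (_ : z^-1 = z)%g; last by apply: (mulgI z); rewrite mulgV -(expg_order z) oz.
by apply/cent1P/(subsetP z_central); rewrite groupV.
Qed.

Lemma tr4 x : x \in L -> (x ^+ 2 = z)%g -> tr x = 0.
Proof.
move=> Lx e; rewrite /tr (_ : x^-1 = z * x)%g ?rho_zM ?subrr //.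
apply: (mulIg x); rewrite mulVg -mulgA -[(x * x)%g]/(x ^+ 2)%g e.
by rewrite -(expg_order z) oz.
Qed.

Lemma tr3 x : x \in L -> (x ^+ 3 = 1)%g -> x = 1%g \/ tr x = - 1.
Proof.
move=> Lx e; have [->|ntx] := eqVneq x 1%g; [by left | right].
have ox : #[x]%g = 3%N by apply: nt_prime_order.
by rewrite /tr; have [_ ->] := rho_order3 Lx ox; rewrite addrC -addrA addNr addr0.
Qed.

(** The quadratic equation is the fifth cyclotomic one in terms of [X + X^-1]. The value of that
    cyclotomic polynomial at 1 is 5, the product of the units [X^k - 1] for k from 1 to 4. *)
Lemma tr5 x : x \in L -> (x ^+ 5 = 1)%g -> x = 1%g \/
  tr x * tr x = 1 - tr x /\ (5%:R : R) \is a GRing.unit.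
Proof.
move=> Lx e; have [->|ntx] := eqVneq x 1%g; [by left | right].
pose X := rho x.
have e5 : X * X * X * X * X = 1 by rewrite /X -!rhoM ?groupM // -rho1 -e !expgS !mulgA mulg1.
have e4 : X * X * X * X = - 1 - X - X * X - X * X * X.
  apply/eqP; rewrite -subr_eq0; apply/eqP; apply: (rho_fix Lx) => //.
  rewrite -/X; nc_prove (tt, e5).
have ev : rho x^-1%g = X * X * X * X.
  by rewrite -[LHS]mulr1 -e5 !mulrA rhoVl // mul1r.
split; first by rewrite /tr -/X ev; nc_prove (tt, e4).
have e2 : (5%:R : R) = (X - 1) * (X * X - 1) * ((X * X * X - 1) * (X * X * X * X - 1)).
  nc_prove (tt, e4).
have u k : (0 < k < 5)%N -> rho (x ^+ k)%g - 1 \is a GRing.unit.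
  move=> /andP[k0 k5]; case: rep => _ _; apply; rewrite !inE groupX // andbT.
  rewrite -order_dvdn (_ : #[x]%g = 5) ?gtnNdvd //; exact: nt_prime_order.
have X2 : X * X = rho (x ^+ 2)%g by rewrite !expgS mulg1 !rhoM.
have X3 : X * X * X = rho (x ^+ 3)%g by rewrite !expgS mulg1 !rhoM ?groupM // mulrA.
have X4 : X * X * X * X = rho (x ^+ 4)%g by rewrite !expgS mulg1 !rhoM ?groupM // !mulrA.
rewrite e2 X4 X3 X2 !unitrMl ?u //; exact: (u 1%N).
Qed.

End FPF.
End FpfRings.

(** * Products of two elements of order 3 *)

Module OrderThreePairs.
Import NcRing ClassEquation FpfRings.
Import GroupScope GRing.Theory.
Local Open Scope ring_scope.

Section SmallTrace.
Variable R : unitRingType.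
(** The traces of elements whose order modulo [<[z]>] is 2, 3, 4 or 5: zero, then 1 or -1, then a
    root of 2, then a root of [t^2 = 1 + t] or its negative. *)
Definition small_trace (t : R) :=
  [\/ t = 0, t = 1, t = - 1 | t * t = 2%:R] \/
  ((5%:R : R) \is a GRing.unit /\ (t * t = 1 - t \/ t * t = 1 + t)).

(** To be applied to the trace t of [y * w]: then [1 - t] and [t^2 - t] are the traces of [y^-1 * w]
    and [y^-1 * y ^ w]. Any other value of t makes one of the three inadmissible, or forces one of
    1, 2, 3, 5 to vanish. *)
Lemma small_trace_eq (t : R) : (2%:R : R) \is a GRing.unit -> (3%:R : R) \is a GRing.unit ->
  small_trace t -> small_trace (1 - t) -> small_trace (t * t - t) ->
  [\/ t = 0, t = 1 | t * t = 1 + t /\ (5%:R : R) \is a GRing.unit].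
Proof.
move=> u2 u3 ht h1 h2.
have no n : (n%:R : R) \is a GRing.unit -> (n%:R : R) <> 0 by move=> u e; rewrite e unitr0 in u.
have n1 := oner_neq0 R.
have div2 (a b : R) : 2%:R * a = 2%:R * b -> a = b by move/(mulrI u2).
have div3 (a b : R) : 3%:R * a = 3%:R * b -> a = b by move/(mulrI u3).
have bad1 (P : Prop) : (1 : R) = 0 -> P by move=> e; case/eqP: n1.
have bad2 (P : Prop) : (2%:R : R) = 0 -> P by move/(no _ u2).
have bad3 (P : Prop) : (3%:R : R) = 0 -> P by move/(no _ u3).
have feq (k a b c : R) : a = b -> c = k * (a - b) -> c = 0.
  by move=> -> ->; rewrite subrr mulr0.
have feq0 (a b : R) : a - b = 0 -> a = b by move/eqP; rewrite subr_eq0 => /eqP.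
case: ht => [[e|e|e|e]|[u5 [e|e]]]; first by constructor 1.
- by constructor 2.
- case: h1 => [[h|h|h|h]|[u5 [h|h]]].
  + apply: bad2; apply: (feq 1 _ _ _ h); nc_prove (tt, e).
  + apply: bad1; apply: (feq 1 _ _ _ h); nc_prove (tt, e).
  + apply: bad3; apply: (feq 1 _ _ _ h); nc_prove (tt, e).
  + apply: bad2; apply: (feq 1 _ _ _ h); nc_prove (tt, e).
  + case: (no _ u5); apply: (feq 1 _ _ _ h); nc_prove (tt, e).
  + apply: bad1; apply: (feq 1 _ _ _ h); nc_prove (tt, e).
- have bt1 : t = 1 -> [\/ t = 0, t = 1 | t * t = 1 + t /\ (5%:R : R) \is a GRing.unit].
    by move=> e'; apply: bad1; apply: (feq (- 1) _ _ _ e); nc_prove (tt, e').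
  case: h1 => [[h|h|h|h]|[u5 [h|h]]].
  + apply: bt1; apply: feq0; apply: (feq (- 1) _ _ _ h); nc_prove tt.
  + have e' : t = 0 by apply: (feq (- 1) _ _ _ h); nc_prove tt.
    apply: bad2; apply: (feq (- 1) _ _ _ e); nc_prove (tt, e').
  + have e' : t = 2%:R by apply: feq0; apply: (feq (- 1) _ _ _ h); nc_prove tt.
    apply: bad2; apply: (feq 1 _ _ _ e); nc_prove (tt, e').
  + have t2 : t + t = 1.
      by apply: feq0; apply: (feq (- 1) _ _ _ h); nc_prove (tt, e).
    have t8 : (t + t) * (t + t) = 8%:R by nc_prove (tt, e).
    (* In characteristic 7 the residue 4 is both one half and a root of 2, so t = 4 passes the
       second test; the third one, on [t^2 - t = -2], excludes it. *)
    have e7 : (7%:R : R) = 0 by apply: (feq 1 _ _ _ (esym t8)); rewrite t2; nc_prove tt.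
    have e' : t = 4%:R.
      apply: feq0; rewrite (_ : _ - _ = 4%:R * (t + t) - 4%:R - 7%:R * t); last by nc_prove tt.
      by rewrite t2 e7 mul0r mulr1 subrr subr0.
    have d : t * t - t = - 2%:R by rewrite e e'; nc_prove tt.
    rewrite d in h2; case: h2 => [[h'|h'|h'|h']|[u5 [h'|h']]].
    * apply: bad2; apply: (feq (- 1) _ _ _ h'); nc_prove tt.
    * apply: bad3; apply: (feq (- 1) _ _ _ h'); nc_prove tt.
    * apply: bad1; apply: (feq (- 1) _ _ _ h'); nc_prove tt.
    * apply: bad2; apply: (feq 1 _ _ _ h'); nc_prove tt.
    * apply: bad1; apply: (feq 1 _ _ _ h'); nc_prove tt.
    * case: (no _ u5); apply: (feq 1 _ _ _ h'); nc_prove tt.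
  + apply: bt1; apply: div3; apply: feq0; apply: (feq (- 1) _ _ _ h); nc_prove (tt, e).
  + apply: bt1; apply: feq0; apply: (feq (- 1) _ _ _ h); nc_prove (tt, e).
- have bt0 : t = 0 -> [\/ t = 0, t = 1 | t * t = 1 + t /\ (5%:R : R) \is a GRing.unit].
    by move=> e'; apply: bad1; apply: (feq (- 1) _ _ _ e); nc_prove (tt, e').
  case: h1 => [[h|h|h|h]|[_ [h|h]]].
  + have e' : t = 1 by apply: feq0; apply: (feq (- 1) _ _ _ h); nc_prove tt.
    apply: bad1; apply: (feq 1 _ _ _ e); nc_prove (tt, e').
  + apply: bt0; apply: (feq (- 1) _ _ _ h); nc_prove tt.
  + have e' : t = 2%:R by apply: feq0; apply: (feq (- 1) _ _ _ h); nc_prove tt.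
    case: (no _ u5); apply: (feq 1 _ _ _ e); nc_prove (tt, e').
  + apply: bt0; apply: div3; rewrite mulr0.
    apply: (feq (- 1) _ _ _ h); nc_prove (tt, e).
  + have t2 : t + t = 1.
      by apply: div2; apply: feq0; apply: (feq (- 1) _ _ _ h); nc_prove (tt, e).
    have t4 : (t + t) * (t + t) + 2%:R * (t + t) = 4%:R by nc_prove (tt, e).
    apply: bad1; apply: (feq (- 1) _ _ _ t4); rewrite t2; nc_prove tt.
  + apply: bt0; apply: div2; rewrite mulr0.
    apply: (feq (- 1) _ _ _ h); nc_prove (tt, e).
- by constructor 3.
Qed.
End SmallTrace.

Section Pairs.
Variables (gT : finGroupType) (L : {group gT}) (R : unitRingType).
Variable rho : gT -> R.
Hypothesis rep : fpf_rep L rho.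
Variable z : gT.
Hypotheses (Lz : z \in L) (oz : #[z]%g = 2%N).

Local Notation tr := (tr rho).

Section TwoOrder3.
Variables y w : gT.
Hypotheses (Ly : y \in L) (Lw : w \in L) (oy : #[y]%g = 3%N) (ow : #[w]%g = 3%N).

Let A := <<[set y; w; z]>>%G.
Let sAL : A \subset L.
Proof. by rewrite gen_subG !subUset !sub1set Ly Lw Lz. Qed.

Let Y := rho y.
Let W := rho w.
Let cent a := a * Y = Y * a /\ a * W = W * a.
(** x' is formally the quaternion conjugate of x: the coefficients are kept, Y and W are replaced by
    their inverses [-1 - Y] and [-1 - W], and the product is reversed. *)
Let quad x x' := exists a b c d, [/\ cent a, cent b, cent c, cent d &
  x = a + b * Y + c * W + d * (Y * W) /\
  x' = a + b * (- 1 - Y) + c * (- 1 - W) + d * ((- 1 - W) * (- 1 - Y))].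

Let YY : Y * Y = - 1 - Y. Proof. by case: (rho_order3 rep Ly oy). Qed.
Let WW : W * W = - 1 - W. Proof. by case: (rho_order3 rep Lw ow). Qed.
Let Yi : rho y^-1%g = - 1 - Y. Proof. by case: (rho_order3 rep Ly oy). Qed.
Let Wi : rho w^-1%g = - 1 - W. Proof. by case: (rho_order3 rep Lw ow). Qed.
Let C := Y * W + W * Y + Y + W.

Let centC : cent C.
Proof. by split; rewrite /C; nc_prove (tt, YY, WW). Qed.

Let centD a b : cent a -> cent b -> cent (a + b).
Proof. by case=> a1 a2 [b1 b2]; split; rewrite mulrDl mulrDr ?a1 ?a2 ?b1 ?b2. Qed.
Let centN a : cent a -> cent (- a).
Proof. by case=> a1 a2; split; rewrite mulNr mulrN ?a1 ?a2. Qed.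
Let centM a b : cent a -> cent b -> cent (a * b).
Proof. by case=> a1 a2 [b1 b2]; split; rewrite -mulrA ?b1 ?b2 !mulrA ?a1 ?a2. Qed.
Let cent1 : cent 1.
Proof. by split; rewrite mul1r mulr1. Qed.
Let cent0 : cent 0.
Proof. by split; rewrite mul0r mulr0. Qed.

Let quadY x x' : quad x x' -> quad (Y * x) (x' * (- 1 - Y)).
Proof.
case=> a [b [c [d [ca cb cc cd [-> ->]]]]].
exists (- b), (a - b), (- d), (c - d); split; try by do ?[apply: centD | apply: centN].
case: ca cb cc cd => [a1 a2] [b1 b2] [c1 c2] [d1 d2].
by split; nc_prove (tt, esym a1, esym a2, esym b1, esym b2, esym c1, esym c2, esym d1, esym d2, YY, WW).
Qed.

Let quadW x x' : quad x x' -> quad (W * x) (x' * (- 1 - W)).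
Proof.
case=> a [b [c [d [ca cb cc cd [-> ->]]]]].
exists (b * C - c + d), (d - b), (a - b - c + d * C + d), (- b).
split; try by do ?[apply: centM => // | apply: centD => // | apply: centN => //].
case: ca cb cc cd => [a1 a2] [b1 b2] [c1 c2] [d1 d2]; rewrite /C.
by split; nc_prove (tt, esym a1, esym a2, esym b1, esym b2, esym c1, esym c2, esym d1, esym d2, YY, WW).
Qed.

Let quadN x x' : quad x x' -> quad (- x) (- x').
Proof.
case=> a [b [c [d [ca cb cc cd [-> ->]]]]].
exists (- a), (- b), (- c), (- d); split; try exact: centN.
by split; nc_prove tt.
Qed.

Let Ainv x : x \in A -> quad (rho x) (rho x^-1%g).
Proof.
case/gen_prodgP=> n [c inS ->{x}].
elim: n c inS => [|n IH] c inS.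
  rewrite big_ord0 invg1 (rho1 rep); exists 1, 0, 0, 0; split=> //.
  by split; nc_prove tt.
rewrite big_ord_recl; set x := (\prod_i _)%g; have /IH: forall i : 'I_n, c (lift ord0 i) \in [set y; w; z] by [].
rewrite -/x => qx; have Ax : x \in L.
  apply: (subsetP sAL); apply: group_prod => i _; exact: mem_gen.
have := inS ord0; rewrite !inE -orbA => /or3P[]/eqP->.
- by rewrite invMg !(rhoM rep) ?groupV // Yi; apply: quadY.
- by rewrite invMg !(rhoM rep) ?groupV // Wi; apply: quadW.
- rewrite (_ : (z * x)^-1 = z * x^-1)%g; first by rewrite !(rho_zM rep Lz oz) ?groupV //; apply: quadN.
  rewrite invMg (_ : z^-1 = z)%g; last by apply: (mulgI z); rewrite mulgV -(expg_order z) oz.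
  by apply/esym/cent1P; rewrite cent1C; apply: (subsetP (z_central rep Lz oz)); rewrite groupV.
Qed.

(** Adding an element to its conjugate leaves an expression in the coefficients and in C, all of
    which commute with Y and W. *)
Let tr_cent x : x \in A -> cent (tr x).
Proof.
case/Ainv=> a [b [c [d [ca cb cc cd [e1 e2]]]]]; rewrite /tr e1 e2.
rewrite [X in cent X](_ : _ = a + a - b - c + d * (C + 1)); last first.
  rewrite /C. nc_prove tt.
by do ?[apply: centM => // | apply: centD => // | apply: centN => //].
Qed.

Let cent_rho a x : cent a -> x \in A -> a * rho x = rho x * a.
Proof.
move=> [a1 a2] /gen_prodgP[n [c inS ->{x}]].
elim: n c inS => [|n IH] c inS; first by rewrite big_ord0 (rho1 rep) mulr1 mul1r.
rewrite big_ord_recl; set x := (\prod_i _)%g.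
have /IH: forall i : 'I_n, c (lift ord0 i) \in [set y; w; z] by [].
rewrite -/x => qx; have Ax : x \in L.
  apply: (subsetP sAL); apply: group_prod => i _; exact: mem_gen.
have := inS ord0; rewrite !inE -orbA => /or3P[]/eqP->; rewrite (rhoM rep) // mulrA.
- by rewrite a1 -mulrA qx mulrA.
- by rewrite a2 -mulrA qx mulrA.
- by rewrite (rho_z rep Lz oz) mulrN1 mulN1r !mulNr qx.
Qed.

Let cent_tr a x : cent a -> x \in A -> a * tr x = tr x * a.
Proof. by move=> ca Ax; rewrite mulrDr mulrDl !cent_rho ?groupV. Qed.

Let unit_diff x : x \in A :\: <[z]> -> rho x - rho x^-1%g \is a GRing.unit.
Proof.
case/setDP=> Ax nx; have Lx := subsetP sAL x Ax.
rewrite (_ : _ - _ = rho x^-1%g * (rho (x * x)%g - 1)); last first.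
  have e := rhoVl rep Lx; rewrite (rhoM rep) //; nc_prove (tt, e).
rewrite unitrMl; last by case: rep => _ _; apply; rewrite !inE groupM // andbT; apply: contra nx => /eqP; apply: (sq1 rep Lz oz).
by apply/unitrP; exists (rho x); rewrite (rhoVl rep) // (rhoVr rep).
Qed.

(** If b commutes with x, then [(rho x - rho x^-1) * rho b] is [tr (x * b) - rho x^-1 * tr b],
    linear in [rho x^-1] with coefficients commuting with A. Two such expressions commute, and the
    factor in front is a unit. *)
Let cent_ab x : x \in A :\: <[z]> -> abelian 'C_A[x]%g.
Proof.
move=> Ax; have Dunit := unit_diff Ax; case/setDP: (Ax) => xA _.
have Lx := subsetP sAL x xA.
have key b : b \in 'C_A[x]%g -> (rho x - rho x^-1%g) * rho b = tr (x * b)%g - rho x^-1%g * tr b.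
  case/setIP=> Ab /cent1P cb; have Lb := subsetP sAL b Ab.
  rewrite /tr (_ : (x * b)^-1 = x^-1 * b^-1)%g; last by rewrite -[in LHS]cb invMg.
  by rewrite !(rhoM rep) ?groupV //; nc_prove tt.
have keyc b : b \in 'C_A[x]%g -> (rho x - rho x^-1%g) * rho b = rho b * (rho x - rho x^-1%g).
  case/setIP=> Ab /cent1P cb; have Lb := subsetP sAL b Ab.
  have c1 : rho x * rho b = rho b * rho x by rewrite -!(rhoM rep) // cb.
  have c2 : rho x^-1%g * rho b = rho b * rho x^-1%g.
    by rewrite -!(rhoM rep) ?groupV //; congr rho; apply: (mulgI x); rewrite mulKVg mulgA -cb mulgK.
  nc_prove (tt, c1, c2).
apply/centsP=> b Cb c Cc; case/setIP: (Cb) => Ab cb; case/setIP: (Cc) => Ac cc.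
have Lb := subsetP sAL b Ab; have Lc := subsetP sAL c Ac.
apply: (rho_inj rep); rewrite ?groupM // !(rhoM rep) //.
apply: (mulrI Dunit); apply: (mulrI Dunit).
set D := _ - _ in Dunit key keyc *.
have k1 := keyc _ Cb; have k2 := keyc _ Cc.
have e1 : D * (D * (rho b * rho c)) = (D * rho b) * (D * rho c).
  nc_prove (tt, k1, k2).
have e2 : D * (D * (rho c * rho b)) = (D * rho c) * (D * rho b).
  nc_prove (tt, k1, k2).
rewrite e1 e2 !key //.
have Axb : (x * b)%g \in A by rewrite groupM.
have Axc : (x * c)%g \in A by rewrite groupM.
have r1 := cent_tr (tr_cent Axb) Axc.
have r2 := cent_tr (tr_cent Axb) Ac.
have r3 := cent_tr (tr_cent Ab) Axc.
have r4 := cent_tr (tr_cent Ab) Ac.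
have xiA : (x^-1)%g \in A by rewrite groupV.
have r5 := cent_rho (tr_cent Axb) xiA.
have r6 := cent_rho (tr_cent Axc) xiA.
have r7 := cent_rho (tr_cent Ab) xiA.
have r8 := cent_rho (tr_cent Ac) xiA.
move: r1 r2 r3 r4 r5 r6 r7 r8; set t1 := tr _; set t2 := tr _; set t3 := tr _; set t4 := tr _.
move: t1 t2 t3 t4 (rho x^-1%g) => t1 t2 t3 t4 X r1 r2 r3 r4 r5 r6 r7 r8.
nc_prove (tt, r1, r2, r3, r4, r5, r6, r7, r8).
Qed.

(** x and [x ^ b] have the same trace, so they are commuting roots of one quadratic equation; unless
    [x * x ^ b] is 1, the factor [rho (x * x ^ b)^-1 - 1] cancels and they agree. *)
Let norm_cent x b : x \in A :\: <[z]> -> b \in A ->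
  (x ^ b \in 'C_A[x] -> x ^ b = x \/ x ^ b = x^-1)%g.
Proof.
move=> /setDP[Ax _] Ab /setIP[Axb /cent1P cxb].
have Lx := subsetP sAL x Ax; have Lb := subsetP sAL b Ab.
have Lxb := subsetP sAL _ Axb.
have e : tr (x ^ b)%g = tr x.
  rewrite /tr -conjVg !(rho_conj rep) ?groupV // -mulrDl -mulrDr -/(tr x).
  by rewrite -(cent_rho (tr_cent Ax)) ?groupV // -mulrA (rhoVl rep) // mulr1.
have [/eqP|ne] := boolP ((x * x ^ b)^-1 == 1)%g.
  by right; apply: (mulgI x); apply: invg_inj; rewrite mulgV invg1.
left; apply: (rho_inj rep) => //; apply/eqP; rewrite -subr_eq0; apply/eqP.
apply: (rho_fix rep (groupVr (groupM Lx Lxb)) ne).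
rewrite -cxb invMg (rhoM rep) ?groupV //.
have e2 := rhoVl rep Lxb.
have e7 : rho x^-1%g * rho (x ^ b)^-1%g * rho x = rho (x ^ b)^-1%g.
  rewrite -!(rhoM rep) ?groupM ?groupV //; congr rho.
  by rewrite -mulgA -(commuteV (commute_sym cxb)) mulKg.
rewrite mulrBr e7 -mulrA e2 mulr1.
have e6 : rho (x ^ b)^-1%g = rho x + rho x^-1%g - rho (x ^ b)%g.
  by rewrite -/(FpfRings.tr rho x) -e /FpfRings.tr addrAC subrr add0r.
nc_prove (tt, e6).
Qed.

Hypothesis ncyw : (w \notin 'C[y])%g.

(** x and z generate an abelian subgroup of ['C_A[x]], of order at most 10, so x has order at most 5
    modulo [<[z]>]. *)
Let order_bound x : x \in A -> exists2 k, (0 < k < 6)%N & (x ^+ k \in <[z]>)%g.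
Proof.
move=> Ax; have [zx|nzx] := boolP (x \in <[z]>)%g; first by exists 1%N.
have Axz : x \in A :\: <[z]> by rewrite inE nzx.
have zA : z \in A by rewrite mem_gen // !inE eqxx orbT.
have yA : y \in A by rewrite mem_gen // !inE eqxx.
have wA : w \in A by rewrite mem_gen // !inE eqxx orbT.
have czA : A \subset 'C[z]%g := subset_trans sAL (z_central rep Lz oz).
have le10 : (#|'C_A[x]| <= 10)%N.
  apply: (class_equation_bound zA oz czA cent_ab norm_cent) => //.
    apply: contra ncyw => /centsP abA; apply/cent1P; exact: abA.
  move=> H sHA iH abH.
  have nsH : H <| A := index2_normal sHA iH.
  (* An element of order 3 equals its fourth power, hence lies in every subgroup of index 2; an
     abelian one would make y and w commute. *)
  have inH a : a \in A -> #[a]%g = 3%N -> a \in H.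
    move=> Aa oa; have : (a ^+ 4 \in H)%g.
      rewrite coset_idr ?(subsetP (normal_norm nsH)) ?groupX //.
      rewrite morphX ?(subsetP (normal_norm nsH)) //.
      apply/eqP; rewrite -order_dvdn; apply: dvdn_trans (order_dvdG (mem_quotient H Aa)) _.
      by rewrite card_quotient ?normal_norm // iH.
    by have := expg_order a; rewrite oa => e; rewrite (expgD a 3 1) e mul1g.
  case/negP: ncyw; apply/cent1P; apply: (centsP abH); exact: inH.
have Cx : x \in 'C_A[x]%g by rewrite inE Ax cent1id.
have Cz : z \in 'C_A[x]%g by rewrite inE zA cent1C (subsetP czA).
have [zx|nz] := boolP (z \in <[x]>)%g.
  have ev : (2 %| #[x])%N by rewrite -oz order_dvdG.
  case/dvdnP: ev => m em; exists m.
    have := order_gt0 x; have : (#[x] <= 10)%N.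
      by apply: leq_trans le10; apply: subset_leq_card; rewrite cycle_subG.
    by rewrite em; clear; lia.
  apply: (sq1 rep Lz oz); first by rewrite groupX // (subsetP sAL).
  by rewrite -expgM -em expg_order.
exists #[x]%g; last by rewrite expg_order group1.
rewrite order_gt0 /=.
have ti : <[x]> :&: <[z]> = 1%g.
  by rewrite setIC prime_TIg ?cycle_subG // -orderE oz.
have cm : <[z]> \subset 'N(<[x]>)%g.
  by apply: cents_norm; rewrite cycle_subG /= cent_cycle; case/setIP: Cz.
have : (#|<[x]> <*> <[z]>| <= 10)%N.
  by apply: leq_trans le10; apply: subset_leq_card; rewrite join_subG !cycle_subG Cx.
by rewrite norm_joinEr // TI_cardMg // -!orderE oz; clear; lia.
Qed.

Lemma order3_trace : small_trace (tr (y * w)%g).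
Proof.
have Ayw : (y * w)%g \in A by rewrite groupM // mem_gen // !inE eqxx ?orbT.
have Lyw : (y * w)%g \in L := subsetP sAL _ Ayw.
have nyw : (y * w)%g \notin <[z]>%g.
  apply: contra ncyw => yw; apply/cent1P.
  have : commute y (y * w)%g.
    apply/cent1P; have: <[z]>%g \subset 'C[y]%g; last by move/subsetP=> /(_ _ yw); rewrite cent1C.
    by rewrite cycle_subG cent1C (subsetP (z_central rep Lz oz)).
  by move=> e; apply: (mulgI y); rewrite mulgA e.
have z1 x : x \in <[z]>%g -> x = 1%g \/ x = z.
  case/cycleP=> i ->; rewrite -(expg_mod i (_ : z ^+ 2 = 1)%g); last by rewrite -(expg_order z) oz.
  by case: (i %% 2)%N (ltn_pmod i (isT : 0 < 2)%N) => [|[|]] // _; [left|right].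
have [k k6] := order_bound Ayw; move: (y * w)%g Lyw nyw => x Lx nx.
have nx1 : x <> 1%g by move=> e; rewrite e group1 in nx.
have Lzx : (z * x)%g \in L by rewrite groupM.
have nzx1 : (z * x)%g <> 1%g.
  by move=> e; case/negP: nx; rewrite -(mulKg z x) e mulg1 groupV cycle_id.
have zz : (z * z = 1)%g by rewrite -(expg_order z) oz.
have zX n : ((z * x) ^+ n = z ^+ n * x ^+ n)%g.
  by apply: expgMn; apply/cent1P; rewrite cent1C (subsetP (z_central rep Lz oz)).
case: k k6 => [|[|[|[|[|[|k]]]]]] // _.
- by rewrite expg1 => xz; rewrite xz in nx.
- case/z1 => e; first by case/negP: nx; apply: (sq1 rep Lz oz).
  by left; constructor 1; apply: (tr4 rep Lz oz).
- case/z1 => e.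
    by left; constructor 3; case: (tr3 rep Lx e).
  left; constructor 2; case: (tr3 rep Lzx) => //; first by rewrite zX e !expgS mulg1 zz mulg1 zz.
  by rewrite (tr_zM rep Lz oz) // => /oppr_inj.
- case/z1 => e.
    have xx : (x ^+ 2 \in <[z]>)%g by apply: (sq1 rep Lz oz); rewrite ?groupX // -expgM.
    case/z1: xx => e'; first by case/negP: nx; apply: (sq1 rep Lz oz).
    by left; constructor 1; apply: (tr4 rep Lz oz).
  left; constructor 4; rewrite (tr_sq rep) //.
  by rewrite (tr4 rep Lz oz) ?add0r ?groupM // -e; apply: esym (expgM x 2 2).
- case/z1 => e; first by case: (tr5 rep Lx e) => // [[e' u]]; right; split; [|left].
  case: (tr5 rep Lzx) => //; first by rewrite zX e !expgS mulg1 zz !mulg1 zz mulg1 zz.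
  rewrite (tr_zM rep Lz oz) // mulrNN opprK => [[e' u]].
  by right; split; [|right].
Qed.

End TwoOrder3.

Lemma unit3 y : y \in L -> #[y]%g = 3%N -> (3%:R : R) \is a GRing.unit.
Proof.
move=> Ly oy; have [yy yi] := rho_order3 rep Ly oy.
have oy' : #[y^-1]%g = 3%N by rewrite orderV.
rewrite (_ : 3%:R = (rho y - 1) * (rho y^-1%g - 1)); last first.
  by rewrite yi; nc_prove (tt, yy).
case: rep => _ _ u; rewrite unitrMl u // !inE ?groupV ?Ly ?andbT -order_eq1 ?oy' ?oy //.
Qed.

(** [rho v] and [rho y] are commuting roots of [t^2 + t + 1]; unless [v * y] is 1, the factor
    [rho (v * y) - 1] cancels. *)
Lemma commuting_order3 y v : y \in L -> v \in L -> #[y]%g = 3%N -> #[v]%g = 3%N ->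
  v \in 'C[y]%g -> v = y \/ v = y^-1%g.
Proof.
move=> Ly Lv oy ov /cent1P cvy.
have [yy yi] := rho_order3 rep Ly oy; have [vv _] := rho_order3 rep Lv ov.
have [->|ne] := eqVneq v y^-1%g; [by right | left].
apply: (rho_inj rep) => //; apply/eqP; rewrite -subr_eq0; apply/eqP.
have ne' : (v * y != 1)%g by apply: contra ne => /eqP e; rewrite -[v](mulgK y) e mul1g.
apply: (rho_fix rep (groupM Lv Ly) ne'); rewrite (rhoM rep) //.
have c : rho v * rho y = rho y * rho v by rewrite -!(rhoM rep) // cvy.
nc_prove (tt, yy, vv, c).
Qed.

(** Otherwise w would normalise [<[y]>] without centralising it, but an element of order 3 cannot
    invert y. *)
Lemma order3_conj_nc y w : y \in L -> w \in L -> #[y]%g = 3%N -> #[w]%g = 3%N ->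
  w \notin 'C[y]%g -> (y ^ w)%g \notin 'C[y]%g.
Proof.
move=> Ly Lw oy ow; apply: contra => c.
have oyw : #[y ^ w]%g = 3%N by rewrite orderJ.
have [e|e] := commuting_order3 Ly (groupJ Ly Lw) oy oyw c.
  by apply/cent1P; apply/esym; rewrite /commute conjgC e.
have e3 : (y ^ (w ^+ 3) = y^-1)%g by rewrite !expgS mulg1 !conjgM e conjVg e invgK e.
have := expg_order w; rewrite ow => w3; rewrite w3 conjg1 in e3.
have y2 : (y ^+ 2 = 1)%g by rewrite expgS expg1 {2}e3 mulgV.
by have : (3 %| 2)%N by rewrite -oy order_dvdn y2.
Qed.

(* The icosahedral alternative: two subgroups of order 3 generate a group of type
   SL(2,3) (trace 0 or 1) or SL(2,5) (trace a golden ratio). *)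
Lemma order3_pair y w : y \in L -> w \in L -> #[y]%g = 3%N -> #[w]%g = 3%N ->
    w \notin 'C[y]%g ->
  [\/ tr (y * w)%g = 0, tr (y * w)%g = 1
   | tr (y * w)%g * tr (y * w)%g = 1 + tr (y * w)%g /\ (5%:R : R) \is a GRing.unit].
Proof.
move=> Ly Lw oy ow nc.
have [yy yi] := rho_order3 rep Ly oy; have [ww wi] := rho_order3 rep Lw ow.
have oyi : #[y^-1]%g = 3%N by rewrite orderV.
have nci : w \notin 'C[y^-1]%g.
  by apply: contra nc => /cent1P/commuteV; rewrite invgK => /cent1P.
have oyw : #[y ^ w]%g = 3%N by rewrite orderJ.
have Lyw : (y ^ w)%g \in L by rewrite groupJ.
have e1 : tr (y^-1 * w)%g = 1 - tr (y * w)%g.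
  rewrite /tr !invMg invgK !(rhoM rep) ?groupV // yi wi; nc_prove (tt, yy, ww).
have e2 : tr (y^-1 * y ^ w)%g = tr (y * w)%g * tr (y * w)%g - tr (y * w)%g.
  rewrite /tr (invMg (y^-1)%g (y ^ w)%g) (invMg y w) invgK -conjVg !(rhoM rep) ?groupM ?groupV //.
  by rewrite yi wi; nc_prove (tt, yy, ww).
apply: small_trace_eq; [exact: (unit2 rep Lz oz)|exact: unit3 Ly oy|exact: order3_trace| |].
  by rewrite -e1; apply: order3_trace => //; rewrite groupV.
rewrite -e2; apply: order3_trace => //; first by rewrite groupV.
apply: contra (order3_conj_nc Ly Lw oy ow nc) => /cent1P/commuteV.
by rewrite invgK => /cent1P.
Qed.

Lemma order3_conj_trace y w : y \in L -> w \in L -> #[y]%g = 3%N -> #[w]%g = 3%N ->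
  tr (y * y ^ w)%g = 1 + tr (y * w)%g - tr (y * w)%g * tr (y * w)%g.
Proof.
move=> Ly Lw oy ow.
have [yy yi] := rho_order3 rep Ly oy; have [ww wi] := rho_order3 rep Lw ow.
rewrite /tr (invMg y (y ^ w)%g) (invMg y w) -conjVg !(rhoM rep) ?groupM ?groupV //.
by rewrite yi wi; nc_prove (tt, yy, ww).
Qed.
End Pairs.
End OrderThreePairs.

(** * Coordinates with respect to a quaternion frame *)

Module QuaternionCoordinates.
Import NcRing ClassEquation FpfRings OrderThreePairs.
Import GroupScope GRing.Theory.
Local Open Scope ring_scope.

Section Quat.
Variables (R : unitRingType) (I J : R).
Hypotheses (u2 : (2%:R : R) \is a GRing.unit) (u3 : (3%:R : R) \is a GRing.unit).
Hypotheses (II : I * I = - 1) (JJ : J * J = - 1) (JI : J * I = - (I * J)).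

Definition qcomm (a : R) := a * I = I * a /\ a * J = J * a.

Lemma half_inj (a b : R) : a + a = b + b -> a = b.
Proof. by move=> e; apply: (mulrI u2); rewrite !mulr_natl !mulr2n. Qed.

Lemma half0 (a : R) : a + a = 0 -> a = 0.
Proof. by move=> e; apply: half_inj; rewrite e addr0. Qed.

(** The map [pi] averages over conjugation by the quaternion group of I and J, so its values commute
    with I and J; the coordinates are the averages of U, -IU, -JU and -IJU. *)
Lemma quat_decomp U : exists b0 b1 b2 b3,
  [/\ qcomm b0, qcomm b1, qcomm b2, qcomm b3 & U = b0 + I * b1 + J * b2 + I * J * b3].
Proof.
have [h hc hh] : exists2 h : R, forall a, h * a = a * h & h + h = 1.
  exists 2%:R^-1; first by move=> a; apply/commr_sym/commrV/commr_nat.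
  by rewrite -[RHS](mulrV u2) mulr_natl mulr2n.
have h4 a : h * h * (a + a + a + a) = a.
  rewrite (_ : _ * _ = (h + h) * (h + h) * a); last by have c := hc a; nc_prove tt.
  by rewrite hh !mul1r.
pose pi a := h * h * (a - I * a * I - J * a * J - I * J * a * (I * J)).
have qpi a : qcomm (pi a).
  have cI := hc I; have cJ := hc J.
  by split; rewrite /pi; nc_prove (tt, II, JJ, JI, cI, cJ).
exists (pi U), (pi (- (I * U))), (pi (- (J * U))), (pi (- (I * J * U))).
split; try exact: qpi.
rewrite -[LHS]h4 /pi; have cI := hc I; have cJ := hc J; have cU := hc U.
nc_prove (tt, II, JJ, JI, cI, cJ, cU).
Qed.

Lemma quat_comp0 a b c d : qcomm a -> qcomm b -> qcomm c -> qcomm d ->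
  a + I * b + J * c + I * J * d = 0 -> [/\ a = 0, b = 0, c = 0 & d = 0].
Proof.
move=> [a1 a2] [b1 b2] [c1 c2] [d1 d2] e.
pose pi (X : R) := X - I * X * I - J * X * J - I * J * X * (I * J).
have four (x : R) : x + x + (x + x) = 0 -> x = 0 by move=> e0; apply: half0; apply: half0.
have pi0 (X : R) : X = 0 -> pi X = 0 by move=> ->; rewrite /pi !(mulr0, mul0r, subr0).
split; apply: four.
- rewrite -(pi0 _ e) /pi; nc_prove (tt, II, JJ, JI, a1, a2, b1, b2, c1, c2, d1, d2).
- have e1 : - (I * (a + I * b + J * c + I * J * d)) = 0 by rewrite e mulr0 oppr0.
  rewrite -(pi0 _ e1) /pi.
  nc_prove (tt, II, JJ, JI, a1, a2, b1, b2, c1, c2, d1, d2).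
- have e1 : - (J * (a + I * b + J * c + I * J * d)) = 0 by rewrite e mulr0 oppr0.
  rewrite -(pi0 _ e1) /pi.
  nc_prove (tt, II, JJ, JI, a1, a2, b1, b2, c1, c2, d1, d2).
- have e1 : - (I * J * (a + I * b + J * c + I * J * d)) = 0 by rewrite e mulr0 oppr0.
  rewrite -(pi0 _ e1) /pi.
  nc_prove (tt, II, JJ, JI, a1, a2, b1, b2, c1, c2, d1, d2).
Qed.

(* The possible values of half the anticommutator of 2 rho y + 1 and 2 rho w + 1. *)
Definition good (e : R) := [\/ e = 1, e = - 1 | e * e = 5%:R /\ (5%:R : R) \is a GRing.unit].

Lemma scalar_b0 b0 s S : qcomm b0 -> qcomm s -> qcomm S ->
  (I + J + I * J) * b0 - S = s -> b0 = 0.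
Proof.
move=> [a1 a2] [c1 c2] [d1 d2] e.
have e0 : (I + J + I * J) * b0 - S - s = 0 by rewrite e subrr.
suff [] : [/\ - S - s = 0, b0 = 0, b0 = 0 & b0 = 0] by [].
apply: quat_comp0; try by [].
  by split; nc_prove (tt, c1, c2, d1, d2).
by rewrite -e0; nc_prove tt.
Qed.

Lemma sq5_comp b0 S : qcomm b0 -> qcomm S ->
  ((I + J + I * J) * b0 - S) * ((I + J + I * J) * b0 - S) = 5%:R ->
  S * S = 5%:R + 3%:R * (b0 * b0) /\ b0 * S + S * b0 = 0.
Proof.
move=> qb qS e; have [[a1 a2] [d1 d2]] := (qb, qS).
have e0 : S * S - 3%:R * (b0 * b0) - 5%:R + I * - (b0 * S + S * b0) + J * - (b0 * S + S * b0)
      + I * J * - (b0 * S + S * b0) = 0.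
  rewrite -[RHS](subrr 5%:R) -[X in _ = X - _]e.
  nc_prove (tt, II, JJ, JI, a1, a2, d1, d2).
have qx : qcomm (- (b0 * S + S * b0)) by split; nc_prove (tt, a1, a2, d1, d2).
have [||||E1 E2 _ _] := quat_comp0 _ _ _ _ e0 => //.
  by split; nc_prove (tt, a1, a2, d1, d2).
split; last by apply/eqP; rewrite -oppr_eq0 E2.
by apply/eqP; rewrite -subr_eq0 -E1; apply/eqP; nc_prove tt.
Qed.

(** The coordinates need not commute with one another, so the imaginary components of the square
    express the commutators of b1, b2, b3 through anticommutators with b0. As soon as b0 vanishes
    they commute. *)
Lemma quat_sq b0 b1 b2 b3 U : qcomm b0 -> qcomm b1 -> qcomm b2 -> qcomm b3 ->
  U = b0 + I * b1 + J * b2 + I * J * b3 -> U * U = - 3%:R ->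
  [/\ b1 * b1 + b2 * b2 + b3 * b3 = 3%:R + b0 * b0,
      b2 * b3 - b3 * b2 = - (b0 * b1 + b1 * b0),
      b3 * b1 - b1 * b3 = - (b0 * b2 + b2 * b0)
    & b1 * b2 - b2 * b1 = - (b0 * b3 + b3 * b0)].
Proof.
move=> [a1 a2] [c1 c2] [d1 d2] [f1 f2] -> e.
have mv (x y : R) : y - x = 0 -> x = y by move/eqP; rewrite subr_eq0 => /eqP.
suff [h1 h2 h3 h4] : [/\ 3%:R + b0 * b0 - (b1 * b1 + b2 * b2 + b3 * b3) = 0,
   (b2 * b3 - b3 * b2) + (b0 * b1 + b1 * b0) = 0,
   (b3 * b1 - b1 * b3) + (b0 * b2 + b2 * b0) = 0
  & (b1 * b2 - b2 * b1) + (b0 * b3 + b3 * b0) = 0].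
  by split; [exact: mv| apply/eqP; rewrite -addr_eq0 h2| apply/eqP; rewrite -addr_eq0 h3| apply/eqP; rewrite -addr_eq0 h4].
apply: quat_comp0; try by split; nc_prove (tt, a1, a2, c1, c2, d1, d2, f1, f2).
rewrite -[RHS](addNr 3%:R) -e.
nc_prove (tt, II, JJ, JI, a1, a2, c1, c2, d1, d2, f1, f2).
Qed.

End Quat.

Section Alternatives.
Variable R : unitRingType.
Hypotheses (u2 : (2%:R : R) \is a GRing.unit) (u3 : (3%:R : R) \is a GRing.unit).

Lemma eq_sub0 (a b : R) : a - b = 0 -> a = b.
Proof. by move/eqP; rewrite subr_eq0 => /eqP. Qed.

Lemma combine0 (k a b c : R) : a = b -> c = k * (a - b) -> c = 0.
Proof. by move=> -> ->; rewrite subrr mulr0. Qed.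

Lemma pow2_neq0 n (P : Prop) : ((2 ^ n)%:R : R) = 0 -> P.
Proof.
move=> e; have : ((2 ^ n)%:R : R) \is a GRing.unit by rewrite natrX unitrX.
by rewrite e unitr0.
Qed.

(** If s and s' were equal, g' would be -2s - g; comparing squares gives g = -s and hence 5 = 1. *)
Lemma scalars_opposite (s s' g g' : R) : s = 1 \/ s = - 1 -> s' = 1 \/ s' = - 1 ->
  g * g = 5%:R -> g' * g' = 5%:R -> s + s' + g + g' = 0 -> s + s' = 0.
Proof.
move=> hs hs' gg gg' e.
have eg' : g' = - (s + s') - g.
  by apply: eq_sub0; apply: (combine0 (k := 1) e); nc_prove tt.
case: hs hs' => -> [] -> in e eg' *; rewrite ?subrr ?addNr //.
  have g1 : g = - 1.
    apply: (half_inj u2); apply: (half_inj u2); apply: eq_sub0.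
    by apply: (combine0 (k := 1) gg'); rewrite eg'; nc_prove (tt, gg).
  by apply: (@pow2_neq0 2); apply: (combine0 (k := - 1) gg); rewrite g1; nc_prove tt.
have g1 : g = 1.
  apply: (half_inj u2); apply: (half_inj u2); apply: eq_sub0.
  by apply: (combine0 (k := - 1) gg'); rewrite eg'; nc_prove (tt, gg).
by apply: (@pow2_neq0 2); apply: (combine0 (k := - 1) gg); rewrite g1; nc_prove tt.
Qed.


(** Up to signs, a golden ratio and its inverse: the nonzero coordinates of a dodecahedron vertex
    off the inscribed cube. *)
Definition golden_pair (a b : R) :=
  (5%:R : R) \is a GRing.unit /\
  (((a + b = 1 \/ a + b = - 1) /\ (a - b) * (a - b) = 5%:R) \/
   ((a - b = 1 \/ a - b = - 1) /\ (a + b) * (a + b) = 5%:R)).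

Lemma good_split (e : R) : good e ->
  ((e = 1 \/ e = - 1) /\ e * e = 1) \/ (e * e = 5%:R /\ (5%:R : R) \is a GRing.unit).
Proof.
case=> [->|->|h]; [left|left|by right]; split; rewrite ?mulrNN ?mulr1 //; [by left|by right].
Qed.

(** The four values sum to 0, and their squares, each 1 or 5, sum to 12; so two of them are 1 or -1
    and two are roots of 5, and [scalars_opposite] makes a coordinate vanish. In all other cases the
    discrepancy is 4 or 8, a unit. *)
Lemma three_coords (a b c : R) : b * a = a * b -> c * a = a * c -> c * b = b * c ->
  a * a + b * b + c * c = 3%:R ->
  good (a + b + c) -> good (a - b - c) -> good (- a + b - c) -> good (- a - b + c) ->
  [\/ a = 0 /\ golden_pair b c, b = 0 /\ golden_pair c a | c = 0 /\ golden_pair a b].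
Proof.
move=> ba ca cb sq g1 g2 g3 g4.
set S1 := a + b + c in g1; set S2 := a - b - c in g2.
set S3 := - a + b - c in g3; set S4 := - a - b + c in g4.
have sum4 : S1 + S2 + S3 + S4 = 0 by rewrite /S1 /S2 /S3 /S4; nc_prove tt.
have cc : c * c = 3%:R - a * a - b * b by rewrite -sq; nc_prove tt.
have sumsq : S1 * S1 + S2 * S2 + S3 * S3 + S4 * S4 = 12%:R.
  by rewrite /S1 /S2 /S3 /S4; nc_prove (tt, ba, ca, cb, cc).
have S12 : S1 + S2 = a + a by rewrite /S1 /S2; nc_prove tt.
have S34 : S3 + S4 = - a - a by rewrite /S3 /S4; nc_prove tt.
have S13 : S1 + S3 = b + b by rewrite /S1 /S3; nc_prove tt.
have S24 : S2 + S4 = - b - b by rewrite /S2 /S4; nc_prove tt.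
have S14 : S1 + S4 = c + c by rewrite /S1 /S4; nc_prove tt.
have S23 : S2 + S3 = - c - c by rewrite /S2 /S3; nc_prove tt.
have opp0 (x : R) : - x - x = 0 -> x = 0.
  by move=> e; apply/eqP; rewrite -oppr_eq0; apply/eqP; apply: (half0 u2).
have pmN (x : R) : x = 1 \/ x = - 1 -> - x = 1 \/ - x = - 1.
  by case=> ->; [right|left; rewrite opprK].
case: (good_split g1) => [[h1 q1]|[q1 v5]]; case: (good_split g2) => [[h2 q2]|[q2 v5']];
case: (good_split g3) => [[h3 q3]|[q3 v5'']]; case: (good_split g4) => [[h4 q4]|[q4 v5''']];
rewrite q1 q2 q3 q4 in sumsq.
- by apply: (@pow2_neq0 3); apply: (combine0 (k := - 1) sumsq); nc_prove tt.
- by apply: (@pow2_neq0 2); apply: (combine0 (k := - 1) sumsq); nc_prove tt.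
- by apply: (@pow2_neq0 2); apply: (combine0 (k := - 1) sumsq); nc_prove tt.
- have a0 : a = 0.
    by apply: (half0 u2); rewrite -S12; apply: (scalars_opposite h1 h2 q3 q4).
  constructor 1; split=> //; split=> //; left; split.
    by move: h1; rewrite /S1 a0 add0r.
  by move: q3; rewrite /S3 a0 oppr0 add0r.
- by apply: (@pow2_neq0 2); apply: (combine0 (k := - 1) sumsq); nc_prove tt.
- have b0 : b = 0.
    apply: (half0 u2); rewrite -S13; apply: (scalars_opposite h1 h3 q2 q4).
    by rewrite -sum4; nc_prove tt.
  constructor 2; split=> //; split=> //; left; split.
    by move: h1; rewrite /S1 b0 addr0 addrC.
  by move: q2; rewrite /S2 b0 subr0 => q2; rewrite -q2; nc_prove tt.
- have c0 : c = 0.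
    apply: (half0 u2); rewrite -S14; apply: (scalars_opposite h1 h4 q2 q3).
    by rewrite -sum4; nc_prove tt.
  constructor 3; split=> //; split=> //; left; split.
    by move: h1; rewrite /S1 c0 addr0.
  by move: q2; rewrite /S2 c0 subr0.
- by apply: (@pow2_neq0 2); apply: (combine0 (k := 1) sumsq); nc_prove tt.
- by apply: (@pow2_neq0 2); apply: (combine0 (k := - 1) sumsq); nc_prove tt.
- have c0 : c = 0.
    apply: opp0; rewrite -S23; apply: (scalars_opposite h2 h3 q1 q4).
    by rewrite -sum4; nc_prove tt.
  constructor 3; split=> //; split=> //; right; split.
    by move: h2; rewrite /S2 c0 subr0.
  by move: q1; rewrite /S1 c0 addr0.
- have b0 : b = 0.
    apply: opp0; rewrite -S24; apply: (scalars_opposite h2 h4 q1 q3).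
    by rewrite -sum4; nc_prove tt.
  constructor 2; split=> //; split=> //; right; split.
    by move: (pmN _ h2); rewrite /S2 b0 subr0 opprB.
  by move: q1; rewrite /S1 b0 addr0 => q1; rewrite -q1; nc_prove tt.
- by apply: (@pow2_neq0 2); apply: (combine0 (k := 1) sumsq); nc_prove tt.
- have a0 : a = 0.
    apply: opp0; rewrite -S34; apply: (scalars_opposite h3 h4 q1 q2).
    by rewrite -sum4; nc_prove tt.
  constructor 1; split=> //; split=> //; right; split.
    by move: h3; rewrite /S3 a0 oppr0 add0r.
  by move: q1; rewrite /S1 a0 add0r.
- by apply: (@pow2_neq0 2); apply: (combine0 (k := 1) sumsq); nc_prove tt.
- by apply: (@pow2_neq0 2); apply: (combine0 (k := 1) sumsq); nc_prove tt.
- by apply: (@pow2_neq0 3); apply: (combine0 (k := 1) sumsq); nc_prove tt.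
Qed.

End Alternatives.
End QuaternionCoordinates.

(** * Excluding and comparing golden coordinates *)

Module GoldenValues.
Import NcRing ClassEquation FpfRings OrderThreePairs QuaternionCoordinates.
Import GroupScope GRing.Theory.
Local Open Scope ring_scope.

(** The extra values 3 and -3 belong to the commuting pairs, y with its inverse and y with
    itself. *)
Definition good3 (R : unitRingType) (e : R) := [\/ good e, e = 3%:R | e = - 3%:R].

Section AllGolden.
Variables (R : unitRingType) (I J b0 b1 b2 b3 U : R).
Hypotheses (u2 : (2%:R : R) \is a GRing.unit) (u3 : (3%:R : R) \is a GRing.unit).
Hypotheses (II : I * I = - 1) (JJ : J * J = - 1) (JI : J * I = - (I * J)).
Hypotheses (q0 : qcomm I J b0) (q1 : qcomm I J b1) (q2 : qcomm I J b2) (q3 : qcomm I J b3).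
Hypothesis (eU : U = b0 + I * b1 + J * b2 + I * J * b3) (UU : U * U = - 3%:R).

Lemma qcommN a : qcomm I J a -> [/\ qcomm I (- J) a, qcomm (- I) J a & qcomm (- I) (- J) a].
Proof. by case=> a1 a2; split; split; rewrite ?mulrN ?mulNr ?a1 ?a2. Qed.

Lemma qcommD a b : qcomm I J a -> qcomm I J b -> qcomm I J (a + b).
Proof. by case=> a1 a2 [c1 c2]; split; rewrite mulrDl mulrDr ?a1 ?a2 ?c1 ?c2. Qed.

Lemma qcommV a : qcomm I J a -> qcomm I J (- a).
Proof. by case=> a1 a2; split; rewrite mulNr mulrN ?a1 ?a2. Qed.

Let sq5 e := e * e = 5%:R :> R.
Hypothesis g1 : sq5 ((I + J + I * J) * b0 - (b1 + b2 + b3)).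
Hypothesis g2 : sq5 ((I - J - I * J) * b0 - (b1 - b2 - b3)).
Hypothesis g3 : sq5 ((- I + J - I * J) * b0 - (- b1 + b2 - b3)).
Hypothesis g4 : sq5 ((- I - J + I * J) * b0 - (- b1 - b2 + b3)).

(** The imaginary parts of the four equations make b0 anticommute with b1, b2, b3, which therefore
    commute by [quat_sq]. The real parts sum to 4 (3 + b0^2) = 4 (5 + 3 b0^2), whence b0^2 = -1, and
    their differences kill the mixed products. *)
Lemma all_golden_coords :
  [/\ [/\ b0 * b0 = - 1, b1 * b0 = - (b0 * b1), b2 * b0 = - (b0 * b2) & b3 * b0 = - (b0 * b3)],
      [/\ b1 * b2 = 0, b2 * b1 = 0, b1 * b3 = 0 & b3 * b1 = 0],
      b2 * b3 = 0 /\ b3 * b2 = 0 & b1 * b1 + b2 * b2 + b3 * b3 = 2%:R].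
Proof.
have qs1 : qcomm I J (b1 + b2 + b3) by do ?apply: qcommD.
have qs2 : qcomm I J (b1 - b2 - b3) by do ?apply: qcommD => //; apply: qcommV.
have qs3 : qcomm I J (- b1 + b2 - b3) by do ?apply: qcommD => //; apply: qcommV.
have qs4 : qcomm I J (- b1 - b2 + b3) by do ?apply: qcommD => //; apply: qcommV.
have [p1 p2 p3] := qcommN q0.
have [s1 c1] := sq5_comp u2 II JJ JI q0 qs1 g1.
have [s2 c2] : (b1 - b2 - b3) * (b1 - b2 - b3) = 5%:R + 3%:R * (b0 * b0) /\
    b0 * (b1 - b2 - b3) + (b1 - b2 - b3) * b0 = 0.
  have [r1 r2 r3] := qcommN qs2.
  apply: (@sq5_comp _ I (- J) u2) => //; rewrite ?mulrNN ?mulNr ?mulrN ?JI //.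
have [s3 c3] : (- b1 + b2 - b3) * (- b1 + b2 - b3) = 5%:R + 3%:R * (b0 * b0) /\
    b0 * (- b1 + b2 - b3) + (- b1 + b2 - b3) * b0 = 0.
  have [r1 r2 r3] := qcommN qs3.
  apply: (@sq5_comp _ (- I) J u2) => //; rewrite ?mulrNN ?mulNr ?mulrN ?JI //.
have [s4 c4] : (- b1 - b2 + b3) * (- b1 - b2 + b3) = 5%:R + 3%:R * (b0 * b0) /\
    b0 * (- b1 - b2 + b3) + (- b1 - b2 + b3) * b0 = 0.
  have [r1 r2 r3] := qcommN qs4.
  apply: (@sq5_comp _ (- I) (- J) u2) => //; rewrite ?mulrNN ?mulNr ?mulrN ?opprK ?JI //.
have ac b c d : b0 * c + c * b0 = 0 -> b0 * d + d * b0 = 0 -> c + d = b + b -> b * b0 = - (b0 * b).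
  move=> e1 e2 e3; apply: eq_sub0; apply: (half0 u2).
  transitivity (b0 * (c + d) + (c + d) * b0); first by rewrite e3; nc_prove tt.
  rewrite -[RHS](addr0 0) -{1}e1 -e2; nc_prove tt.
have a1 : b1 * b0 = - (b0 * b1) by apply: (ac _ _ _ c1 c2); nc_prove tt.
have a2 : b2 * b0 = - (b0 * b2) by apply: (ac _ _ _ c1 c3); nc_prove tt.
have a3 : b3 * b0 = - (b0 * b3) by apply: (ac _ _ _ c1 c4); nc_prove tt.
have [e1 e2 e3 e4] := quat_sq u2 II JJ JI q0 q1 q2 q3 eU UU.
have k1 : b3 * b2 = b2 * b3 by apply/esym/eq_sub0; rewrite e2 a1 subrr oppr0.
have k2 : b3 * b1 = b1 * b3 by apply/eq_sub0; rewrite e3 a2 subrr oppr0.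
have k3 : b2 * b1 = b1 * b2 by apply/esym/eq_sub0; rewrite e4 a3 subrr oppr0.
have e0 : b0 * b0 = - 1.
  apply: eq_sub0; do 3!apply: (half0 u2).
  rewrite (_ : _ + _ = 4%:R * ((b1 * b1 + b2 * b2 + b3 * b3) - (3%:R + b0 * b0)) -
    (((b1 + b2 + b3) * (b1 + b2 + b3) - (5%:R + 3%:R * (b0 * b0))) +
     ((b1 - b2 - b3) * (b1 - b2 - b3) - (5%:R + 3%:R * (b0 * b0))) +
     ((- b1 + b2 - b3) * (- b1 + b2 - b3) - (5%:R + 3%:R * (b0 * b0))) +
     ((- b1 - b2 + b3) * (- b1 - b2 + b3) - (5%:R + 3%:R * (b0 * b0))))).
    by rewrite s1 s2 s3 s4 e1 !subrr mulr0 !addr0 subr0.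
  nc_prove (tt, k1, k2, k3).
have z1 : b1 * b2 + b1 * b3 = 0.
  do 2!apply: (half0 u2); rewrite -[RHS](subrr ((b1 + b2 + b3) * (b1 + b2 + b3))) [X in _ - X]s1 -s2.
  nc_prove (tt, k1, k2, k3).
have z2 : b1 * b2 + b2 * b3 = 0.
  do 2!apply: (half0 u2); rewrite -[RHS](subrr ((b1 + b2 + b3) * (b1 + b2 + b3))) [X in _ - X]s1 -s3.
  nc_prove (tt, k1, k2, k3).
have z3 : b1 * b3 + b2 * b3 = 0.
  do 2!apply: (half0 u2); rewrite -[RHS](subrr ((b1 + b2 + b3) * (b1 + b2 + b3))) [X in _ - X]s1 -s4.
  nc_prove (tt, k1, k2, k3).
have y1 : b1 * b2 = 0.
  apply: (half0 u2); rewrite (_ : _ + _ = (b1 * b2 + b1 * b3) + (b1 * b2 + b2 * b3) - (b1 * b3 + b2 * b3)).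
    by rewrite z1 z2 z3 subr0 addr0.
  nc_prove tt.
have y2 : b1 * b3 = 0 by move: z1; rewrite y1 add0r.
have y3 : b2 * b3 = 0 by move: z2; rewrite y1 add0r.
rewrite e1 e0 k1 k2 k3 y1 y2 y3; split=> //; nc_prove tt.
Qed.

(** The conjugate of U by I pairs with U to [1 - 2 b1^2]. Multiplying the sum of squares by b1^2
    gives [b1^4 = 2 b1^2]; with zero divisors this alone does not force 0 or 2, but together with
    the list of admissible f it does. *)
Lemma all_golden_sq f : U * (I * U * I) + I * U * I * U = - f - f -> good3 f ->
  b1 * b1 = 0 \/ b1 * b1 = 2%:R.
Proof.
have [[e0 a1 a2 a3] [y1 y1' y2 y2'] [y3 y3'] e] := all_golden_coords.
move=> ef gf.
have e3 : b3 * b3 = 2%:R - b1 * b1 - b2 * b2 by rewrite -e; nc_prove tt.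
have [q01 q02] := q0; have [q11 q12] := q1; have [q21 q22] := q2; have [q31 q32] := q3.
have f1 : f = 1 - b1 * b1 - b1 * b1.
  apply: (half_inj u2); apply: oppr_inj; rewrite opprD -ef eU.
  nc_prove (tt, II, JJ, JI, q01, q02, q11, q12, q21, q22, q31, q32, e0, a1, a2, a3, y1, y1', y2, y2', y3, y3', e3).
have b4 : b1 * b1 * (b1 * b1) = b1 * b1 + b1 * b1.
  rewrite -[RHS](_ : b1 * b1 * (b1 * b1 + b2 * b2 + b3 * b3) = _).
    by nc_prove (tt, y1, y2).
  by rewrite e; nc_prove tt.
have no1 : b1 * b1 = 1 -> b1 * b1 = 0 \/ b1 * b1 = 2%:R.
  by move=> e1; apply: (@pow2_neq0 _ u2 0); apply: (combine0 (k := - 1) b4); rewrite e1; nc_prove tt.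
case: gf => [[h|h|[h _]]|h|h]; rewrite f1 in h.
- by left; apply: (half0 u2); apply: (combine0 (k := - 1) h); nc_prove tt.
- by apply: no1; apply: (half_inj u2); apply: eq_sub0; apply: (combine0 (k := - 1) h); nc_prove tt.
- apply: no1; do 2!apply: (half_inj u2); apply: eq_sub0; apply: (combine0 (k := 1) h).
  have b4' : b1 * b1 * b1 * b1 = b1 * b1 + b1 * b1 by rewrite -b4 !mulrA.
  nc_prove (tt, b4').
- have e1 : b1 * b1 = - 1.
    by apply: (half_inj u2); apply: eq_sub0; apply: (combine0 (k := - 1) h); nc_prove tt.
  have : 3%:R = 0 :> R by apply: (combine0 (k := 1) b4); rewrite e1; nc_prove tt.
  by move=> e30; case/negP: (negbT (unitr0 R)); rewrite -e30.
- by right; apply: (half_inj u2); apply: eq_sub0; apply: (combine0 (k := - 1) h); nc_prove tt.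
Qed.

End AllGolden.

Section AxialGolden.
Variables (R : unitRingType) (I J b0 b1 U : R).
Hypotheses (u2 : (2%:R : R) \is a GRing.unit) (u3 : (3%:R : R) \is a GRing.unit).
Hypotheses (II : I * I = - 1) (JJ : J * J = - 1) (JI : J * I = - (I * J)).
Hypotheses (q0 : qcomm I J b0) (q1 : qcomm I J b1).
Hypotheses (eU : U = b0 + I * b1) (e0 : b0 * b0 = - 1) (e1 : b1 * b1 = 2%:R)
  (e01 : b1 * b0 = - (b0 * b1)).

(** V is the conjugate by y of the frame axis [I + J + I * J], paired with another axis. The value
    is [1 + c] with [c = (b0 + 1) * b1] and [c^2 = 4]; among the admissible values only c = 2 or -2
    resists, and that would turn b0 into -1. *)
Lemma axial_golden_absurd V e : 4%:R * V = (- U - 1) * (I + J + I * J) * (U - 1) ->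
  V * (- I + J - I * J) + (- I + J - I * J) * V = e + e -> good3 e -> False.
Proof.
move=> eV ee ge; have [q01 q02] := q0; have [q11 q12] := q1.
pose c := (b0 + 1) * b1.
have ee' : e = 1 + c.
  do 3!apply: (half_inj u2).
  rewrite (_ : e + e + (e + e) + (e + e + (e + e)) = 4%:R * (e + e)); last by nc_prove tt.
  rewrite -ee mulrDr mulrA eV (_ : 4%:R * _ = (- I + J - I * J) * (4%:R * V)); last by nc_prove tt.
  rewrite eV eU /c.
  nc_prove (tt, II, JJ, JI, q01, q02, q11, q12, e0, e1, e01).
have cc : c * c = 4%:R by rewrite /c; nc_prove (tt, e0, e1, e01).
have bad3 : (3%:R : R) = 0 -> False by move=> e30; case/negP: (negbT (unitr0 R)); rewrite -e30.
have c0 : c = 0 -> False.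
  by move=> ec; apply: (@pow2_neq0 _ u2 2); apply: (combine0 (k := - 1) cc); rewrite ec; nc_prove tt.
have cs s : s * s = 1 -> s * b0 = b0 * s -> s * b1 = b1 * s -> c = s + s -> False.
  move=> ss s0 s1 ec.
  have eb1 : b1 = s - s * b0.
    apply: (half_inj u2); transitivity ((1 - b0) * c); first by rewrite /c; nc_prove (tt, e0).
    by rewrite ec; nc_prove (tt, s0).
  have eb0 : b0 = - 1.
    apply: (half_inj u2); apply: eq_sub0; apply: (combine0 (k := - 1) e1); rewrite eb1.
    nc_prove (tt, s0, ss, e0).
  by apply: (@pow2_neq0 _ u2 1); apply: (combine0 (k := 1) e0); rewrite eb0; nc_prove tt.
case: ge => [[h|h|[h _]]|h|h]; rewrite ee' in h.
- by apply: c0; apply: (combine0 (k := 1) h); nc_prove tt.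
- apply: (cs (- 1)); rewrite ?mulrNN ?mulr1 ?mulrN1 ?mulN1r //.
  by apply: eq_sub0; apply: (combine0 (k := 1) h); nc_prove tt.
- apply: c0; apply: (half0 u2); apply: (combine0 (k := 1) h); nc_prove (tt, cc).
- apply: (cs 1); rewrite ?mulr1 ?mul1r //.
  by apply: eq_sub0; apply: (combine0 (k := 1) h); nc_prove tt.
- have ec : c = - 4%:R by apply: eq_sub0; apply: (combine0 (k := 1) h); nc_prove tt.
  apply: bad3; do 2!apply: (half0 u2); apply: (combine0 (k := 1) cc); rewrite ec; nc_prove tt.
Qed.

End AxialGolden.

Section GoldenUnique.
Variables (R : unitRingType) (I J r s U U' V2 V3 e1 e2 e3 : R).
Hypotheses (u2 : (2%:R : R) \is a GRing.unit) (u3 : (3%:R : R) \is a GRing.unit).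
Hypothesis u5 : (5%:R : R) \is a GRing.unit.
Hypotheses (II : I * I = - 1) (JJ : J * J = - 1) (JI : J * I = - (I * J)).
Hypotheses (qr : qcomm I J r) (qs : qcomm I J s).
Hypotheses (rr : r * r = 5%:R) (ss : s * s = 5%:R).
Hypotheses (eU : U + U = J * (1 + r) + I * J * (1 - r))
  (eU' : U' + U' = J * (1 + s) + I * J * (1 - s))
  (eV2 : V2 + V2 = J * (1 + s) - I * J * (1 - s))
  (eV3 : V3 + V3 = I * J * (1 + s) + I * (1 - s)).
Hypotheses (E1 : U * U' + U' * U = e1 + e1) (E2 : U * V2 + V2 * U = e2 + e2)
  (E3 : U * V3 + V3 * U = e3 + e3).
Hypotheses (g1 : good3 e1) (g2 : good3 e2) (g3 : good3 e3).

(** The value -3 will mean that the two elements coincide. The roots r and s need not commute, but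
    [g = r * s + s * r] is determined by e1, and [16 e2^2 = (10 + g) (14 - g)] together with the
    components of e2 refutes every other e1 except 1. There e2^2 = 5 is consistent, and the pairing
    e3 with a rotated element decides. *)
Lemma golden_unique : e1 = - 3%:R.
Proof.
have [r1 r2] := qr; have [s1 s2] := qs.
have bad3 (P : Prop) : (3%:R : R) = 0 -> P.
  by move=> e30; case/negP: (negbT (unitr0 R)); rewrite -e30.
have bad5 (P : Prop) : (5%:R : R) = 0 -> P.
  by move=> e30; case/negP: (negbT (unitr0 R)); rewrite -e30.
have bad2 n (P : Prop) : ((2 ^ n)%:R : R) = 0 -> P by move=> e0; exact (@pow2_neq0 _ u2 n P e0).
have four (A B e : R) : A * B + B * A = e + e ->
   8%:R * e = (A + A) * (B + B) + (B + B) * (A + A).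
  by move=> h; transitivity (4%:R * (e + e)); [nc_prove tt | rewrite -h; nc_prove tt].
pose g := r * s + s * r.
have f1 : 4%:R * e1 = - 2%:R - g.
  apply: (half_inj u2); transitivity (8%:R * e1); first by nc_prove tt.
  rewrite (four _ _ _ E1) eU eU' /g; nc_prove (tt, II, JJ, JI, r1, r2, s1, s2, rr, ss).
have f2 : 4%:R * e2 = - 2%:R * (r + s) + I * (r * s - s * r).
  apply: (half_inj u2); transitivity (8%:R * e2); first by nc_prove tt.
  rewrite (four _ _ _ E2) eU eV2; nc_prove (tt, II, JJ, JI, r1, r2, s1, s2, rr, ss).
pose G := r * s - s * r.
have f3 : 8%:R * e3 = (I + J + I * J) * G - (2%:R - r - r + s + s - g).
  rewrite (four _ _ _ E3) eU eV3 /g /G; nc_prove (tt, II, JJ, JI, r1, r2, s1, s2, rr, ss).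
have qG : qcomm I J G by split; rewrite /G; nc_prove (tt, r1, r2, s1, s2).
have [G1 G2] := qG.
have gg : g * g = G * G + 100%:R by rewrite /g /G; nc_prove (tt, rr, ss).
have rg : g * r = r * g by rewrite /g; nc_prove (tt, rr, ss).
have sg : g * s = s * g by rewrite /g; nc_prove (tt, rr, ss).
have rG : G * r = - (r * G) by rewrite /G; nc_prove (tt, rr, ss).
have sG : G * s = - (s * G) by rewrite /G; nc_prove (tt, rr, ss).
have f22 : 16%:R * (e2 * e2) = (10%:R + g) * (14%:R - g).
  transitivity ((4%:R * e2) * (4%:R * e2)); first by nc_prove tt.
  rewrite f2 -/G.
  have -> : (10%:R + g) * (14%:R - g) = 140%:R + 4%:R * g - (G * G + 100%:R) by rewrite -gg; nc_prove tt.
  rewrite /g; nc_prove (tt, II, G1, G2, r1, r2, s1, s2, rr, ss, rG, sG).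
have cases : good3 e2 -> [\/ e2 * e2 = 1, e2 * e2 = 5%:R | e2 = 3%:R \/ e2 = - 3%:R].
  case=> [[->|->|[h _]]|h|h]; [constructor 1|constructor 1|constructor 2|constructor 3|constructor 3];
  rewrite ?mulrNN ?mulr1 //; [by left|by right].
have sq2 : good3 e2 -> [\/ e2 * e2 = 1, e2 * e2 = 5%:R | e2 * e2 = 9%:R].
  case/cases=> [->|->|[]->]; [by constructor 1|by constructor 2|constructor 3|constructor 3]; nc_prove tt.
case: g1 => [[h|h|[h _]]|h|h] //.
- (* g = - 6 *)
  have eg : g = - 6%:R by apply: eq_sub0; apply: (combine0 (k := 1) f1); rewrite h; nc_prove tt.
  have GG : G * G = - 64%:R by apply: eq_sub0; apply: (combine0 (k := - 1) gg); rewrite eg; nc_prove tt.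
  have G0 : G = 0 -> False.
    by move=> e; apply: (@bad2 6); apply: (combine0 (k := 1) GG); rewrite e; nc_prove tt.
  exfalso.
  pose X := - (8%:R - r - r + s + s).
  have f3' : 8%:R * e3 = (I + J + I * J) * G + X by rewrite f3 eg /X; nc_prove tt.
  have qX : qcomm I J X by split; rewrite /X; nc_prove (tt, r1, r2, s1, s2).
  have [X1 X2] := qX.
  have scal c : qcomm I J c -> 8%:R * e3 = c -> False.
    move=> [c1 c2] ec; apply: G0.
    suff [] : [/\ X - c = 0, G = 0, G = 0 & G = 0] by [].
    apply: (quat_comp0 u2 II JJ JI) => //; first by split; nc_prove (tt, X1, X2, c1, c2).
    by apply: (combine0 (k := - 1) f3'); rewrite ec; nc_prove tt.
  have qn n : qcomm I J (n%:R) by split; rewrite commr_nat.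
  have qN n : qcomm I J (- n%:R) by case: (qn n) => ? ?; split; rewrite mulNr mulrN commr_nat.
  case: g3 => [[k|k|[k _]]|k|k].
  + by apply: (scal 8%:R) => //; rewrite k mulr1.
  + by apply: (scal (- 8%:R)) => //; rewrite k mulrN1.
  + have : 320%:R = ((I + J + I * J) * G + X) * ((I + J + I * J) * G + X).
      by rewrite -f3'; transitivity (64%:R * (e3 * e3)); [rewrite k; nc_prove tt | nc_prove tt].
    move=> k2.
    have XG : G * X + X * G = - 16%:R * G by rewrite /X; nc_prove (tt, rG, sG).
    have qXX : qcomm I J (G * X + X * G).
      by rewrite XG; split; nc_prove (tt, G1, G2).
    have [] : [/\ X * X - 3%:R * (G * G) - 320%:R = 0, G * X + X * G = 0, G * X + X * G = 0 & G * X + X * G = 0].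
      apply: (quat_comp0 u2 II JJ JI) => //.
        by split; nc_prove (tt, X1, X2, G1, G2).
      by apply: (combine0 (k := - 1) k2); nc_prove (tt, II, JJ, JI, X1, X2, G1, G2).
    rewrite XG => _ e16 _ _; apply: G0; do 4!apply: (half0 u2).
    by rewrite -[RHS]oppr0 -e16; nc_prove tt.
  + by apply: (scal 24%:R) => //; rewrite k; nc_prove tt.
  + by apply: (scal (- 24%:R)) => //; rewrite k; nc_prove tt.
- (* g = 2 *)
  have eg : g = 2%:R by apply: eq_sub0; apply: (combine0 (k := 1) f1); rewrite h; nc_prove tt.
  rewrite eg in f22; case: (cases g2) => [k|k|k].
  + by apply: (@bad2 7); apply: (combine0 (k := - 1) f22); rewrite k; nc_prove tt.
  + by apply: (@bad2 6); apply: (combine0 (k := - 1) f22); rewrite k; nc_prove tt.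
  + have [c [qc ec cc0]] : exists c, [/\ qcomm I J c, 4%:R * e2 = c & c * c = 144%:R].
      by case: k => ->; [exists 12%:R | exists (- 12%:R)]; split; try nc_prove tt;
        split; rewrite ?mulNr ?mulrN commr_nat.
    have [c1 c2] := qc.
    have [] : [/\ - 2%:R * (r + s) - c = 0, G = 0, (0 : R) = 0 & (0 : R) = 0].
      apply: (quat_comp0 u2 II JJ JI) => //; try by split; rewrite ?mulr0 ?mul0r.
        by split; nc_prove (tt, r1, r2, s1, s2, c1, c2).
      by rewrite !mulr0 !addr0; apply: (combine0 (k := - 1) f2); rewrite ec -/G; nc_prove tt.
    move=> _ eG _ _; rewrite eG eg in gg.
    exfalso; apply: bad3; do 5!apply: (half0 u2).
    by apply: (combine0 (k := - 1) gg); nc_prove tt.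
- (* g = - 2 - 4 e1 *)
  have eg : g = - 2%:R - 4%:R * e1 by rewrite f1; nc_prove tt.
  rewrite eg in f22; exfalso.
  have e1c (x : R) : x * x = 1 \/ x * x = 9%:R -> e1 = x -> False.
    case=> xx ex; rewrite ex xx in h.
      by apply: (@bad2 2); apply: (combine0 (k := - 1) h); nc_prove tt.
    by apply: (@bad2 2); apply: (combine0 (k := 1) h); nc_prove tt.
  case: (sq2 g2) => k; rewrite k in f22.
  + apply: (e1c 1); first by left; rewrite mulr1.
    do 5!apply: (half_inj u2); apply: eq_sub0; apply: (combine0 (k := 1) f22).
    nc_prove (tt, h).
  + apply: (e1c (- 1)); first by left; rewrite mulrNN mulr1.
    do 5!apply: (half_inj u2); apply: eq_sub0; apply: (combine0 (k := 1) f22).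
    nc_prove (tt, h).
  + apply: (e1c (- 3%:R)); first by right; nc_prove tt.
    do 5!apply: (half_inj u2); apply: eq_sub0; apply: (combine0 (k := 1) f22).
    nc_prove (tt, h).
- (* g = - 14 *)
  have eg : g = - 14%:R by apply: eq_sub0; apply: (combine0 (k := 1) f1); rewrite h; nc_prove tt.
  rewrite eg in f22; exfalso; case: (sq2 g2) => k; rewrite k in f22.
  + by apply: (@bad2 7); apply: (combine0 (k := 1) f22); nc_prove tt.
  + by apply: bad3; do 6!apply: (half0 u2); apply: (combine0 (k := 1) f22); nc_prove tt.
  + by apply: (@bad2 8); apply: (combine0 (k := 1) f22); nc_prove tt.
Qed.

End GoldenUnique.
End GoldenValues.

(** * Elements of order 3 and quaternion frames in L *)

Module Frames.
Import NcRing ClassEquation FpfRings OrderThreePairs QuaternionCoordinates GoldenValues.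
Import GroupScope GRing.Theory.
Local Open Scope ring_scope.

Section Frames.
Variables (gT : finGroupType) (L : {group gT}) (R : unitRingType).
Variable rho : gT -> R.
Hypothesis rep : fpf_rep L rho.
Variable z : gT.
Hypotheses (Lz : z \in L) (oz : #[z]%g = 2%N).

Local Notation tr := (tr rho).
Let u2 := unit2 rep Lz oz.

Definition order3 := [set y in L | #[y]%g == 3%N].
(** Twice the imaginary part of the quaternion [rho y]; for y of order 3 its square is -3. *)
Definition pure y := rho y + rho y + 1.
Definition pair_value y w := tr (y * w)%g + tr (y * w)%g - 1.

Lemma order3P y : y \in order3 -> y \in L /\ #[y]%g = 3%N.
Proof. by rewrite inE => /andP[? /eqP]. Qed.

Lemma order3V y : y \in order3 -> y^-1%g \in order3.
Proof. by rewrite !inE groupV orderV. Qed.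

Lemma order3J y x : x \in L -> y \in order3 -> (y ^ x)%g \in order3.
Proof. by rewrite !inE orderJ => Lx /andP[Ly ->]; rewrite groupJ. Qed.

Lemma pure_sq y : y \in order3 -> pure y * pure y = - 3%:R.
Proof.
by case/order3P=> Ly oy; have [yy _] := rho_order3 rep Ly oy; rewrite /pure; nc_prove (tt, yy).
Qed.

Lemma pureV y : y \in order3 -> pure y^-1%g = - pure y.
Proof.
by case/order3P=> Ly oy; have [_ yi] := rho_order3 rep Ly oy; rewrite /pure yi; nc_prove tt.
Qed.

Lemma pureJ y x : x \in L -> y \in L -> pure (y ^ x)%g = rho x^-1%g * pure y * rho x.
Proof.
by move=> Lx Ly; rewrite /pure (rho_conj rep) //; have e := rhoVl rep Lx; nc_prove (tt, e).
Qed.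

Lemma pure_pair y w : y \in order3 -> w \in order3 ->
  pure y * pure w + pure w * pure y = pair_value y w + pair_value y w.
Proof.
move=> /order3P[Ly oy] /order3P[Lw ow].
have [yy yi] := rho_order3 rep Ly oy; have [ww wi] := rho_order3 rep Lw ow.
rewrite /pair_value /pure /FpfRings.tr invMg !(rhoM rep) ?groupV // yi wi; nc_prove (tt, yy, ww).
Qed.

Lemma pair_good y w : y \in order3 -> w \in order3 -> w \notin 'C[y]%g -> good (pair_value y w).
Proof.
move=> /order3P[Ly oy] /order3P[Lw ow] nc; rewrite /pair_value.
case: (order3_pair rep Lz oz Ly Lw oy ow nc) => [->|->|[e v5]].
- by constructor 2; nc_prove tt.
- by constructor 1; nc_prove tt.
- by constructor 3; split=> //; nc_prove (tt, e).
Qed.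

Lemma u3 y : y \in order3 -> (3%:R : R) \is a GRing.unit.
Proof. by case/order3P=> Ly oy; apply: (unit3 rep Ly oy). Qed.

Lemma pair_same y : y \in order3 -> pair_value y y = - 3%:R.
Proof. by move=> Yy; apply: (half_inj u2); rewrite -pure_pair // pure_sq //; nc_prove tt. Qed.

Lemma pair_inv y : y \in order3 -> pair_value y y^-1%g = 3%:R.
Proof.
move=> Yy; apply: (half_inj u2); rewrite -pure_pair ?order3V // pureV //.
by rewrite mulrN mulNr pure_sq //; nc_prove tt.
Qed.

Lemma pair_good3 y w : y \in order3 -> w \in order3 -> good3 (pair_value y w).
Proof.
move=> Yy Yw; have [/order3P[Ly oy] /order3P[Lw ow]] := (Yy, Yw).
have [c|nc] := boolP (w \in 'C[y]%g); last by constructor 1; apply: pair_good.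
by case: (commuting_order3 rep Ly Lw oy ow c) => ->;
  [constructor 3; apply: pair_same | constructor 2; apply: pair_inv].
Qed.

(** The other admissible values differ from -3 by 4, 2 or 6, or have square 5 instead of 9, and 2
    and 3 are units. *)
Lemma pair_eqN3 y w : y \in order3 -> w \in order3 -> pair_value y w = - 3%:R -> w = y.
Proof.
move=> Yy Yw e; have [/order3P[Ly oy] /order3P[Lw ow]] := (Yy, Yw).
have u3 := u3 Yy.
have bad2 n (P : Prop) : ((2 ^ n)%:R : R) = 0 -> P by move=> e0; exact (@pow2_neq0 _ u2 n P e0).
have [c|nc] := boolP (w \in 'C[y]%g); last first.
  case: (pair_good Yy Yw nc) => [h|h|[h _]]; rewrite e in h.
  - by apply: (@bad2 2); apply: (combine0 (k := - 1) h); nc_prove tt.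
  - by apply: (@bad2 1%N); apply: (combine0 (k := - 1) h); nc_prove tt.
  - by apply: (@bad2 2); apply: (combine0 (k := 1) h); nc_prove tt.
case: (commuting_order3 rep Ly Lw oy ow c) => // ew.
have e30 : 3%:R = 0 :> R.
  by apply: (half0 u2); move: e; rewrite ew pair_inv // => e; apply: (combine0 (k := 1) e); nc_prove tt.
by case/negP: (negbT (unitr0 R)); rewrite -e30.
Qed.

(** [rho i] and [rho j] are anticommuting roots of -1, and [rho p = (-1 + I + J + I J) / 2] is the
    unit quaternion of order 3 rotating i, j and ij. *)
Definition frame i j p :=
  [/\ [/\ i \in L, j \in L & p \in order3],
      [/\ rho i * rho i = - 1, rho j * rho j = - 1 & rho j * rho i = - (rho i * rho j)]
    & pure p = rho i + rho j + rho i * rho j].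

Lemma frame_cyc i j p : frame i j p -> frame j (i * j)%g p.
Proof.
case=> [[Li Lj Yp] [ii jj ji] ep]; split; first by split; rewrite ?groupM.
  by rewrite !(rhoM rep) //; split=> //; nc_prove (tt, ii, jj, ji).
by rewrite ep !(rhoM rep) //; nc_prove (tt, ii, jj, ji).
Qed.

Lemma rhoN_inv i : i \in L -> rho i * rho i = - 1 -> rho i^-1%g = - rho i.
Proof.
move=> Li ii; rewrite -[LHS]mulr1 -[1]opprK -ii mulrN mulrA (rhoVl rep) // mul1r //.
Qed.

(** Trace 0 makes [rho (p * q)] a root of -1, and together with its conjugate by p it generates a
    quaternion group. The factor z gives the components of [pure p] the sign +. *)
Lemma frame_of p q : p \in order3 -> q \in order3 -> tr (p * q)%g = 0 ->
  frame (z * (p * q))%g ((z * (p * q)) ^ p)%g p.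
Proof.
move=> Yp Yq t0; have [[Lp op] [Lq oq]] := (order3P Yp, order3P Yq).
have [pp pi] := rho_order3 rep Lp op; have [qq qi] := rho_order3 rep Lq oq.
have qp : rho q * rho p = - 1 - rho p - rho q - rho p * rho q.
  apply: eq_sub0; rewrite -t0 /FpfRings.tr invMg !(rhoM rep) ?groupV // pi qi; nc_prove tt.
have Li : (z * (p * q))%g \in L by rewrite !groupM.
have ei : rho (z * (p * q))%g = - (rho p * rho q) by rewrite (rho_zM rep Lz oz) ?groupM // (rhoM rep).
have ej : rho ((z * (p * q)) ^ p)%g = (- 1 - rho p) * - (rho p * rho q) * rho p.
  by rewrite (rho_conj rep) // pi ei.
split; first by split; rewrite ?groupJ.
  by rewrite ej ei; split; nc_prove (tt, pp, qq, qp).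
by rewrite ej ei /pure; nc_prove (tt, pp, qq, qp).
Qed.

(** Inverting y turns trace 1 into 0; for a golden trace t the pair y, [y ^ w] has trace
    [1 + t - t^2 = 0]. *)
Lemma exists_trace0 y w : y \in order3 -> w \in order3 -> w \notin 'C[y]%g ->
  exists p q, [/\ p \in order3, q \in order3 & tr (p * q)%g = 0].
Proof.
move=> Yy Yw nc; have [[Ly oy] [Lw ow]] := (order3P Yy, order3P Yw).
case: (order3_pair rep Lz oz Ly Lw oy ow nc) => [e|e|[e _]]; first by exists y, w.
  have [yy yi] := rho_order3 rep Ly oy; have [ww wi] := rho_order3 rep Lw ow.
  exists y^-1%g, w; split; rewrite ?order3V //.
  rewrite -[RHS](subrr 1) -[X in _ - X]e /FpfRings.tr !invMg invgK !(rhoM rep) ?groupV // yi wi.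
  nc_prove (tt, yy, ww).
exists y, (y ^ w)%g; split; rewrite ?order3J //.
by rewrite (order3_conj_trace rep) // e subrr.
Qed.


Lemma frame_jij i j p : frame i j p -> (j * (i * j) = i)%g.
Proof.
case=> [[Li Lj _] [ii jj ji] _]; apply: (rho_inj rep); rewrite ?groupM //.
by rewrite !(rhoM rep) ?groupM //; nc_prove (tt, ii, jj, ji).
Qed.

Lemma frame_cyc2 i j p : frame i j p -> frame (i * j)%g i p.
Proof. by move=> F; rewrite -{2}(frame_jij F); do 2!apply: frame_cyc. Qed.

Lemma qcomm_cyc i j b : i \in L -> j \in L -> qcomm (rho i) (rho j) b ->
  qcomm (rho j) (rho (i * j)%g) b /\ qcomm (rho (i * j)%g) (rho i) b.
Proof.
move=> Li Lj [b1 b2]; rewrite (rhoM rep) //.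
by split; split=> //; rewrite mulrA b1 -mulrA b2 mulrA.
Qed.

(** Conjugation by i, j or ij changes two of the three signs of [pure p], which gives the four
    diagonals of the cube. *)
Lemma frame_values i j p y b0 b1 b2 b3 (I := rho i) (J := rho j) : frame i j p ->
    y \in order3 -> qcomm I J b0 -> qcomm I J b1 -> qcomm I J b2 -> qcomm I J b3 ->
    pure y = b0 + I * b1 + J * b2 + I * J * b3 ->
  [/\ (I + J + I * J) * b0 - (b1 + b2 + b3) = pair_value p y,
      (I - J - I * J) * b0 - (b1 - b2 - b3) = pair_value (p ^ i)%g y,
      (- I + J - I * J) * b0 - (- b1 + b2 - b3) = pair_value (p ^ j)%g y
    & (- I - J + I * J) * b0 - (- b1 - b2 + b3) = pair_value (p ^ (i * j))%g y].
Proof.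
move=> [[Li Lj Yp] [ii jj ji] ep] Yy [a1 a2] [c1 c2] [d1 d2] [f1 f2] eU.
have [Lp _] := order3P Yp.
have e1 := rhoN_inv Li ii; have e2 := rhoN_inv Lj jj.
have ij : rho (i * j)%g * rho (i * j)%g = - 1.
  by rewrite (rhoM rep) //; nc_prove (tt, ii, jj, ji).
have e3 := rhoN_inv (groupM Li Lj) ij.
split; apply: (half_inj u2); rewrite -pure_pair ?order3J ?groupM // ?pureJ ?groupM // ?e1 ?e2 ?e3
  ?(rhoM rep) // ep eU /I /J.
- nc_prove (tt, ii, jj, ji, a1, a2, c1, c2, d1, d2, f1, f2).
- nc_prove (tt, ii, jj, ji, a1, a2, c1, c2, d1, d2, f1, f2).
- nc_prove (tt, ii, jj, ji, a1, a2, c1, c2, d1, d2, f1, f2).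
- nc_prove (tt, ii, jj, ji, a1, a2, c1, c2, d1, d2, f1, f2).
Qed.

(** If b1^2 were 2, the vanishing products would give b2 = b3 = 0, and the conjugate of p by y would
    contradict [axial_golden_absurd]. *)
Lemma golden_b1 i j p y b0 b1 b2 b3 (I := rho i) (J := rho j) : frame i j p ->
    y \in order3 -> qcomm I J b0 -> qcomm I J b1 -> qcomm I J b2 -> qcomm I J b3 ->
    pure y = b0 + I * b1 + J * b2 + I * J * b3 ->
    pair_value p y * pair_value p y = 5%:R ->
    pair_value (p ^ i)%g y * pair_value (p ^ i)%g y = 5%:R ->
    pair_value (p ^ j)%g y * pair_value (p ^ j)%g y = 5%:R ->
    pair_value (p ^ (i * j))%g y * pair_value (p ^ (i * j))%g y = 5%:R ->
  b1 * b1 = 0 /\ b1 * b1 + b2 * b2 + b3 * b3 = 2%:R.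
Proof.
move=> F Yy q0 q1 q2 q3 eU g1 g2 g3 g4.
have [v1 v2 v3 v4] := frame_values F Yy q0 q1 q2 q3 eU.
rewrite -v1 in g1; rewrite -v2 in g2; rewrite -v3 in g3; rewrite -v4 in g4.
have [[Li Lj Yp] [ii jj ji] ep] := F; have [Lp op] := order3P Yp; have [Ly oy] := order3P Yy.
have t3 := u3 Yy; have UU := pure_sq Yy.
have [[e0 a1 a2 a3] [y1 y1' y2 y2'] [y3 y3'] e] := all_golden_coords u2 ii jj ji q0 q1 q2 q3 eU UU g1 g2 g3 g4.
split=> //.
have [//|b11] : b1 * b1 = 0 \/ b1 * b1 = 2%:R.
  apply: (all_golden_sq u2 t3 ii jj ji q0 q1 q2 q3 eU UU g1 g2 g3 g4 _ (pair_good3 Yy (order3J Li Yy))).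
  rewrite -[RHS](_ : - (pair_value y (y ^ i)%g + pair_value y (y ^ i)%g) = _); last by nc_prove tt.
  rewrite -pure_pair ?order3J // pureJ // rhoN_inv //; nc_prove tt.
exfalso.
have b20 : b2 = 0.
  apply: (half0 u2); transitivity (b1 * b1 * b2); first by rewrite b11; nc_prove tt.
  by rewrite -mulrA y1 mulr0.
have b30 : b3 = 0.
  apply: (half0 u2); transitivity (b1 * b1 * b3); first by rewrite b11; nc_prove tt.
  by rewrite -mulrA y2 mulr0.
rewrite b20 b30 !mulr0 !addr0 in eU.
have [yy yi] := rho_order3 rep Ly oy.
have Ypy := order3J Ly Yp; have Ypj := order3J Lj Yp.
apply: (@axial_golden_absurd _ (rho i) (rho j) b0 b1 (pure y) u2 t3 ii jj ji q0 q1 eU e0 b11 a1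
   (pure (p ^ y)%g) (pair_value (p ^ y)%g (p ^ j)%g)).
- rewrite pureJ // yi ep /pure; nc_prove tt.
- rewrite -pure_pair // [pure (p ^ j)%g]pureJ // rhoN_inv // ep.
  move: (pure _) => V; nc_prove (tt, ii, jj, ji).
- exact: pair_good3.
Qed.

(** The point is b0 = 0. If one of the four values is 1 or -1, comparing components suffices.
    Otherwise all are roots of 5, and [golden_b1] for the three rotations of the frame kills squares
    whose sum is 2. *)
Lemma outside_coords i j p y (I := rho i) (J := rho j) : frame i j p -> y \in order3 ->
    y \notin 'C[p]%g -> y \notin 'C[p ^ i]%g -> y \notin 'C[p ^ j]%g ->
    y \notin 'C[p ^ (i * j)]%g ->
  exists b1 b2 b3, [/\ [/\ qcomm I J b1, qcomm I J b2 & qcomm I J b3],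
    pure y = I * b1 + J * b2 + I * J * b3, b1 + b2 + b3 = - pair_value p y
  & [\/ b1 = 0 /\ golden_pair b2 b3, b2 = 0 /\ golden_pair b3 b1 | b3 = 0 /\ golden_pair b1 b2]].
Proof.
move=> F Yy n1 n2 n3 n4; have [[Li Lj Yp] [ii jj ji] ep] := F.
have g1 := pair_good Yp Yy n1; have g2 := pair_good (order3J Li Yp) Yy n2.
have g3 := pair_good (order3J Lj Yp) Yy n3.
have g4 := pair_good (order3J (groupM Li Lj) Yp) Yy n4.
have [b0 [b1 [b2 [b3 [q0 q1 q2 q3 eU]]]]] := quat_decomp u2 ii jj ji (pure y).
have [v1 v2 v3 v4] := frame_values F Yy q0 q1 q2 q3 eU.
have UU := pure_sq Yy.
have qs1 : qcomm I J (b1 + b2 + b3) by do ?apply: qcommD.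
have qs2 : qcomm I J (b1 - b2 - b3) by do ?apply: qcommD => //; apply: qcommV.
have qs3 : qcomm I J (- b1 + b2 - b3) by do ?apply: qcommD => //; apply: qcommV.
have qs4 : qcomm I J (- b1 - b2 + b3) by do ?apply: qcommD => //; apply: qcommV.
suff b00 : b0 = 0.
  rewrite b00 !mulr0 !sub0r in v1 v2 v3 v4; rewrite b00 add0r in eU.
  have gN e e' : - e = e' -> good e' -> good e.
    move=> <- [h|h|[h v5]]; [constructor 2|constructor 1|constructor 3].
    - by rewrite -h opprK.
    - by rewrite -[e]opprK h opprK.
    - by rewrite mulrNN in h.
  exists b1, b2, b3; split=> //; first by rewrite -v1 opprK.
  rewrite b00 in q0; have eU0 : pure y = 0 + I * b1 + J * b2 + I * J * b3 by rewrite add0r.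
  have [e1 e2 e3 e4] := quat_sq u2 ii jj ji q0 q1 q2 q3 eU0 UU.
  apply: three_coords => //; last 1 first; [exact: gN v4 g4| | | | |exact: gN v1 g1|exact: gN v2 g2|exact: gN v3 g3].
  - by apply/esym/eq_sub0; rewrite e4 mul0r mulr0 addr0 oppr0.
  - by apply/eq_sub0; rewrite e3 mul0r mulr0 addr0 oppr0.
  - by apply/esym/eq_sub0; rewrite e2 mul0r mulr0 addr0 oppr0.
  - by rewrite e1 mul0r addr0.
have qpm e : e = 1 \/ e = - 1 -> qcomm I J e.
  by case=> ->; split; rewrite ?mulN1r ?mulrN1 ?mul1r ?mulr1.
have [p1 p2 p3] := qcommN q0.
case: (good_split g1) => [[h1 _]|[h1 _]].
  exact: (scalar_b0 u2 ii jj ji q0 (qpm _ h1) qs1 v1).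
case: (good_split g2) => [[h2 _]|[h2 _]].
  have [r1 _ _] := qcommN qs2; have [r2 _ _] := qcommN (qpm _ h2).
  apply: (@scalar_b0 _ I (- J) u2 ii _ _ b0 _ _ p1 r2 r1); rewrite ?mulrNN ?mulNr ?mulrN ?ji //.
case: (good_split g3) => [[h3 _]|[h3 _]].
  have [_ r1 _] := qcommN qs3; have [_ r2 _] := qcommN (qpm _ h3).
  apply: (@scalar_b0 _ (- I) J u2 _ jj _ b0 _ _ p2 r2 r1); rewrite ?mulrNN ?mulNr ?mulrN ?ji //.
case: (good_split g4) => [[h4 _]|[h4 _]].
  have [_ _ r1] := qcommN qs4; have [_ _ r2] := qcommN (qpm _ h4).
  apply: (@scalar_b0 _ (- I) (- J) u2 _ _ _ b0 _ _ p3 r2 r1); rewrite ?mulrNN ?mulNr ?mulrN ?opprK ?ji //.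
exfalso.
have [z1 sum] := golden_b1 F Yy q0 q1 q2 q3 eU h1 h2 h3 h4.
have [[[[s0 t0] [s1 t1]] [s2 t2]] [s3 t3]] := (qcomm_cyc Li Lj q0, qcomm_cyc Li Lj q1, qcomm_cyc Li Lj q2, qcomm_cyc Li Lj q3).
have [z2 _] : b2 * b2 = 0 /\ b2 * b2 + b3 * b3 + b1 * b1 = 2%:R.
  apply: (golden_b1 (frame_cyc F) Yy s0 s2 s3 s1) => //; last by rewrite (frame_jij F).
  by rewrite eU !(rhoM rep) // /I /J; nc_prove (tt, ii, jj, ji).
have [z3 _] : b3 * b3 = 0 /\ b3 * b3 + b1 * b1 + b2 * b2 = 2%:R.
  apply: (golden_b1 (frame_cyc2 F) Yy t0 t3 t1 t2) => //.
    by rewrite eU !(rhoM rep) // /I /J; nc_prove (tt, ii, jj, ji).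
  have -> : (i * j * i = j)%g.
    apply: (rho_inj rep); rewrite ?groupM //.
    by rewrite !(rhoM rep) ?groupM //; nc_prove (tt, ii, jj, ji).
  by [].
apply: (@pow2_neq0 _ u2 1); apply: (combine0 (k := - 1) sum).
by rewrite z1 z2 z3; nc_prove tt.
Qed.

(* In the quaternion frame (i, j) such a y is (J phi - IJ phi^-1 - 1) / 2 with phi a
   golden ratio: r plays the role of the square root of 5. *)
Definition normal3 i j y := y \in order3 /\
  exists r, [/\ qcomm (rho i) (rho j) r, r * r = 5%:R &
    pure y + pure y = rho j * (1 + r) + rho i * rho j * (1 - r)].

Lemma normal3_unique i j p y y' : frame i j p -> (5%:R : R) \is a GRing.unit ->
  normal3 i j y -> normal3 i j y' -> y' = y.
Proof.
move=> F u5 [Yy [r [qr rr er]]] [Yy' [s [qs ss es]]].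
have [[Li Lj Yp] [ii jj ji] ep] := F; have [Lp op] := order3P Yp.
have [Ly' oy'] := order3P Yy'.
have [s1 s2] := qs.
have Yj := order3J Lj Yy'; have Yp' := order3J Lp Yy'.
apply: (pair_eqN3 Yy Yy').
apply: (@golden_unique _ (rho i) (rho j) r s (pure y) (pure y') (pure (y' ^ j)%g) (pure (y' ^ p)%g)
   (pair_value y y') (pair_value y (y' ^ j)%g) (pair_value y (y' ^ p)%g)) => //;
  try exact: pure_pair; try exact: pair_good3; first exact: (u3 Yy).
- rewrite pureJ // rhoN_inv //.
  transitivity (- rho j * (pure y' + pure y') * rho j); first by nc_prove tt.
  by rewrite es; nc_prove (tt, ii, jj, ji, s1, s2).
- rewrite pureJ //; have [pp pi] := rho_order3 rep Lp op; rewrite pi.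
  do 2!apply: (half_inj u2).
  transitivity ((- pure p - 1) * (pure y' + pure y') * (pure p - 1)); first by rewrite /(pure p); nc_prove tt.
  by rewrite es ep; nc_prove (tt, ii, jj, ji, s1, s2).
Qed.

(** Inversion changes both signs and conjugation by j that of the IJ coordinate, so one of four
    elements is in normal form. The value of [b1 + b2] later singles out the y that pair with p to
    -1. *)
Lemma golden_normal i j p y b1 b2 : frame i j p -> y \in order3 ->
    qcomm (rho i) (rho j) b1 -> qcomm (rho i) (rho j) b2 ->
    pure y = rho j * b1 + rho i * rho j * b2 -> golden_pair b1 b2 ->
  [\/ normal3 i j y /\ b1 + b2 = 1, normal3 i j y^-1%g /\ b1 + b2 = - 1
    | [\/ normal3 i j (y ^ j)%g | normal3 i j (y ^ j)^-1%g] /\ (b1 + b2) * (b1 + b2) = 5%:R].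
Proof.
move=> F Yy q1 q2 eU [u5 [[[h|h] sq]|[h sq]]].
- constructor 1; split=> //; split=> //; exists (b1 - b2); split=> //.
    by apply: qcommD => //; apply: qcommV.
  rewrite eU -h; nc_prove tt.
- constructor 2; split=> //; split; first exact: order3V.
  exists (b2 - b1); split; first by apply: qcommD => //; apply: qcommV.
    by rewrite -sq; nc_prove tt.
  by rewrite pureV // eU -[1]opprK -h; nc_prove tt.
have [[Li Lj Yp] [ii jj ji] ep] := F; have [Ly oy] := order3P Yy.
have [[c1 c2] [d1 d2]] := (q1, q2).
have eUj : pure (y ^ j)%g = rho j * b1 - rho i * rho j * b2.
  by rewrite pureJ // rhoN_inv // eU; nc_prove (tt, ii, jj, ji, c1, c2, d1, d2).
have Yj := order3J Lj Yy.
constructor 3; split=> //; case: h => h; [constructor 1|constructor 2].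
  split=> //; exists (b1 + b2); split=> //; first exact: qcommD.
  by rewrite eUj -h; nc_prove tt.
split; first exact: order3V.
exists (- b1 - b2); split; first by apply: qcommD; apply: qcommV.
  by rewrite -sq; nc_prove tt.
by rewrite pureV // eUj -[1]opprK -h; nc_prove tt.
Qed.


Definition frames3 (i j : gT) := [:: (i, j); (j, i * j)%g; (i * j, i)%g].

Lemma frames3P i j p ij : frame i j p -> ij \in frames3 i j -> frame ij.1 ij.2 p.
Proof.
move=> F; rewrite !inE => /or3P[]/eqP-> /=; [exact: F|exact: frame_cyc|exact: frame_cyc2].
Qed.

Definition on_line (i j p y : gT) :=
  [|| y \in 'C[p]%g, y \in 'C[p ^ i]%g, y \in 'C[p ^ j]%g | y \in 'C[p ^ (i * j)]%g].

(** The vanishing coordinate selects one of the three rotations of the frame. Each has a unique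
    normal element and thus yields two axes, the normal one and a conjugate; with the four axes of
    the frame this makes ten. *)
Lemma outside_normal i j p y : frame i j p -> y \in order3 -> ~~ on_line i j p y ->
  (5%:R : R) \is a GRing.unit /\
  exists2 ij, ij \in frames3 i j &
    (exists2 w, normal3 ij.1 ij.2 w &
       [\/ y = w, y = w^-1, (y ^ ij.2) = w | (y ^ ij.2) = w^-1]%g) /\
    (pair_value p y = - 1 -> normal3 ij.1 ij.2 y).
Proof.
move=> F Yy; rewrite !negb_or => /and4P[n1 n2 n3 n4].
have [[Li Lj Yp] [ii jj ji] ep] := F.
have [b1 [b2 [b3 [[q1 q2 q3] eU sum pos]]]] := outside_coords F Yy n1 n2 n3 n4.
have key i' j' b b' : (i', j') \in frames3 i j -> qcomm (rho i') (rho j') b ->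
    qcomm (rho i') (rho j') b' -> pure y = rho j' * b + rho i' * rho j' * b' ->
    golden_pair b b' -> b + b' = - pair_value p y ->
  (5%:R : R) \is a GRing.unit /\
  exists2 ij, ij \in frames3 i j &
    (exists2 w, normal3 ij.1 ij.2 w &
       [\/ y = w, y = w^-1, (y ^ ij.2) = w | (y ^ ij.2) = w^-1]%g) /\
    (pair_value p y = - 1 -> normal3 ij.1 ij.2 y).
  move=> inF qb qb' e gp sm; split; first by case: gp.
  have F' := frames3P F inF; exists (i', j') => //=.
  have bad (P : Prop) : b + b' = - 1 -> pair_value p y = - 1 -> P.
    move=> h k; apply: (@pow2_neq0 _ u2 1); rewrite k opprK h in sm.
    by apply: (combine0 (k := - 1) sm); nc_prove tt.
  have bad5 (P : Prop) : (b + b') * (b + b') = 5%:R -> pair_value p y = - 1 -> P.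
    move=> h k; apply: (@pow2_neq0 _ u2 2); rewrite sm k in h.
    by apply: (combine0 (k := - 1) h); nc_prove tt.
  case: (golden_normal F' Yy qb qb' e gp) => [[h k]|[h k]|[[h|h] k]]; split.
  - by exists y => //; constructor 1.
  - by [].
  - by exists y^-1%g => //; constructor 2; rewrite invgK.
  - exact: bad.
  - by exists (y ^ j')%g => //; constructor 3.
  - exact: bad5.
  - by exists (y ^ j')^-1%g => //; constructor 4; rewrite invgK.
  - exact: bad5.
have [s1 t1] := qcomm_cyc Li Lj q1.
have [s2 t2] := qcomm_cyc Li Lj q2.
have [s3 t3] := qcomm_cyc Li Lj q3.
case: pos => [[b0 gp]|[b0 gp]|[b0 gp]].
- apply: (key i j b2 b3) => //; first by rewrite !inE eqxx.
    by rewrite eU b0 mulr0 add0r.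
  by rewrite -sum b0 add0r.
- apply: (key j (i * j)%g b3 b1) => //; first by rewrite !inE eqxx orbT.
    by rewrite eU b0 (rhoM rep) //; nc_prove (tt, ii, jj, ji).
  by rewrite -sum b0; nc_prove tt.
- apply: (key (i * j)%g i b1 b2) => //; first by rewrite !inE eqxx !orbT.
    by rewrite eU b0 (rhoM rep) //; nc_prove (tt, ii, jj, ji).
  by rewrite -sum b0; nc_prove tt.
Qed.

End Frames.
End Frames.

(** * Counting the subgroups of order 3 *)

Module Points.
Import NcRing ClassEquation FpfRings OrderThreePairs QuaternionCoordinates GoldenValues Frames.
Import GroupScope.

Lemma odd_perm_involution (T : finType) (s : {perm T}) :
  s * s = 1 -> odd_perm s = odd (#|[set x | s x != x]|./2).
Proof.
move: {2}#|_| (leqnn #|[set x | s x != x]|) => n.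
elim: n s => [|n IH] s le ss.
  have e0 : [set x | s x != x] = set0 by apply/eqP; rewrite -cards_eq0 -leqn0.
  rewrite e0 cards0 /= (_ : s = 1) ?odd_perm1 //.
  by apply/permP=> x; rewrite perm1; move/setP/(_ x): e0; rewrite !inE => /negbFE/eqP.
have sK x : s (s x) = x by rewrite -permM ss perm1.
have [e0|[x]] := set_0Vmem [set x | s x != x].
  rewrite e0 cards0 /= (_ : s = 1) ?odd_perm1 //.
  by apply/permP=> x; rewrite perm1; move/setP/(_ x): e0; rewrite !inE => /negbFE/eqP.
rewrite inE => nx; pose t := tperm x (s x) * s.
have et y : t y = if (y == x) || (y == s x) then y else s y.
  rewrite permM; have [->|n1] := eqVneq y x; first by rewrite tpermL sK.
  have [->|n2] := eqVneq y (s x); first by rewrite tpermR.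
  by rewrite tpermD // eq_sym.
have em : [set y | t y != y] = [set y | s y != y] :\: [set x; s x].
  by apply/setP=> y; rewrite !inE et; case: ifP; rewrite ?eqxx // => ->; rewrite ?andbF.
have cm : #|[set y | s y != y]| = #|[set y | t y != y]|.+2.
  rewrite em (cardsD1 x) inE nx (cardsD1 (s x)) !inE sK nx eq_sym nx /=.
  do 2!congr _.+1; apply: eq_card => y; rewrite !inE.
  by case: (y == x); case: (y == s x); rewrite ?andbF.
have tt : t * t = 1.
  apply/permP=> y; rewrite perm1 permM !et; case: (boolP ((y == x) || (y == s x))) => h; rewrite ?h //.
  by rewrite -(inj_eq (@perm_inj _ s) (s y) x) -(inj_eq (@perm_inj _ s) (s y) (s x)) !sK orbC (negPf h).
have := IH t _ tt; rewrite odd_mul_tperm eq_sym nx cm /= => IHt.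
rewrite -[odd_perm s]negbK -IHt //.
by move: le; rewrite cm ltnS; apply: ltnW.
Qed.

Lemma perfect_additive_bool (gT : finGroupType) (G : {group gT}) (phi : gT -> bool) :
    {in G &, forall x y, phi (x * y) = phi x (+) phi y} -> G^`(1) = G ->
  {in G, forall x, phi x = false}.
Proof.
move=> phiM pG; have phi1 : phi 1 = false.
  by have := phiM 1 1 (group1 G) (group1 G); rewrite mulg1; case: (phi 1).
have phiV x : x \in G -> phi x^-1 = phi x.
  move=> Gx; have := phiM x x^-1 Gx (groupVr Gx); rewrite mulgV phi1.
  by case: (phi x); case: (phi x^-1).
pose A := [set x in G | ~~ phi x].
have gA : group_set A.
  apply/group_setP; split; first by rewrite inE group1 phi1.
  move=> x y; rewrite !inE => /andP[Gx /negbTE px] /andP[Gy /negbTE py].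
  by rewrite groupM // phiM // px py.
have : G^`(1) \subset Group gA.
  rewrite gen_subG; apply/subsetP=> _ /imset2P[x y Gx Gy ->].
  by rewrite inE groupR // commgEl conjgE !phiM ?groupM ?groupV // !phiV //; case: (phi x); case: (phi y).
by rewrite pG => /subsetP sGA x /sGA; rewrite inE => /andP[_ /negbTE].
Qed.

(** The sign is a homomorphism to a group of order 2. *)
Lemma perfect_even_action (gT : finGroupType) (G : {group gT}) (T : finType)
    (to : {action gT &-> T}) (S : {set T}) : G^`(1) = G -> [acts G, on S | to] ->
  {in G, forall x, odd_perm (restr_perm S (actperm to x)) = false}.
Proof.
move=> pG aS; apply: perfect_additive_bool pG => x y Gx Gy.
have nS w : w \in G -> actperm to w \in 'N(S | 'P).
  by move=> Gw; apply/astabsP=> s; rewrite /= apermE actpermE (acts_act aS).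
by rewrite (morphM (actperm_morphism to)) ?inE // morphM ?nS // odd_permM.
Qed.

(** Excluded middle for any proposition while the goal is boolean: counting may then choose a normal
    element, although [normal3] quantifies over the ring. *)
Lemma em_bool (P : Prop) (b : bool) : (P -> b) -> (~ P -> b) -> b.
Proof. by case: b => // h1 h2; have /h2 : ~ P by move/h1. Qed.

Section Points.
Variables (gT : finGroupType) (L : {group gT}) (R : unitRingType).
Variable rho : gT -> R.
Hypothesis rep : fpf_rep L rho.
Variable z : gT.
Hypotheses (Lz : z \in L) (oz : #[z] = 2).

Local Notation Y := (order3 L).

Lemma comm3 y w : y \in Y -> w \in Y -> w \in 'C[y] -> w = y \/ w = y^-1.
Proof. by move=> /order3P[Ly oy] /order3P[Lw ow]; apply: (commuting_order3 rep). Qed.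

Lemma cycle_order3 y w : y \in Y -> w \in Y -> <[y]> = <[w]> -> y = w \/ y = w^-1.
Proof.
move=> Yy Yw e; apply: comm3 => //; rewrite -cent_cycle -e cent_cycle cent1id //.
Qed.

Lemma order3_norm_cent y x : y \in Y -> x \in Y -> <[y]> :^ x = <[y]> -> x \in 'C[y].
Proof.
move=> Yy Yx; rewrite -cycleJ => e; have [Lx ox] := order3P Yx.
have [Ly oy] := order3P Yy.
apply: contraT => nc; case/negP: (order3_conj_nc rep Ly Lx oy ox nc).
by rewrite -cent_cycle -e cent_cycle cent1id.
Qed.

Lemma normal3J i j w x : i \in L -> j \in L -> x \in L -> x \in 'C[i] -> x \in 'C[j] ->
  normal3 L rho i j w -> normal3 L rho i j (w ^ x).
Proof.
move=> Li Lj Lx /cent1P ci /cent1P cj [Yw [r [[r1 r2] rr e]]].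
have [Lw _] := order3P Yw.
split; first exact: order3J.
have xi := rhoVl rep Lx; have ix := rhoVr rep Lx.
have k1 : (rho x * rho i = rho i * rho x)%R by rewrite -!(rhoM rep) // ci.
have k2 : (rho x * rho j = rho j * rho x)%R by rewrite -!(rhoM rep) // cj.
have k3 : (rho x^-1 * rho i = rho i * rho x^-1)%R.
  by rewrite -!(rhoM rep) ?groupV //; congr rho; apply/commute_sym/commuteV/commute_sym.
have k4 : (rho x^-1 * rho j = rho j * rho x^-1)%R.
  by rewrite -!(rhoM rep) ?groupV //; congr rho; apply/commute_sym/commuteV/commute_sym.
exists (rho x^-1 * r * rho x)%R; split.
- by split; nc_prove (tt, k1, k2, k3, k4, r1, r2).
- transitivity (rho x^-1 * (r * r) * rho x)%R; first by nc_prove (tt, ix).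
  by rewrite rr; nc_prove (tt, xi).
- rewrite (pureJ rep) //.
  transitivity (rho x^-1 * (pure rho w + pure rho w) * rho x)%R; first by nc_prove tt.
  by rewrite e; nc_prove (tt, k1, k2, k3, k4, xi).
Qed.

Section Frame.
Variables p q : gT.
Hypotheses (Yp : p \in Y) (Yq : q \in Y) (pq0 : tr rho (p * q) = 0%R).

Let i := z * (p * q).
Let j := i ^ p.
Let F : frame L rho i j p := frame_of rep Lz oz Yp Yq pq0.
Let Lp : p \in L. Proof. by case: (order3P Yp). Qed.
Let Lq : q \in L. Proof. by case: (order3P Yq). Qed.
Let Li : i \in L. Proof. by rewrite !groupM. Qed.
Let Lj : j \in L. Proof. by rewrite groupJ. Qed.

Lemma cent_pair_frame x : x \in L -> x \in 'C[p] -> x \in 'C[q] -> x \in 'C[i] /\ x \in 'C[j].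
Proof.
move=> Lx cp cq; have zx : x \in 'C[z] by apply: (subsetP (z_central rep Lz oz)).
have ci : x \in 'C[i].
  by move: zx cp cq; rewrite ![x \in _]cent1C => ? ? ?; rewrite !groupM.
split=> //; move: cp ci; rewrite ![x \in _]cent1C => cp ci.
by rewrite groupJ.
Qed.

(** x commutes with the frame. An element on an axis is, up to inversion, a conjugate of p by a
    frame element. Off the axes it reduces to a normal element w, and [w ^ x] is normal for the same
    frame, hence equal to w. *)
Lemma cent_pair_all x y : x \in L -> x \in 'C[p] -> x \in 'C[q] -> y \in Y -> x \in 'C[y].
Proof.
move=> Lx cp cq Yy; have [ci cj] := cent_pair_frame Lx cp cq.
have cij : x \in 'C[i * j].
  by move: ci cj; rewrite ![x \in _]cent1C => ? ?; rewrite groupM.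
rewrite cent1C.
have CV w : (w^-1 \in 'C[x]) = (w \in 'C[x]) by rewrite groupV.
have line g : g \in L -> x \in 'C[g] -> y \in 'C[p ^ g] -> y \in 'C[x].
  move=> Lg cg /(comm3 (order3J Lg Yp) Yy).
  by case=> ->; rewrite ?CV groupJ // -cent1C.
have [on|off] := boolP (on_line i j p y).
  case/or4P: on => h.
  - by apply: (line 1); [exact: group1|rewrite cent1C group1|rewrite conjg1].
  - exact: line h.
  - exact: line h.
  - by apply: line h => //; rewrite groupM.
have [u5 [ij inF [[w nw hw] _]]] := outside_normal rep Lz oz F Yy off.
have F' := frames3P rep F inF.
have [[Li' Lj' _] _ _] := F'.
have [ci' cj'] : x \in 'C[ij.1] /\ x \in 'C[ij.2].
  have : [|| ij == (i, j), ij == (j, i * j) | ij == (i * j, i)] by move: inF; rewrite !inE.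
  by case/or3P=> /eqP->.
have wx : w ^ x = w.
  exact: (normal3_unique rep Lz oz F' u5 nw (normal3J Li' Lj' Lx ci' cj' nw)).
have cw : w \in 'C[x] by apply/cent1P/commgP/conjg_fixP.
case: hw => e.
- by rewrite e.
- by rewrite e CV.
- by rewrite -(groupJr _ (_ : ij.2 \in 'C[x])) ?e // -cent1C.
- by rewrite -(groupJr _ (_ : ij.2 \in 'C[x])) ?e ?CV // -cent1C.
Qed.


(** In the dodecahedron these are the six vertices whose scalar product with the vertex of p is
    1. *)
Definition opposite (p : gT) := [set y in Y | tr rho (p * y) == 0%R].
Definition points := [set <[y]> | y in Y].

Lemma oppositeP y : y \in Y -> (y \in opposite p) = (pair_value rho p y == - 1)%R.
Proof.
move=> Yy; rewrite inE Yy /= /pair_value -[RHS](inj_eq (@GRing.addIr _ 1%R)) GRing.subrK GRing.addNr.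
apply/eqP/eqP => [->|]; first by rewrite GRing.addr0.
exact: (half0 (unit2 rep Lz oz)).
Qed.

Lemma opposite_order3 p' y : y \in opposite p' -> y \in Y.
Proof. by rewrite inE => /andP[]. Qed.

Lemma pair_valueV y : y \in Y -> pair_value rho p y^-1 = (- pair_value rho p y)%R.
Proof.
move=> Yy; apply: (half_inj (unit2 rep Lz oz)).
rewrite -(pure_pair rep) ?order3V // (pureV rep) //.
transitivity (- (pure rho p * pure rho y + pure rho y * pure rho p))%R; first by nc_prove tt.
by rewrite (pure_pair rep) //; nc_prove tt.
Qed.

Lemma oppositeV y : y \in opposite p -> y^-1 \notin opposite p.
Proof.
move=> Ty; have Yy := opposite_order3 Ty; rewrite oppositeP ?order3V // pair_valueV //.
move: Ty; rewrite oppositeP // => /eqP->; rewrite GRing.opprK; apply/eqP=> e.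
apply: (@pow2_neq0 _ (unit2 rep Lz oz) 1); apply: (combine0 (k := 1%R) e); nc_prove tt.
Qed.

Lemma opposite_nc y : y \in opposite p -> y \notin 'C[p].
Proof.
move=> Ty; have Yy := opposite_order3 Ty; apply/negP=> c.
have bad n (P : Prop) : ((2 ^ n)%:R : R)%R = 0%R -> P by move=> e0; exact (@pow2_neq0 _ (unit2 rep Lz oz) n P e0).
case: (comm3 Yp Yy c) => e; move: Ty; rewrite oppositeP // e.
  rewrite (pair_same rep Lz oz) // => /eqP h.
  by apply: (bad 1%N); apply: (combine0 (k := (- 1)%R) h); nc_prove tt.
rewrite (pair_inv rep Lz oz) // => /eqP h.
by apply: (bad 2); apply: (combine0 (k := 1%R) h); nc_prove tt.
Qed.

Lemma normal3_rep (b : bool) ij : ij \in frames3 i j ->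
  (forall n, (forall y, (5%:R : R)%R \is a GRing.unit -> normal3 L rho ij.1 ij.2 y -> y = n) -> b) ->
  b.
Proof.
move=> inF h.
apply: (@em_bool ((5%:R : R)%R \is a GRing.unit /\ exists w, normal3 L rho ij.1 ij.2 w)).
  case=> u5 [w nw]; apply: (h w) => y _ ny.
  exact: (normal3_unique rep Lz oz (frames3P rep F inF) u5 nw ny).
(* Without a normal element the condition on y is void, and p is a dummy. *)
by move=> nP; apply: (h p) => y u5 ny; case: nP; split=> //; exists y.
Qed.

Lemma line_order3 g y : g \in L -> y \in Y -> y \in 'C[p ^ g] -> y = p ^ g \/ y = (p ^ g)^-1.
Proof. by move=> Lg Yy; apply: comm3 => //; apply: order3J. Qed.

(** Inversion negates the pair value, so each of the three axes other than that of p contributes at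
    most one generator; each rotation of the frame contributes at most its normal element. *)
Lemma card_opposite : #|opposite p| <= 6.
Proof.
apply: (@normal3_rep _ (i, j)) => [|n1 h1]; first by rewrite !inE eqxx.
apply: (@normal3_rep _ (j, i * j)) => [|n2 h2]; first by rewrite !inE eqxx orbT.
apply: (@normal3_rep _ (i * j, i)) => [|n3 h3]; first by rewrite !inE eqxx !orbT.
pose a g := if p ^ g \in opposite p then p ^ g else (p ^ g)^-1.
apply: leq_trans (_ : size [:: a i; a j; a (i * j); n1; n2; n3] <= 6) => //.
apply: leq_trans (card_size _); apply: subset_leq_card; apply/subsetP=> y Ty.
have Yy := opposite_order3 Ty.
have line g : g \in L -> y \in 'C[p ^ g] -> y = a g.
  move=> Lg /(line_order3 Lg Yy)[e|e]; rewrite /a; first by rewrite -e Ty.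
  by case: ifP => // /oppositeV; rewrite -e Ty.
have [on|off] := boolP (on_line i j p y).
  rewrite !in_cons; case/or4P: on => h.
  - by case/negP: (opposite_nc Ty).
  - by rewrite (line i) ?eqxx.
  - by rewrite (line j) ?eqxx ?orbT.
  - by rewrite (line (i * j) (groupM Li Lj) h) eqxx !orbT.
have [u5 [ij inF [_ hn]]] := outside_normal rep Lz oz F Yy off.
have {}hn : normal3 L rho ij.1 ij.2 y by apply: hn; move: Ty; rewrite oppositeP // => /eqP.
have : [|| ij == (i, j), ij == (j, i * j) | ij == (i * j, i)] by move: inF; rewrite !inE.
rewrite !in_cons; case/or3P=> /eqP e; rewrite e in hn.
- by rewrite (h1 y u5 hn) eqxx !orbT.
- by rewrite (h2 y u5 hn) eqxx !orbT.
- by rewrite (h3 y u5 hn) eqxx !orbT.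
Qed.

Lemma card_points : #|points| <= 10.
Proof.
apply: (@normal3_rep _ (i, j)) => [|n1 h1]; first by rewrite !inE eqxx.
apply: (@normal3_rep _ (j, i * j)) => [|n2 h2]; first by rewrite !inE eqxx orbT.
apply: (@normal3_rep _ (i * j, i)) => [|n3 h3]; first by rewrite !inE eqxx !orbT.
pose s := [:: <[p]>; <[p ^ i]>; <[p ^ j]>; <[p ^ (i * j)]>;
  <[n1]>; <[n1 ^ j^-1]>; <[n2]>; <[n2 ^ (i * j)^-1]>; <[n3]>; <[n3 ^ i^-1]>].
apply: leq_trans (_ : size s <= 10) => //.
apply: leq_trans (card_size _); apply: subset_leq_card; apply/subsetP=> _ /imsetP[y Yy ->].
have line g : g \in L -> y \in 'C[p ^ g] -> <[y]> = <[p ^ g]>.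
  by move=> Lg /(line_order3 Lg Yy)[]->; rewrite ?cycleV.
have [on|off] := boolP (on_line i j p y).
  rewrite !in_cons; case/or4P: on => h.
  - by have := line 1 (group1 L); rewrite conjg1 => -> //; rewrite eqxx.
  - by rewrite (line i) ?eqxx ?orbT.
  - by rewrite (line j) ?eqxx ?orbT.
  - by rewrite (line (i * j) (groupM Li Lj) h) eqxx !orbT.
have [u5 [ij inF [[w nw hw] _]]] := outside_normal rep Lz oz F Yy off.
have ey : <[y]> = <[w]> \/ <[y]> = <[w ^ ij.2^-1]>.
  case: hw => [->|->|<-|e]; [by left|by left; rewrite cycleV|by right; rewrite conjgK|right].
  by rewrite -[w]invgK -e conjVg conjgK cycleV.
have : [|| ij == (i, j), ij == (j, i * j) | ij == (i * j, i)] by move: inF; rewrite !inE.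
rewrite !in_cons; case/or3P=> /eqP e; rewrite e in nw ey.
- by rewrite -(h1 w u5 nw); case: ey => ->; rewrite eqxx !orbT.
- by rewrite -(h2 w u5 nw); case: ey => ->; rewrite eqxx !orbT.
- by rewrite -(h3 w u5 nw); case: ey => ->; rewrite eqxx !orbT.
Qed.

End Frame.
End Points.
End Points.

(** * The centraliser of all elements of order 3 *)

Module PerfectCentraliser.
Import NcRing ClassEquation FpfRings OrderThreePairs QuaternionCoordinates GoldenValues Frames Points.
Import GroupScope.

Section Perfect.
Variables (gT : finGroupType) (L : {group gT}) (R : unitRingType).
Variable rho : gT -> R.
Hypothesis rep : fpf_rep L rho.
Variable z : gT.
Hypotheses (Lz : z \in L) (oz : #[z] = 2).

Local Notation Y := (order3 L).
Local Notation points := (points L).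
Local Notation opposite := (opposite L rho).

(** A Sylow 3-subgroup has a central element of order 3, and by [comm3] its other elements of order
    3 lie in the same cyclic group. *)
Lemma order3_conjugate y w : y \in Y -> w \in Y -> exists2 x, x \in L & <[y]> = <[w]> :^ x.
Proof.
move=> Yy Yw; have [[Ly oy] [Lw ow]] := (order3P Yy, order3P Yw).
have p3 v : #[v] = 3 -> 3.-group <[v]> by move=> ov; rewrite /pgroup -orderE ov.
have [P sylP] := Sylow_exists 3 L; have [sPL pP _] := and3P sylP.
have [|a La sya] := @Sylow_Jsub 3 _ L P <[y]>%G sylP _ (p3 _ _ oy); first by rewrite cycle_subG.
have [|b Lb swb] := @Sylow_Jsub 3 _ L P <[w]>%G sylP _ (p3 _ _ ow); first by rewrite cycle_subG.
rewrite -cycleJ cycle_subG in sya; rewrite -cycleJ cycle_subG in swb.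
have Yya := order3J La Yy; have Ywb := order3J Lb Yw.
have ntP : P :!=: 1.
  by apply/trivgPn; exists (y ^ a) => //; rewrite -order_eq1 orderJ oy.
have ntZ : 'Z(P) != 1 by rewrite (center_nil_eq1 (pgroup_nil pP)).
have [_ d3 _] := pgroup_pdiv (pgroupS (center_sub P) pP) ntZ.
have [c Zc oc] := Cauchy (isT : prime 3) d3.
have Pc := subsetP (center_sub P) c Zc.
have Yc : c \in Y by rewrite inE (subsetP sPL) // oc.
have cc v : v \in P -> v \in Y -> <[v]> = <[c]>.
  move=> Pv Yv; have cv : v \in 'C[c].
    by apply/cent1P/commute_sym; apply: (centP (subsetP (subsetIr _ _) c Zc)).
  by case: (comm3 rep Yc Yv cv) => ->; rewrite ?cycleV.
have e : <[y]> :^ a = <[w]> :^ b by rewrite -!cycleJ (cc (y ^ a)) // (cc (w ^ b)).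
by exists (b * a^-1); rewrite ?groupM ?groupV // conjsgM -e conjsgK.
Qed.

Hypotheses (perfL : L^`(1) = L) (L8 : 8 %| #|L|).

Section Frame.
Variables p q : gT.
Hypotheses (Yp : p \in Y) (Yq : q \in Y) (pq0 : tr rho (p * q) = 0%R).

Let N := 'C_L(Y).
Let C := 'C_L[p].

Let Lp : p \in L. Proof. by case: (order3P Yp). Qed.
Let Lq : q \in L. Proof. by case: (order3P Yq). Qed.
Let Oq : q \in opposite p. Proof. by rewrite inE Yq pq0 eqxx. Qed.

Let nY : L \subset 'N(Y).
Proof.
apply/subsetP=> x Lx; rewrite inE; apply/subsetP=> _ /imsetP[y Yy ->].
exact: order3J.
Qed.

Lemma cent3_normal : N <| L.
Proof. by rewrite /normal subsetIl normsI ?normG ?norms_cent. Qed.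

Lemma cent_opposite y : y \in opposite p -> 'C_C[y] = N.
Proof.
move=> Oy; have Yy := opposite_order3 Oy; apply/setP=> x; apply/idP/idP.
  case/setIP=> /setIP[Lx cp] cy; rewrite inE Lx /=; apply/centP=> v Yv; apply/cent1P.
  have y0 : tr rho (p * y) = 0%R by move: Oy; rewrite inE => /andP[_ /eqP].
  exact: (cent_pair_all rep Lz oz Yp Yy y0 Lx cp cy Yv).
case/setIP=> Lx /centP cx; apply/setIP; split; last exact/cent1P/cx.
by apply/setIP; split=> //; apply/cent1P/cx.
Qed.

Lemma oppositeJ x y : x \in C -> y \in opposite p -> y ^ x \in opposite p.
Proof.
case/setIP=> Lx /cent1P cx Oy; have Yy := opposite_order3 Oy; have [Ly _] := order3P Yy.
rewrite inE order3J //=; have -> : p * y ^ x = (p * y) ^ x.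
  by rewrite conjMg (_ : p ^ x = p) // conjgE -cx mulKg.
move: Oy; rewrite inE => /andP[_ /eqP e]; apply/eqP.
rewrite /tr -conjVg !(rho_conj rep) ?groupV ?groupM // -GRing.mulrDl -GRing.mulrDr.
by rewrite -[(_ + _)%R]/(tr rho (p * y)) e GRing.mulr0 GRing.mul0r.
Qed.

Let pC : p \in C. Proof. by rewrite inE Lp cent1id. Qed.
Let npq : p \notin N.
Proof.
rewrite -(cent_opposite Oq) inE pC /= cent1C.
exact: (opposite_nc rep Lz oz Yp Oq).
Qed.

Let sNC : N \subset C.
Proof. by rewrite -(cent_opposite Oq) subsetIl. Qed.
Let nNC : N <| C.
Proof. by apply: normalS cent3_normal; rewrite ?subsetIl. Qed.

(** The index is the size of the class of q under C, which stays among the at most six opposite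
    elements; 3 divides it since p has order 3 modulo N. *)
Lemma card_class_opposite : #|C : N| = 3 \/ #|C : N| = 6 /\ #|opposite p| = 6.
Proof.
have eI : #|C : N| = #|q ^: C| by rewrite -index_cent1 (cent_opposite Oq).
have le : #|C : N| <= #|opposite p|.
  by rewrite eI; apply: subset_leq_card; apply/subsetP=> _ /imsetP[x Cx ->]; apply: oppositeJ.
have le6 := card_opposite rep Lz oz Yp Yq pq0.
have d3 : 3 %| #|C : N|.
  rewrite -card_quotient ?normal_norm //.
  have nNp : p \in 'N(N) by apply: (subsetP (normal_norm nNC)).
  have o3 : #[coset N p] = 3.
    apply: nt_prime_order => //.
      by rewrite -morphX // (_ : p ^+ 3 = 1) ?morph1 //; case: (order3P Yp) => _ <-; rewrite expg_order.
    by apply: contra npq => /eqP/coset_idr; apply.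
  by rewrite -o3 order_dvdG // mem_quotient.
have gt0 : 0 < #|C : N| by rewrite indexg_gt0.
move: d3 gt0 le le6; move: #|C : N| #|opposite p| => a b.
case/dvdnP=> [[|[|[|k]]] ->] // _ le le6; [by left|right|].
  by split=> //; apply/eqP; rewrite eqn_leq le6.
by have := leq_trans le le6; rewrite !mulSn.
Qed.


Let Lpoints : [acts L, on points | 'Js].
Proof.
apply/actsP=> x Lx d; apply/idP/idP; last first.
  by case/imsetP=> y Yy ->; rewrite /= -cycleJ; apply: imset_f; apply: order3J.
case/imsetP=> y Yy /= e; rewrite -(conjsgK x d) e -cycleJ; apply: imset_f.
by apply: order3J => //; rewrite groupV.
Qed.

Let p3 k : ~~ (3 %| k) -> exists m, p = (p ^+ k) ^+ m.
Proof.
move=> nk; have [_ op] := order3P Yp.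
have e : <[p]> = <[p ^+ k]>.
  by apply/eqP; rewrite -[_ == _]/(generator _ _) generator_coprime op prime_coprime.
by have := cycle_id p; rewrite e => /cycleP[m em]; exists m.
Qed.

Let p_moves d : d \in points -> d != <[p]> -> d :^ p != d.
Proof.
case/imsetP=> y Yy -> ne; apply: contra ne => /eqP e.
have c := order3_norm_cent rep Yy Yp e.
by case: (comm3 rep Yy Yp c) => ->; rewrite ?cycleV.
Qed.

(** An element x of C of order 2 modulo N moves exactly the six points of [opposite p]. It is then a
    product of three transpositions, an odd permutation, which a perfect group does not afford. *)
Lemma no_involution : #|C : N| <> 6.
Proof.
move=> C6; have [C3|[_ O6]] := card_class_opposite; first by rewrite C3 in C6.
have [x [Cx nx x2]] : exists x, [/\ x \in C, x \notin N & x ^+ 2 \in N].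
  have d2 : 2 %| #|C / N| by rewrite card_quotient ?normal_norm // C6.
  have [xN CxN oxN] := Cauchy (isT : prime 2) d2.
  case/morphimP: CxN => x nNx Cx exN; exists x; split=> //.
    apply/negP=> Nx; move: oxN; rewrite exN /= coset_id // order1 //.
  rewrite coset_idr ?groupX // morphX //.
  by move: oxN; rewrite exN /= => <-; rewrite expg_order.
have Lx : x \in L by case/setIP: Cx.
pose Dc := [set <[y]> | y in opposite p].
have cDc : #|Dc| = 6.
  rewrite -O6; apply: card_in_imset => y y' Oy Oy' e.
  case: (cycle_order3 rep (opposite_order3 Oy) (opposite_order3 Oy') e) => // ey.
  by have := oppositeV rep Lz oz Yp Oy'; rewrite -ey Oy.
have sDc : Dc \subset points by apply: imsetS; apply/subsetP=> y; apply: opposite_order3.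
have pD : <[p]> \in points by apply: imset_f.
have pDc : <[p]> \notin Dc.
  apply/imsetP=> [[y Oy e]]; case/negP: (opposite_nc rep Lz oz Yp Oy).
  by rewrite -cent_cycle e cent_cycle cent1id.
pose s := restr_perm points (actperm 'Js x).
have nS : actperm 'Js x \in 'N(points | 'P).
  by apply/astabsP=> d; rewrite /= apermE actpermE; apply: (acts_act Lpoints).
have sE d : d \in points -> s d = d :^ x by move=> Dd; rewrite /s restr_permE // actpermE.
have sout d : d \notin points -> s d = d by move=> nd; apply: (out_perm (restr_perm_on _ _)).
have Nfix w d : w \in N -> d \in points -> d :^ w = d.
  case/setIP=> Lw /centP cw /imsetP[y Yy ->]; rewrite -cycleJ; congr <[_]>.
  by rewrite conjgE -cw // mulKg.
have x2fix d : d \in points -> (d :^ x) :^ x = d.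
  by move=> Dd; rewrite -conjsgM; apply: Nfix.
have ss : s * s = 1.
  apply/permP=> d; rewrite perm1 permM; have [Dd|nd] := boolP (d \in points); last by rewrite !sout.
  rewrite !sE // ?x2fix //; first by rewrite (acts_act Lpoints).
have DcJ w d : w \in C -> d \in Dc -> d :^ w \in Dc.
  by move=> Cw /imsetP[y Oy ->]; rewrite -cycleJ; apply: imset_f; apply: oppositeJ.
have mov : [set d | s d != d] = Dc.
  apply/setP=> d; rewrite inE; apply/idP/idP; last first.
    move=> Dd; rewrite sE ?(subsetP sDc) //; apply: contra nx => /eqP.
    case/imsetP: Dd => y Oy ->; rewrite -cycleJ => e; have Yy := opposite_order3 Oy.
    rewrite -(cent_opposite Oy) inE Cx /= cent1C; apply/cent1P/commgP/conjg_fixP.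
    case: (cycle_order3 rep (order3J Lx Yy) Yy e) => // ey.
    by have := oppositeV rep Lz oz Yp Oy; rewrite -ey oppositeJ.
  apply: contraR => nDc; have [Dd|nd] := boolP (d \in points); last by rewrite sout.
  rewrite sE //; have [->|dp] := eqVneq d <[p]>.
    by rewrite -cycleJ (_ : p ^ x = p) // conjgE; case/setIP: Cx => _ /cent1P <-; rewrite mulKg.
  (* At most 10 - 7 = 3 points remain, and p permutes them in a single cycle if there are any. As x
     commutes with p, it acts on them as a power of p, and being an involution it acts trivially. *)
  pose Dg := points :\: (<[p]> |: Dc).
  have le3 : #|Dg| <= 3.
    rewrite cardsD (setIidPr _) ?subUset ?sub1set ?pD // cardsU1 pDc cDc.
    by have := card_points rep Lz oz Yp Yq pq0; rewrite leq_subLR.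
  have dg : d \in Dg by rewrite !inE negb_or dp nDc.
  have DgJ w e : w \in C -> e \in Dg -> e :^ w \in Dg.
    move=> Cw; case/setIP: (Cw) => Lw /cent1P cw.
    rewrite !inE !negb_or -andbA => /and3P[e1 e2 e3].
    rewrite (acts_act Lpoints Lw e : (e :^ w \in points) = _) e3 andbT; apply/andP; split.
      apply: contra e1 => /eqP ep; rewrite -(conjsgK w e) ep -cycleJ.
      by rewrite (_ : p ^ w^-1 = p) // conjgE invgK mulgA cw mulgK.
    by apply: contra e2 => /(DcJ w^-1); rewrite conjsgK; apply; rewrite groupV.
  have dP k : d :^ (p ^+ k) = d -> 3 %| k.
    move=> dk; apply: contraT => /p3[m em]; case/negP: (p_moves Dd dp); apply/eqP.
    rewrite em; elim: m {em} => [|m IH]; first by rewrite expg0 conjsg1.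
    by rewrite expgS conjsgM dk.
  have sub : [set d; d :^ p; d :^ (p ^+ 2)] \subset Dg.
    by rewrite !subUset !sub1set dg DgJ //= DgJ // groupX.
  have c3 : #|[set d; d :^ p; d :^ (p ^+ 2)]| = 3.
    rewrite -setUA cardsU1 cards2 !inE negb_or.
    have -> : d != d :^ p by rewrite eq_sym p_moves.
    have -> : d != d :^ (p ^+ 2) by apply/eqP => e; have := dP 2 (esym e).
    have -> : d :^ p != d :^ (p ^+ 2); last by [].
    apply/eqP=> e; have := dP 1%N; rewrite expg1 => h; suff: 3 %| 1 by [].
    by apply: h; apply: (@conjsg_inj _ p); rewrite -conjsgM -e.
  have eDg : [set d; d :^ p; d :^ (p ^+ 2)] = Dg by apply/eqP; rewrite eqEcard sub c3.
  have : d :^ x \in Dg by apply: DgJ.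
  have cpx : commute x p by case/setIP: Cx => _ /cent1P.
  have key k : d :^ x = d :^ (p ^+ k) -> 3 %| k.
    move=> e; have := x2fix _ Dd; rewrite {1}e -conjsgM -(commuteX k cpx) conjsgM e -conjsgM -expgD.
    by move/dP; rewrite addnn -mul2n Euclid_dvdM.
  rewrite -eDg !inE -orbA => /or3P[/eqP->//|/eqP e|/eqP e]; first by have := key 1%N e.
  by have := key 2 e.
have := perfect_even_action perfL Lpoints Lx; rewrite -/s odd_perm_involution // mov cDc //.
Qed.

(** Otherwise N has an element w of order 4, commuting with i and j. Since w and i commute and both
    square to z, w is i^-1 or z i^-1, so i commutes with j; but their images anticommute. *)
Lemma cent3_no4 : ~~ (4 %| #|N|).
Proof.
apply/negP=> d4; have [P sylP] := Sylow_exists 2 N; have [sPN pP _] := and3P sylP.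
have sNL : N \subset L by apply: subsetIl.
have P4 : 4 %| #|P|.
  have d4' : 1 < logn 2 #|N| by rewrite -(@pfactor_dvdn 2 2) ?cardG_gt0.
  by rewrite (card_Hall sylP) p_part; apply: (dvdn_exp2l 2 d4').
have [x Px nx] : exists2 x, x \in P & x \notin <[z]>.
  apply/subsetPn; apply: contraL P4 => /subset_leq_card; rewrite -orderE oz => le2.
  by rewrite gtnNdvd // (leq_trans _ (_ : 3 <= 4)).
have Lx : x \in L by rewrite (subsetP sNL) ?(subsetP sPN).
have [k ok] := p_natP (mem_p_elt pP Px).
have k2 : 1 < k.
  case: k ok => [|[|k]] // ok; case/negP: nx; apply: (sq1 rep Lz oz) => //.
    by apply/eqP; rewrite -order_dvdn ok.
  by apply/eqP; rewrite -order_dvdn ok.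
pose w := x ^+ (2 ^ (k - 2)).
have ow : #[w] = 4.
  by rewrite /w (orderXexp _ ok) subKn.
have Nw : w \in N by rewrite groupX // (subsetP sPN).
case/setIP: (Nw) => Lw /centP cw.
have cen v : v \in Y -> w \in 'C[v] by move=> Yv; apply/cent1P/cw.
have [ci cj] := cent_pair_frame rep Lz oz Lw (cen p Yp) (cen q Yq).
have [[Li Lj _] [ii jj ji] _] := frame_of rep Lz oz Yp Yq pq0.
set i := z * (p * q) in ci cj Li Lj ii jj ji; set j := i ^ p in cj Lj jj ji.
have zcase v : v \in <[z]> -> v = 1 \/ v = z.
  case/cycleP=> n ->; rewrite -(expg_mod n (_ : z ^+ 2 = 1)); last by rewrite -oz expg_order.
  by case: (n %% 2) (ltn_pmod n (isT : 0 < 2)) => [|[|]] // _; [left|right].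
have i2 : i ^+ 2 = z by apply: (rho_inj rep); rewrite ?groupX // expgS expg1 (rhoM rep) // ii (rho_z rep Lz oz).
have w2 : w ^+ 2 = z.
  have : w ^+ 2 \in <[z]>.
    by apply: (sq1 rep Lz oz); rewrite ?groupX // -expgM; apply/eqP; rewrite -order_dvdn ow.
  by case/zcase=> // e; have : #[w] %| 2 by [rewrite order_dvdn e]; rewrite ow.
have wi : w * i \in <[z]>.
  apply: (sq1 rep Lz oz); rewrite ?groupM // expgMn; last exact/cent1P.
  by rewrite w2 i2 -(expg_order z) oz.
have ew : w = i^-1 \/ w = z * i^-1.
  by case/zcase: wi => e; [left|right]; rewrite -[LHS](mulgK i) e ?mul1g.
have cji : j \in 'C[i].
  have zj : j \in 'C[z] by apply: (subsetP (z_central rep Lz oz)).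
  rewrite cent1C in zj; have : i^-1 \in 'C[j].
    case: ew => ew; first by rewrite -ew.
    by rewrite (_ : i^-1 = z^-1 * w) ?groupM ?groupV // ew mulKg.
  by rewrite groupV cent1C.
have ij0 : (rho i * rho j = 0)%R.
  apply: (half0 (unit2 rep Lz oz)); rewrite -{2}[(_ * _)%R]GRing.opprK -ji -!(rhoM rep) //.
  by rewrite (cent1P cji) GRing.subrr.
have : (rho i * (rho i * rho j) * rho j = 0)%R by rewrite ij0 GRing.mulr0 GRing.mul0r.
rewrite GRing.mulrA ii -GRing.mulrA jj GRing.mulrNN GRing.mulr1 => /eqP.
by rewrite GRing.oner_eq0.
Qed.

(** The index is 3 times the number of points times 1 or 2. The number of points is at most 10 and
    is 1 modulo 3, because p fixes only its own point; and 4 divides the index by [cent3_no4]. *)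
Lemma card_cent_quotient : [\/ #|L : N| = 12, #|L : N| = 24 | #|L : N| = 60].
Proof.
have C3 : #|C : N| = 3 by have [//|[/no_involution]] := card_class_opposite.
pose M := 'N_L(<[p]>).
have sCM : C \subset M.
  by rewrite setIS // -cent_cycle cent_sub.
have eP : #|points| = #|L : M|.
  rewrite -card_conjugates; apply: eq_card => d; apply/imsetP/imsetP=> [[y Yy ->]|[x Lx ->]].
    by have [x Lx ->] := order3_conjugate Yy Yp; exists x.
  by exists (p ^ x); rewrite ?order3J ?cycleJ.
have eCM : 'C_M[p] = C.
  apply/eqP; rewrite eqEsubset setSI ?subsetIl //= subsetI sCM; exact: subsetIr.
have MC : #|M : C| <= 2.
  rewrite -eCM index_cent1; apply: leq_trans (_ : #|[set p; p^-1]| <= 2); last by rewrite cards2; case: eqP.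
  apply: subset_leq_card; apply/subsetP=> _ /imsetP[x /setIP[Lx /normP nx] ->]; rewrite !inE.
  by case: (cycle_order3 rep (order3J Lx Yp) Yp) => [|->|->]; rewrite ?eqxx ?orbT // cycleJ.
have le10 := card_points rep Lz oz Yp Yq pq0.
have gt0 : 0 < #|M : C| by rewrite indexg_gt0.
have eLN : #|L : N| = (#|points| * #|M : C| * 3)%N.
  by rewrite eP -C3 -mulnA Lagrange_index ?Lagrange_index ?subsetIl // (subset_trans sNC).
have mod3 : #|points| = 1 %[mod 3].
  have pp : [acts <[p]>, on points | 'Js].
    by apply: subset_trans Lpoints; rewrite cycle_subG.
  have p3g : 3.-group <[p]> by rewrite /pgroup -orderE; case: (order3P Yp) => _ ->.
  rewrite (pgroup_fix_mod p3g pp) (_ : 'Fix_(_ | _)(_) = [set <[p]>]) ?cards1 //.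
  apply/setP=> d; rewrite in_setI in_set1; apply/andP/eqP=> [[Dd /afixP fx]|->].
    apply/eqP; apply: contraT => /(p_moves Dd)/eqP[]; exact: fx (cycle_id p).
  split; first exact: imset_f.
  by apply/afixP=> x px /=; apply: normP; apply: subsetP px; apply: normG.
have d4 : 4 %| #|L : N|.
  have := L8; rewrite -(Lagrange (subsetIl L 'C(Y))) -/N.
  have := cent3_no4; have := cardG_gt0 [group of N]; rewrite /=.
  rewrite (@pfactor_dvdn 2 2) // => N0 n4 m8.
  have L0 : 0 < #|L : N| by rewrite indexg_gt0.
  rewrite (@pfactor_dvdn 2 2) //; rewrite (@pfactor_dvdn 2 3) ?muln_gt0 ?N0 // lognM // in m8.
  by rewrite -ltnNge in n4; rewrite -[3]/(1 + 2)%N in m8; rewrite -(leq_add2l 1) (leq_trans m8) // leq_add2r -ltnS.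
move: eLN d4 mod3 le10 gt0 MC; move: #|L : N| #|points| #|M : C| => a b c -> d4 mod3 le10 gt0 MC.
have bc : (b = 1 \/ b = 4 \/ b = 7 \/ b = 10)%N.
  by clear -mod3 le10; move: mod3 le10; do 11?[case: b => [|b] //]; lia.
by have [c1|c2] : c = 1%N \/ c = 2; [clear -gt0 MC; lia| |]; move: d4;
  [rewrite c1|rewrite c2]; case: bc => [->|[->|[->|->]]] // _; first [by constructor 1|by constructor 2|by constructor 3].
Qed.

End Frame.
End Perfect.
End PerfectCentraliser.

(** * A quotient of order 60 with a subgroup of index 5 *)

Module IcosahedralQuotient.
Import NcRing ClassEquation FpfRings OrderThreePairs QuaternionCoordinates GoldenValues Frames Points PerfectCentraliser.
Import GroupScope.

Lemma perfect_not_solvable (gT : finGroupType) (X : {group gT}) :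
  X^`(1) = X -> X :!=: 1 -> ~~ solvable X.
Proof.
move=> pX ntX; apply/negP=> solX; have := sol_der1_proper solX (subxx X) ntX.
by rewrite pX properxx.
Qed.

Section Perfect.
Variables (gT : finGroupType) (L : {group gT}) (R : unitRingType).
Variable rho : gT -> R.
Hypothesis rep : fpf_rep L rho.
Variable z : gT.
Hypotheses (Lz : z \in L) (oz : #[z] = 2).
Hypotheses (perfL : L^`(1) = L) (L8 : 8 %| #|L|).

Lemma frameJ i j p : frame L rho i j p -> j ^ p = i * j.
Proof.
case=> [[Li Lj Yp] [ii jj ji] ep]; have [Lp _] := order3P Yp.
apply: (@mulgI _ p); rewrite -conjgC; apply: (rho_inj rep); rewrite ?groupM //.
rewrite !(rhoM rep) ?groupM //; apply/eqP; rewrite -GRing.subr_eq0; apply/eqP.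
apply: (half0 (unit2 rep Lz oz)).
have -> : (rho j * rho p - rho p * (rho i * rho j) + (rho j * rho p - rho p * (rho i * rho j)) =
  rho j * (pure rho p - 1) - (pure rho p - 1) * (rho i * rho j))%R.
  by rewrite /pure; nc_prove tt.
by rewrite ep; nc_prove (tt, ii, jj, ji).
Qed.

(** Groups of order 12 and 24 are soluble. In order 60 the images of i and j generate a four-group V
    normalised by the image of p, so the index of its normaliser divides 5; index 1 would make the
    quotient soluble. *)
Lemma perfect_index5 p q : p \in order3 L -> q \in order3 L -> tr rho (p * q) = 0%R ->
  exists N M : {group gT},
    [/\ N <| L, z \in N, #|L : N| = 60, ~~ (4 %| #|N|) & [/\ N \subset M, M \subset L & #|L : M| = 5]].
Proof.
move=> Yp Yq pq0; pose N := 'C_L(order3 L)%G.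
have nN : N <| L := cent3_normal L.
have n4 : ~~ (4 %| #|N|) := cent3_no4 rep Lz oz Yp Yq pq0.
have nNL := normal_norm nN.
have zN : z \in N.
  rewrite inE Lz; apply/centP=> y /order3P[Ly _]; apply/esym/cent1P.
  exact: (subsetP (z_central rep Lz oz)).
have pX : (L / N)^`(1) = L / N by rewrite -quotient_der // perfL.
have cX : #|L / N| = #|L : N| by rewrite card_quotient.
have ntX : 1 < #|L : N| -> ~~ solvable (L / N).
  by move=> gt1; apply: perfect_not_solvable => //; rewrite -cardG_gt1 cX.
have i60 : #|L : N| = 60.
  have := card_cent_quotient rep Lz oz perfL L8 Yp Yq pq0; rewrite -/N.
  by case=> // e; (have := ntX; rewrite e => /(_ isT)/negP[]; apply: Burnside_p_a_q_b; rewrite cX e).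
have F := frame_of rep Lz oz Yp Yq pq0.
have [Lp op] := order3P Yp.
have [i [j [ip jp Li Lj [ii jj ji]]]] : exists i j, [/\ i ^ p = j, j ^ p = i * j, i \in L, j \in L &
  [/\ rho i * rho i = -1, rho j * rho j = -1 & rho j * rho i = - (rho i * rho j)]%R].
  have jp := frameJ F; case: F => [[Li Lj _] h _].
  by exists (z * (p * q)), ((z * (p * q)) ^ p).
have root w : w \in L -> (rho w * rho w = -1)%R -> w ^+ 2 = z.
  by move=> Lw ww; apply: (rho_inj rep); rewrite ?groupX // expgS expg1 (rhoM rep) // ww (rho_z rep Lz oz).
have notN w : w ^+ 2 = z -> w \notin N.
  move=> ww; apply: contra n4 => Nw; suff <- : #[w] = 4 by apply: order_dvdG.
  by apply: (@orderXpfactor _ 2 1 2 w); rewrite ?ww.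
have i2 := root i Li ii; have j2 := root j Lj jj.
have ij2 : (i * j) ^+ 2 = z by apply: root; [apply: groupM|rewrite !(rhoM rep) //; nc_prove (tt, ii, jj, ji)].
have jiz : j * i = z * (i * j).
  by apply: (rho_inj rep); rewrite ?groupM // !(rhoM rep) ?groupM // (rho_z rep Lz oz) ji GRing.mulN1r.
have nNw w : w \in L -> w \in 'N(N) := fun Lw => subsetP nNL w Lw.
have [nNi nNj nNp nNz] : [/\ i \in 'N(N), j \in 'N(N), p \in 'N(N) & z \in 'N(N)] by split; apply: nNw.
pose a := coset N i; pose b := coset N j; pose c := coset N p.
have a2 : a ^+ 2 = 1 by rewrite -morphX //= i2 coset_id.
have b2 : b ^+ 2 = 1 by rewrite -morphX //= j2 coset_id.
have nt w : w \in L -> w \notin N -> coset N w != 1.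
  by move=> Lw; apply: contra => /eqP/coset_idr; apply; apply: nNw.
have na : a != 1 by apply: nt (notN _ i2).
have nb : b != 1 by apply: nt (notN _ j2).
have nab : a * b != 1 by rewrite -morphM //; apply: nt (notN _ ij2); rewrite groupM.
have cab : commute a b by rewrite /commute -!morphM // jiz [RHS]morphM ?groupM //= (coset_id zN) mul1g.
have oa : #[a] = 2 by apply: nt_prime_order.
have ob : #[b] = 2 by apply: nt_prime_order.
pose V := (<[a]> <*> <[b]>)%G.
have cVab : <[b]> \subset 'C(<[a]>) by rewrite cent_cycle cycle_subG; apply/cent1P.
have oV : #|V| = 4.
  rewrite /= cent_joinEr // TI_cardMg -?orderE ?oa ?ob //.
  rewrite prime_TIg -?orderE ?oa // cycle_subG; apply/negP; case/cycleP=> n.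
  rewrite -(expg_mod n b2); case: (n %% 2) (ltn_pmod n (isT : 0 < 2)) => [|[|]] // _ e.
    by rewrite e eqxx in na.
  by case/eqP: nab; rewrite e -expgSr b2.
have ac : a ^ c = b by rewrite -morphJ // ip.
have nVc : c \in 'N(V).
  have bc : b ^ c = a * b by rewrite -morphJ // jp morphM.
  have aV : a \in V by rewrite mem_gen // inE cycle_id.
  have bV : b \in V by rewrite mem_gen // inE cycle_id orbT.
  by rewrite inE /= joingE -genJ gen_subG conjUg -!cycleJ ac bc subUset !cycle_subG bV groupM.
have oc : #[c] = 3.
  apply: nt_prime_order => //; first by rewrite -morphX // -op expg_order morph1.
  apply: contra nab => /eqP c1; move: ac; rewrite c1 conjg1 => <-.
  by rewrite -expg2 a2.
have VX : V \subset L / N by rewrite /= gen_subG subUset !cycle_subG !mem_quotient.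
have cN : c \in 'N_(L / N)(V) by rewrite inE mem_quotient.
have d12 : 12 %| #|'N_(L / N)(V)|.
  rewrite (@Gauss_dvd 4 3) //; apply/andP; split.
    by rewrite -oV cardSg // subsetI VX normG.
  by rewrite -oc; apply: order_dvdG.
have iX : (#|'N_(L / N)(V)| * #|L / N : 'N_(L / N)(V)|)%N = 60.
  by rewrite Lagrange ?subsetIl // cX.
have i5 : #|L / N : 'N_(L / N)(V)| = 5.
  have n1 : #|L / N : 'N_(L / N)(V)| <> 1%N.
    move/eqP; rewrite indexg_eq1 subsetI subxx /= => nV.
    have nsol : ~~ solvable (L / N) by apply: ntX; rewrite i60.
    case/negP: nsol; rewrite (series_sol (_ : V <| L / N)) ?/normal ?VX //.
    by rewrite !Burnside_p_a_q_b ?oV // card_quotient // -divgS //= oV cX i60.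
  case/dvdnP: d12 iX => k -> /eqP; rewrite mulnAC -[60]/(5 * 12)%N eqn_pmul2r // => /eqP iX.
  have : #|L / N : 'N_(L / N)(V)| %| 5 by rewrite -iX dvdn_mull.
  by case/primeP: (isT : prime 5) => _ h /h/pred2P[/n1|].
have [M eM sNM sML] := inv_quotientS nN (subsetIl (L / N) 'N(V)).
exists N, M; split=> //; split=> //.
by rewrite -(index_quotient_eq (H := N)) -?eM // (subset_trans (subsetIr _ _) sNM).
Qed.
End Perfect.
End IcosahedralQuotient.

(** * Consequences of GC* for central elements and degrees *)

Module GaloisConjugates.
Import Order.TTheory GRing.Theory Num.Theory.
Local Open Scope ring_scope.

Lemma GCstar_quotient (gT : finGroupType) (G H : {group gT}) :
  (H <| G)%g -> GCstar G -> GCstar (G / H)%G.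
Proof.
move=> nH GC i j ni nj ij.
have e k : 'chi_(mod_Iirr k) 1%g = 'chi[(G / H)%G]_k 1%g by rewrite mod_IirrE // cfMod1.
have [|||u Du] := GC (mod_Iirr i) (mod_Iirr j); rewrite ?e //.
exists u; move: Du; rewrite !mod_IirrE // cfAutMod => /(congr1 (fun phi => phi / H)%CF).
by rewrite !cfModK.
Qed.

Lemma GCstar_isog (gT rT : finGroupType) (G : {group gT}) (H : {group rT}) :
  (G \isog H)%g -> GCstar G -> GCstar H.
Proof.
case/isogP=> f injf defH GC i j; have iso : isom G H f by apply/isomP.
have pre k : exists k', 'chi[H]_k = cfIsom iso 'chi[G]_k'.
  have /irrP[k' ek] : cfIsom (isom_sym iso) 'chi_k \in irr G by rewrite cfIsom_irr mem_irr.
  by exists k'; rewrite -ek cfIsomKV.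
have [[i' ->] [j' ->]] := (pre i, pre j); rewrite !cfIsom1 => ni nj ij.
by have [u ->] := GC _ _ ni nj ij; exists u; rewrite cfAutIsom.
Qed.

Section OneGroup.
Variables (gT : finGroupType) (G : {group gT}).

Lemma lin_irrE (i : Iirr G) : ('chi_i \is a linear_char) = ('chi_i 1%g == 1).
Proof. by rewrite qualifE/= irr_char. Qed.

Lemma irr_central_value (i : Iirr G) x : (x \in 'Z(G))%g ->
  exists2 w, w ^+ #[x]%g = 1 & 'chi_i x = 'chi_i 1%g * w.
Proof.
move=> Zx; have [xi lxi Dxi] := cfcenter_Res 'chi_i.
have Zix : (x \in 'Z('chi_i)%CF)%g.
  by apply: subsetP Zx; rewrite -cap_cfcenter_irr; apply: bigcap_inf.
have sZG := cfcenter_sub 'chi_i.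
exists (xi x); first by rewrite -lin_charX // expg_order lin_char1.
by rewrite -(cfResE _ (cfcenter_sub 'chi_i) Zix) Dxi cfunE.
Qed.

Lemma cfDet_aut (u : {rmorphism algC -> algC}) (phi : 'CF(G)) :
  phi \is a character -> cfDet (cfAut u phi) = cfAut u (cfDet phi).
Proof.
case/char_reprP=> rG ->; rewrite -cfRepr_map !cfDetRepr.
apply/cfun_inP=> x Gx; rewrite !cfunE Gx !mulr1n !trace_mx11 !mxE map_reprE.
by rewrite det_map_mx.
Qed.

Hypothesis GC : GCstar G.

Lemma GCstar_mul_lin (i : Iirr G) lam : lam \is a linear_char -> 'chi_i 1%g != 1 ->
  exists u : {rmorphism algC -> algC}, lam * 'chi_i = cfAut u 'chi_i.
Proof.
move=> llam ni; have /irrP[j Dj] := mul_lin_irr llam (mem_irr i).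
have e1 : 'chi_j 1%g = 'chi_i 1%g by rewrite -Dj cfunE lin_char1 // mul1r.
by rewrite Dj; apply: GC; rewrite ?e1.
Qed.

(** For lam linear and chi nonlinear, [lam * chi] is Galois conjugate to chi and has the same
    kernel. If lam x is not 1, a power of lam cancels the scalar of x in chi; so x lies in the
    kernel of chi, but then not in that of [lam * chi]. *)
Lemma GCstar_central_der x : (x \in 'Z(G))%g -> prime #[x]%g -> (x \notin G^`(1))%g -> abelian G.
Proof.
move=> Zx px nx; have Gx := subsetP (center_sub G) x Zx.
have [j lj njx] : exists2 j : Iirr G, 'chi_j \is a linear_char & 'chi_j x != 1.
  apply/exists_inP; apply: contraNT nx; rewrite negb_exists_in => /forall_inP h.
  rewrite -cap_cfker_lin_irr; apply/bigcapP=> j lj.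
  by rewrite cfkerEirr inE (lin_char1 lj); apply: contraTT (h j lj) => ->.
apply/char_abelianP=> i; rewrite lin_irrE; apply: contraT => ni.
have ker lam : lam \is a linear_char -> (lam * 'chi_i) x = (lam * 'chi_i) 1%g -> 'chi_i x = 'chi_i 1%g.
  move=> llam e; have [u Du] := GCstar_mul_lin llam ni.
  have : (x \in cfker (lam * 'chi_i)%R)%g.
    have /irrP[k Dk] := mul_lin_irr llam (mem_irr i).
    by rewrite Dk cfkerEirr inE -Dk e.
  by rewrite Du cfker_aut cfkerEirr inE => /eqP.
have [w wx Dw] := irr_central_value i Zx.
have prim : (#[x]%g).-primitive_root ('chi_j x).
  have lx : ('chi_j x) ^+ #[x]%g = 1 by rewrite -lin_charX // expg_order lin_char1.
  have [m pm dm] := prim_order_exists (prime_gt0 px) lx.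
  case/primeP: px => _ /(_ m dm)/pred2P[m1|<- //].
  by case/eqP: njx; rewrite -(prim_expr_order pm) m1.
have [k Dk] := prim_rootP prim wx.
have i1 := irr1_neq0 i.
have w1 : w = 1.
  apply: (mulfI i1); rewrite mulr1 -Dw; apply: (ker ('chi_j ^+ (#[x]%g - k))); first exact: rpredX.
  rewrite !cfunE !exp_cfunE // (lin_char1 lj) expr1n mul1r Dw Dk mulrCA -exprD subnK ?(ltnW (ltn_ord k)) //.
  by rewrite (prim_expr_order prim) mulr1.
have ker1 : (x \in cfker 'chi_i)%g by rewrite cfkerEirr inE Dw w1 mulr1.
have [u Du] := GCstar_mul_lin lj ni; have : (x \in cfker ('chi_j * 'chi_i)%R)%g by rewrite Du cfker_aut.
have /irrP[k' Dk'] := mul_lin_irr lj (mem_irr i).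
rewrite Dk' cfkerEirr inE -Dk' !cfunE (lin_char1 lj) Dw w1 mulr1 mul1r => /eqP e.
by case/eqP: njx; apply: (mulIf i1); rewrite e mul1r.
Qed.

(** Suppose p does not divide m = chi(1). A twist by mu multiplies det chi by mu^m and preserves its
    order n. A twist of order p shows that p divides n; a twist by a suitable power of det chi
    itself then lowers the order. *)
Lemma GCstar_dvd_irr1 p (i : Iirr G) : prime p -> (p %| #|G : G^`(1)|%g)%N -> 'chi_i 1%g != 1 ->
  (p %| Num.truncn ('chi_i 1%g))%N.
Proof.
move=> pr_p dp ni; apply: contraT; set m := Num.truncn _ => npm.
have [linG [cF [injF oF linF _] [F1 FM FX _ Fo]]] := lin_char_group G.
have [|v _ ov] := @Cauchy _ p [set: linG] pr_p; first by rewrite cardsT oF.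
pose lam := cF v; have llam : lam \is a linear_char := linF v.
have olam : #[lam]%CF = p by rewrite Fo.
set del := cfDet 'chi_i; have ldel : del \is a linear_char := cfDet_lin_char _.
have detM mu : mu \is a linear_char -> cfDet (mu * 'chi_i) = mu ^+ m * del.
  by move=> lmu; rewrite cfDet_mul_lin ?irr_char.
have ord mu : mu \is a linear_char -> #[mu ^+ m * del]%CF = #[del]%CF.
  by move=> lmu; have [u Du] := GCstar_mul_lin lmu ni; rewrite -detM // Du cfDet_aut ?irr_char // cforder_aut.
pose n := #[del]%CF; have n0 : (0 < n)%N by apply: cforder_lin_char_gt0.
have copm : coprime p m by rewrite prime_coprime.
have dn : (p %| n)%N.
  have : (#[lam]%CF %| m * n)%N.
    rewrite dvdn_cforder exprM; have := ord _ llam; rewrite -/n => en.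
    have : (lam ^+ m * del) ^+ n = 1 by apply/eqP; rewrite -dvdn_cforder en.
    have d1 : del ^+ n = 1 by apply/eqP; rewrite -dvdn_cforder.
    by rewrite exprMn d1 mulr1 => ->.
  by rewrite olam Gauss_dvdr.
(* A multiple e m of m that is -1 modulo p: the twist by [del ^+ e] has determinant [del ^+ c.+1],
   whose order divides n / p. *)
pose c := chinese p m p.-1 0.
have [e De] : exists e, c = (e * m)%N.
  by apply/dvdnP; rewrite /dvdn (chinese_modr copm) mod0n.
have dc : (p %| c.+1)%N.
  by rewrite /dvdn -addn1 -modnDml (chinese_modl copm) modnDml addn1 prednK ?prime_gt0 // modnn.
have := ord _ (rpredX e ldel); rewrite -exprM -De -exprSr -/n => en.
have : (n %| n %/ p)%N.
  rewrite -{1}en dvdn_cforder -exprM; case/dvdnP: dc => k ->.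
  rewrite -mulnA [(p * _)%N]mulnC divnK // mulnC exprM.
  by rewrite (_ : del ^+ n = 1) ?expr1n //; apply/eqP; rewrite -dvdn_cforder.
case: (ltnP (n %/ p) n) => [lt|]; last by rewrite leqNgt ltn_Pdiv ?prime_gt1.
by rewrite gtnNdvd // divn_gt0 ?prime_gt0 // dvdn_leq.
Qed.
End OneGroup.
End GaloisConjugates.

(** * Transfer and normal complements *)

Module Transfer.
Import GroupScope.

Section Transfer.
Variables (gT : finGroupType) (G P : {group gT}).
Hypotheses (sPG : P \subset G) (abP : abelian P) (coP : coprime #|P| #|G : P|).

(** By the fusion condition every orbit of g on the cosets contributes a power of g itself, so the
    transfer of g is g to the index of P. It is trivial on the derived group, and the index is prime
    to the order of P. *)
Lemma transfer_der1 g : g \in P ->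
    (forall n x, x \in G -> (g ^+ n) ^ x \in P -> (g ^+ n) ^ x = g ^+ n) ->
  g \in G^`(1) -> g = 1.
Proof.
move=> Pg fus Dg; have Gg := subsetP sPG g Pg.
have abA : abelian (idm P @* P) by rewrite morphim_idm.
have t0 : transfer G abA g = 0%R.
  have : transfer_morphism G abA g \in (transfer_morphism G abA @* G)^`(1).
    by rewrite -morphim_der // mem_morphim // (subsetP (der_sub 1 G)).
  rewrite (_ : _^`(1) = 1) => [/set1P //|]; apply/derG1P.
  by apply/centsP=> u _ v _; apply: GRing.addrC.
have [X trX] : exists X, is_transversal X (rcosets P G :* <[g]>) G.
  by exists (transversal (rcosets P G :* <[g]>) G); apply/transversalP/rcosets_cycle_partition.
have := transfer_cycle_expansion sPG abA Gg trX; rewrite t0 => /esym e.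
have {}e : g ^+ #|G : P| = 1.
  rewrite -(sum_index_rcosets_cycle sPG Gg trX).
  transitivity (FiniteModule.fmval (0%R : FiniteModule.fmod_of abA)); last by [].
  rewrite -e FiniteModule.fmval_sum.
  elim/big_rec2: _ => [//|x n h Xx <-]; rewrite expgD; congr (_ * _).
  set k := (#|_ : _|).
  have Pk : (g ^+ k) ^ x^-1 \in P.
    by rewrite conjgE invgK mulgA -mem_rcoset; apply: mulg_exp_card_rcosets.
  have Gx : x \in G by apply: (subsetP (transversal_sub trX)).
  rewrite /= FiniteModule.fmodK; last by rewrite mem_morphim.
  rewrite /idm /=.
  by rewrite fus ?groupV.
by apply/eqP; rewrite -order_eq1 -dvdn1 -(eqnP coP) dvdn_gcd order_dvdG //= order_dvdn e.
Qed.
End Transfer.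

Lemma transfer_central (gT : finGroupType) (G P : {group gT}) g : P \subset G -> abelian P ->
  coprime #|P| #|G : P| -> g \in P -> g \in 'Z(G) -> g \in G^`(1) -> g = 1.
Proof.
move=> sPG abP coP Pg /setIP[Gg /centP cg]; apply: (transfer_der1 sPG) => // n x Gx _.
by rewrite conjXg (_ : g ^ x = g) //; apply/conjg_fixP/commgP; apply: cg.
Qed.

Lemma Sylow_coindex (gT : finGroupType) (G P : {group gT}) p : p.-Sylow(G) P -> coprime #|P| #|G : P|.
Proof. by case/and3P=> _ pP p'i; apply: pnat_coprime pP p'i. Qed.

(** Burnside: P and [P :^ x] are Sylow subgroups of the centraliser of [g ^ x], so x can be
    corrected there to an element normalising P. *)
Lemma Sylow_fusion (gT : finGroupType) (G P : {group gT}) p g x : p.-Sylow(G) P -> abelian P ->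
  'N_G(P) \subset 'C(P) -> g \in P -> x \in G -> g ^ x \in P -> g ^ x = g.
Proof.
move=> sylP abP nc Pg Gx Pgx; have [sPG pP _] := and3P sylP.
pose C := 'C_G[g ^ x]%G.
have sPC : P \subset C by rewrite subsetI sPG sub_cent1; apply: (subsetP abP).
have sPxC : P :^ x \subset C.
  rewrite subsetI conj_subG //= sub_cent1 centJ memJ_conjg; exact: (subsetP abP).
have sylPC : p.-Sylow(C) P by apply: pHall_subl sylP; rewrite ?subsetIl.
have sylPxC : p.-Sylow(C) (P :^ x)%G.
  by apply: pHall_subl sPxC (subsetIl _ _) _; rewrite pHallJ.
have [c Cc e] := Sylow_trans sylPxC sylPC.
have [Gc /cent1P cc] := setIP Cc.
have nxc : x * c \in 'N_G(P) by rewrite inE groupM //= inE conjsgM /= -e.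
have : g ^ (x * c) = g.
  by apply/conjg_fixP/commgP/commute_sym; apply: (centP (subsetP nc _ nxc)).
by rewrite conjgM conjgE -cc mulKg.
Qed.

Lemma Sylow_der1_TI (gT : finGroupType) (G P : {group gT}) p : p.-Sylow(G) P -> abelian P ->
  'N_G(P) \subset 'C(P) -> P :&: G^`(1) = 1.
Proof.
move=> sylP abP nc; apply/trivgP/subsetP=> g /setIP[Pg Dg]; apply/set1P.
apply: (transfer_der1 (pHall_sub sylP) abP (Sylow_coindex sylP) Pg) => // n x Gx.
by apply: (Sylow_fusion sylP) => //; apply: groupX.
Qed.

(** The automorphism group of P has order p - 1 times a power of p. The automiser of P is prime to
    p, so its order divides p - 1, and a prime dividing it would be below p. *)
Lemma cyclic_Sylow_norm_cent (gT : finGroupType) (G P : {group gT}) p : p.-Sylow(G) P -> cyclic P ->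
  (forall r, prime r -> r %| #|G| -> p <= r) -> 'N_G(P) \subset 'C(P).
Proof.
move=> sylP cyP min; have [sPG pP p'i] := and3P sylP; have abP := cyclic_abelian cyP.
have [P1|ntP] := eqVneq (P : {set gT}) 1.
  by rewrite P1 cents1.
have [p_pr _ [m oP]] := pgroup_pdiv pP ntP.
have sNN : 'N_G(P) \subset 'N(P) by apply: subsetIr.
have := cardSg (Aut_conj_aut P 'N_G(P)); rewrite card_morphim (setIidPr sNN) ker_conj_aut.
rewrite card_Aut_cyclic // oP totient_pfactor //= => dv.
suff: #|'N_G(P) : 'C(P)| == 1%N by rewrite indexg_eq1.
have p'n : p^'.-nat #|'N_G(P) : 'C(P)|.
  apply: pnat_dvd p'i; apply: dvdn_trans (_ : #|'N_G(P) : P| %| _).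
    exact: indexgS.
  by apply: indexSg; rewrite ?subsetIl // subsetI sPG normG.
have {dv} : #|'N_G(P) : 'C(P)| %| p.-1.
  rewrite p'natE // in p'n.
  by move: dv; rewrite mulnC Gauss_dvdr // coprime_sym coprimeXl // prime_coprime.
have dG : #|'N_G(P) : 'C(P)| %| #|G|.
  by apply: dvdn_trans (cardSg (subsetIl G 'N(P))); rewrite -indexgI dvdn_indexg.
move: #|_ : _| dG p'n => n dG p'n dn; apply: contraT => n1.
have n2 : 1 < n.
  by case: n n1 dG {p'n dn} => [|[|n]] //; rewrite dvd0n eqn0Ngt cardG_gt0.
have := min _ (pdiv_prime n2) (dvdn_trans (pdiv_dvd n) dG).
have : pdiv n <= p.-1.
  by rewrite (leq_trans (pdiv_leq _)) ?(ltnW n2) // dvdn_leq // -subn1 subn_gt0 prime_gt1.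
by rewrite -{2}(prednK (prime_gt0 p_pr)) ltnNge => ->.
Qed.

Lemma der1_p'group (gT : finGroupType) (G P : {group gT}) p : p.-Sylow(G) P ->
  P :&: G^`(1) = 1 -> p^'.-group G^`(1).
Proof.
move=> sylP ti; have /and3P[_ _] := Sylow_setI_normal (der_normal 1 G) sylP.
by rewrite /= setIC ti indexg1.
Qed.

Lemma pcore_der1_Hall (gT : finGroupType) (G P : {group gT}) p : p.-Sylow(G) P ->
  P :&: G^`(1) = 1 -> p^'.-Hall(G) 'O_p^'(G).
Proof.
move=> sylP ti; have p'D := der1_p'group sylP ti.
have nD := der_normal 1 G.
rewrite -(pquotient_pHall _ nD) ?(normalS (pcore_max p'D nD) (pcore_sub _ _) nD) //.
rewrite -pquotient_pcore // nilpotent_pcore_Hall // abelian_nil //.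
exact: der_abelian.
Qed.
End Transfer.

(** * Sylow subgroups of a fixed-point-free group *)

Module FpfSylow.
Import NcRing ClassEquation FpfRings GaloisConjugates Transfer.
Import GroupScope GRing.Theory.
Local Open Scope ring_scope.

Section FPF.
Variables (gT : finGroupType) (L : {group gT}) (R : unitRingType).
Variable rho : gT -> R.
Hypothesis rep : fpf_rep L rho.
Hypothesis uL : {in \pi(L), forall p, p%:R \is a @GRing.unit R}.

Lemma rhoX x n : x \in L -> rho (x ^+ n)%g = rho x ^+ n.
Proof.
by move=> Lx; elim: n => [|n IH]; rewrite ?(rho1 rep) // expgS exprS (rhoM rep) ?groupX // IH.
Qed.

Lemma rho_geom c n : c \in L -> c != 1%g -> (c ^+ n = 1)%g -> \sum_(i < n) rho (c ^+ i)%g = 0.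
Proof.
move=> Lc ntc cn; under eq_bigr do rewrite rhoX //.
apply: (rho_fix rep Lc ntc); apply/eqP; rewrite -subr_eq0 -{2}[\sum_(_ < _) _]mul1r -mulrBl -subrX1.
by rewrite -rhoX // cn (rho1 rep) subrr.
Qed.

Let prime_neq0 p : prime p -> (p %| #|L|)%N -> (p%:R : R) != 0.
Proof.
move=> pr_p pL; apply: contraTneq (uL (_ : p \in \pi(L))) => [->|]; first by rewrite unitr0.
by rewrite mem_primes pr_p cardG_gt0.
Qed.

(* Averages over the p subgroups <x y^i> vanish; summing them gives p = 0 unless y = 1. *)
Lemma fpf_comm_prime p x y : prime p -> x \in L -> y \in L -> #[x]%g = p -> #[y]%g = p ->
  commute x y -> y \in <[x]>%g.
Proof.
move=> pr_p Lx Ly ox oy cxy; apply: contraT => nyx.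
have xp : (x ^+ p = 1)%g by rewrite -ox expg_order.
have yp : (y ^+ p = 1)%g by rewrite -oy expg_order.
have ex : <[x]>%g = <[x^-1]>%g by rewrite cycleV.
have nt i : (x * y ^+ i != 1)%g.
  apply: contra nyx => /eqP e.
  have yi : (y ^+ i \in <[x]>)%g by rewrite ex; apply/cycleP; exists 1%N; rewrite expg1 -[RHS]mulg1 -e mulKg.
  have nti : (y ^+ i != 1)%g.
    by apply: contraTneq (prime_gt1 pr_p) => yi1; rewrite -ox -leqNgt; move: e; rewrite yi1 mulg1 => ->; rewrite order1.
  have : (#[y ^+ i] = p)%g by apply: nt_prime_order => //; rewrite -expgM mulnC expgM yp expg1n.
  move=> oyi; have sub : <[y ^+ i]>%g \subset <[y]>%g by rewrite cycle_subG mem_cycle.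
  have : <[y ^+ i]>%g = <[y]>%g by apply/eqP; rewrite eqEcard sub -!orderE oyi oy /=.
  by move=> eyi; rewrite -cycle_subG -eyi cycle_subG.
have s0 : \sum_(i < p) \sum_(j < p) rho ((x * y ^+ i) ^+ j)%g = 0.
  apply: big1 => i _; apply: rho_geom; rewrite ?groupM ?groupX // expgMn; last exact: commuteX.
  by rewrite xp -expgM mulnC expgM yp expg1n mulg1.
rewrite exchange_big /= (bigD1 (Ordinal (prime_gt0 pr_p))) //= [X in _ + X]big1 ?addr0 in s0.
  move: s0; under eq_bigr do rewrite expg0 (rho1 rep).
  rewrite sumr_const card_ord => /eqP; rewrite (negPf (prime_neq0 _ _)) // -ox.
  by rewrite order_dvdG.
move=> j nj; transitivity (\sum_(i < p) rho (x ^+ j)%g * rho ((y ^+ j) ^+ i)%g).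
  apply: eq_bigr => i _; rewrite -(rhoM rep) ?groupX // expgMn; last exact: commuteX.
  by rewrite -!expgM mulnC.
rewrite -mulr_sumr rho_geom ?mulr0 ?groupX //; last by rewrite -expgM mulnC expgM yp expg1n.
have j0 : (0 < j)%N by rewrite lt0n -[0%N]/(val (Ordinal (prime_gt0 pr_p))) val_eqE.
by rewrite -order_dvdn oy gtnNdvd.
Qed.

(** Sum over the conjugates of [<[y]>] by the r powers of x; each cyclic sum vanishes. For k nonzero
    the conjugates of y^k are y^k c^i with c nontrivial in [<[x]>], and they sum to 0 as well; the
    terms with k = 0 leave r = 0, but r is a unit. *)
Lemma fpf_pr x y : x \in L -> y \in L -> prime #[x]%g -> prime #[y]%g -> (y \in 'N(<[x]>))%g ->
  commute x y.
Proof.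
move=> Lx Ly prx pry ny; apply/eqP; apply: contraT => nc.
set r := #[x]%g in prx; set p := #[y]%g in pry.
have xr : (x ^+ r = 1)%g by rewrite expg_order.
have yp : (y ^+ p = 1)%g by rewrite expg_order.
have s0 : \sum_(i < r) \sum_(k < p) rho ((y ^+ k) ^ (x ^+ i))%g = 0.
  apply: big1 => i _; under eq_bigr do rewrite conjXg; apply: rho_geom.
  - by rewrite groupJ ?groupX.
  - by rewrite -order_eq1 orderJ -/p neq_ltn prime_gt1 ?orbT.
  by rewrite -conjXg yp conj1g.
rewrite exchange_big /= (bigD1 (Ordinal (prime_gt0 pry))) //= [X in _ + X]big1 ?addr0 in s0.
  move: s0; under eq_bigr do rewrite expg0 conj1g (rho1 rep).
  by rewrite sumr_const card_ord => /eqP; rewrite (negPf (prime_neq0 _ _)) // order_dvdG.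
move=> k nk; set w := (y ^+ k)%g; have Lw : w \in L by rewrite groupX.
have nw : (w \in 'N(<[x]>))%g by rewrite groupX.
have cw v v' : (v \in <[x]> -> v' \in <[x]> -> commute v v')%g.
  by move=> xv xv'; apply: (centsP (cycle_abelian x)).
have xx : (x^-1 ^ w \in <[x]>)%g by rewrite memJ_norm // groupV cycle_id.
pose c := (x^-1 ^ w * x)%g.
have xc : (c \in <[x]>)%g by rewrite groupM // cycle_id.
transitivity (\sum_(i < r) rho w * rho (c ^+ i)%g).
  apply: eq_bigr => i _; rewrite -(rhoM rep) ?groupX ?groupM ?groupJ ?groupV //; congr rho.
  rewrite expgMn; last by apply: cw => //; apply: cycle_id.
  by rewrite -conjXg expgVn !conjgE !mulgA mulgV mul1g.
rewrite -mulr_sumr rho_geom ?mulr0 ?groupM ?groupJ ?groupV //; last first.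
  by apply/eqP; rewrite -order_dvdn order_dvdG.
apply: contra nc; rewrite /c => /eqP e.
have cxw : commute x w.
  apply/commgP/conjg_fixP; apply: invg_inj; rewrite -conjVg.
  by apply: (mulIg x); rewrite e mulVg.
have : y \in <[w]>%g.
  rewrite (_ : <[w]>%g = <[y]>%g) ?cycle_id //; apply/esym/eqP.
  rewrite -[_ == _]/(generator _ _) generator_coprime prime_coprime //.
  have k0 : (0 < k)%N by rewrite lt0n -[0%N]/(val (Ordinal (prime_gt0 pry))) val_eqE.
  by rewrite gtnNdvd.
by case/cycleP=> m ->; apply/eqP/commuteX.
Qed.

(** Every element of order p commutes with a central one, so [fpf_comm_prime] puts it into one
    cyclic group. *)
Lemma fpf_Ohm1 (p : nat) (P : {group gT}) : p.-group P -> P \subset L -> P :!=: 1%g -> #|'Ohm_1(P)%g| = p.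
Proof.
move=> pP sPL ntP; have [pr_p _ _] := pgroup_pdiv pP ntP.
have ntZ : ('Z(P) != 1)%g by rewrite (center_nil_eq1 (pgroup_nil pP)).
have [_ dp _] := pgroup_pdiv (pgroupS (center_sub P) pP) ntZ.
have [c Zc oc] := Cauchy pr_p dp.
have [Pc /centP cc] := setIP Zc.
rewrite -oc orderE; congr #|pred_of_set _|; rewrite (OhmE 1 pP); apply/eqP.
rewrite eqEsubset gen_subG cycle_subG mem_gen ?andbT; last first.
  by rewrite !inE Pc expn1 -oc expg_order eqxx.
apply/subsetP=> x; rewrite !inE expn1 => /andP[Px /eqP xp].
have [->|ntx] := eqVneq x 1%g; first exact: group1.
have ox : #[x]%g = p by apply: nt_prime_order.
by apply: (fpf_comm_prime pr_p _ _ oc ox); rewrite ?(subsetP sPL) //; apply: cc.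
Qed.

Lemma fpf_pgroup (p : nat) (P : {group gT}) : p.-group P -> P \subset L -> P :!=: 1%g ->
  cyclic P || (p == 2%N) && (extremal_class P == Quaternion).
Proof. by move=> pP sPL ntP; apply/(prime_Ohm1P pP ntP)/fpf_Ohm1. Qed.

Lemma fpf_odd_cyclic (p : nat) (P : {group gT}) : p.-group P -> P \subset L -> odd p -> cyclic P.
Proof.
move=> pP sPL op; have [->|ntP] := eqVneq (P : {set gT}) 1%g; first exact: cyclic1.
by case/orP: (fpf_pgroup pP sPL ntP) => // /andP[/eqP p2]; rewrite p2 in op.
Qed.

(** Otherwise [[~: P, <[y]>]] has an element x of order r. As P is cyclic, y normalises [<[x]>] and
    centralises it by [fpf_pr], whereas coprime action leaves y no nontrivial fixed point there. *)
Lemma fpf_coprime_cent (r : nat) (P : {group gT}) y : r.-group P -> P \subset L -> odd r ->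
  y \in L -> prime #[y]%g -> #[y]%g != r -> (y \in 'N(P))%g -> (y \in 'C(P))%g.
Proof.
move=> rP sPL odr Ly pry nr nPy.
have [->|ntP] := eqVneq (P : {set gT}) 1%g; first by rewrite cent1T inE.
have [pr_r _ _] := pgroup_pdiv rP ntP.
have cyP := fpf_odd_cyclic rP sPL odr.
have nPY : (<[y]> \subset 'N(P))%g by rewrite cycle_subG.
have cop : coprime #|P| #|<[y]>%g|.
  by have [n ->] := p_natP rP; rewrite -orderE coprimeXl // prime_coprime // dvdn_prime2 // eq_sym.
have sRP : ([~: P, <[y]>] \subset P)%g by rewrite commg_subl.
have := coprime_abel_cent_TI nPY cop (cyclic_abelian cyP).
have [R1 _|ntR] := eqVneq [~: P, <[y]>]%g 1%g.
  by move/commG1P: R1; rewrite centsC cycle_subG.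
have [_ dR _] := pgroup_pdiv (pgroupS sRP rP) ntR.
have [x Rx ox] := Cauchy pr_r dR; have Px := subsetP sRP x Rx.
move=> ti; have : x \in ('C_[~: P, <[y]>](<[y]>))%g.
  rewrite inE Rx cent_cycle; apply/cent1P; apply: fpf_pr; rewrite ?(subsetP sPL x Px) ?ox //.
  have nx : ('N(P) \subset 'N(<[x]>))%g by apply: char_norms; rewrite sub_cyclic_char // cycle_subG.
  exact: (subsetP nx).
by rewrite ti inE -order_eq1 ox => /eqP r1; rewrite r1 in pr_r.
Qed.

End FPF.
End FpfSylow.

(** * Groups of odd order *)

Module FpfOdd.
Import NcRing ClassEquation FpfRings GaloisConjugates Transfer FpfSylow.
Import GroupScope.

Section FPF.
Variables (gT : finGroupType) (L : {group gT}) (R : unitRingType).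
Variable rho : gT -> R.
Hypothesis rep : fpf_rep L rho.
Hypothesis uL : {in \pi(L), forall p, (p%:R)%R \is a @GRing.unit R}.

(** For the smallest prime p, transfer makes L' a p'-group. An element y of order p normalises and
    then centralises a Sylow r-subgroup of L' for every r, hence centralises L' and is central in L;
    [GCstar_central_der] applies. *)
Lemma fpf_odd_abelian : GCstar L -> odd #|L| -> abelian L.
Proof.
move=> GC oddL; have [->|ntL] := eqVneq (L : {set gT}) 1; first exact: abelian1.
pose p := pdiv #|L|; have pr_p : prime p by rewrite pdiv_prime ?cardG_gt1.
have min r : prime r -> (r %| #|L|) -> (p <= r) by move=> pr_r; apply: pdiv_min_dvd (prime_gt1 pr_r).
have odd_d r : (r %| #|L|) -> odd r by move=> d; apply: dvdn_odd d oddL.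
have [P sylP] := Sylow_exists p L; have [sPL pP _] := and3P sylP.
have cyP : cyclic P by apply: (fpf_odd_cyclic rep uL pP sPL); rewrite odd_d ?pdiv_dvd.
have abP := cyclic_abelian cyP.
have ti := Sylow_der1_TI sylP abP (cyclic_Sylow_norm_cent sylP cyP min).
have p'D := der1_p'group sylP ti.
have [|y Py oy] := @Cauchy _ p P pr_p.
  rewrite (card_Hall sylP) p_part dvdn_exp ?logn_gt0 //.
  by rewrite mem_primes pr_p cardG_gt0 pdiv_dvd.
have Ly := subsetP sPL y Py.
have nDy : (y \in 'N(L^`(1))) by apply: subsetP Ly; apply: der_norm.
have cDy : (L^`(1) \subset 'C[y]).
  rewrite -indexg_eq1; apply: contraT => ne1.
  have i1 : (1 < #|L^`(1) : 'C[y]|) by rewrite ltn_neqAle eq_sym ne1 indexg_gt0.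
  pose r := pdiv #|L^`(1) : 'C[y]|; have pr_r : prime r by apply: pdiv_prime.
  have ri : (r %| #|L^`(1) : 'C[y]|) by apply: pdiv_dvd.
  have rD : (r %| #|L^`(1)|) by apply: dvdn_trans ri _; rewrite -indexgI dvdn_indexg.
  have rp : p != r.
    by apply: contraTneq rD => <-; rewrite -p'natE.
  (* The number of Sylow r-subgroups divides the order of L', which is prime to p, so y fixes one of
     them. *)
  have [Q nQ sylQ] : exists2 Q : {group gT}, (y \in 'N(Q)) & r.-Sylow(L^`(1)) Q.
    have acts : [acts <[y]>, on 'Syl_r(L^`(1)) | 'JG].
      apply: subset_trans (_ : 'N(L^`(1)) \subset _); first by rewrite cycle_subG.
      apply/subsetP=> x nx; rewrite !inE; apply/subsetP=> Q; rewrite !inE /= => sylQ.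
      by rewrite -(normP nx) pHallJ2.
    have py : p.-group <[y]> by rewrite /pgroup -orderE oy pnat_id.
    have := pgroup_fix_mod py acts; case: (set_0Vmem 'Fix_('Syl_r(L^`(1)) | 'JG)(<[y]>)) => [->|[Q]].
      rewrite cards0 mod0n => /eqP dS; have : p %| #|L^`(1)| := dvdn_trans dS (card_Syl_dvd _ _).
      by move: p'D; rewrite /pgroup p'natE // => /negPf->.
    case/setIP=> sylQ /afixP fQ _; exists Q; last by rewrite inE in sylQ.
    by apply/normP; have /(congr1 val) := fQ y (cycle_id y).
  have [sQD rQ r'i] := and3P sylQ.
  have sQL : Q \subset L by apply: subset_trans sQD (der_sub 1 L).
  have cQy : (Q \subset 'C[y]).
    rewrite sub_cent1; apply: (fpf_coprime_cent rep uL rQ sQL _ Ly); rewrite ?oy //.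
    by apply: odd_d; apply: dvdn_trans rD (cardSg (der_sub 1 L)).
  have : r^'.-nat #|L^`(1) : 'C[y]| by apply: pnat_dvd r'i; apply: indexgS.
  by rewrite p'natE // ri.
apply: (GCstar_central_der GC (x := y)); rewrite ?oy //.
  rewrite inE Ly; apply/centP=> g Lg; apply/commgP; set c := [~ y, g].
  have Dc : (c \in L^`(1)) by apply: mem_commg.
  have cyc : commute y c by apply/commute_sym; apply/cent1P/(subsetP cDy).
  (* y c is a conjugate of y and c commutes with y, so c^p = 1 inside the p'-group L'. *)
  have : ((y * c) ^+ p = 1) by rewrite /c commgEl mulKVg -conjXg -oy expg_order conj1g.
  rewrite expgMn // -{1}oy expg_order mul1g => cp.
  rewrite -order_eq1 -dvdn1 -(eqnP (_ : coprime p #|L^`(1)|)) ?dvdn_gcd ?order_dvdG // ?andbT.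
    by rewrite order_dvdn cp.
  by rewrite prime_coprime // -p'natE.
apply/negP=> Dy; have : y \in (P :&: L^`(1)) by rewrite inE Py.
by rewrite ti inE -order_eq1 oy => /eqP p1; rewrite p1 in pr_p.
Qed.
End FPF.
End FpfOdd.

(** * Characters that are odd at the central involution *)

Module OddCharacters.
Import NcRing ClassEquation FpfRings GaloisConjugates Transfer FpfSylow FpfOdd.
Import GroupScope Order.TTheory GRing.Theory Num.Theory.

Lemma quaternion_facts (gT : finGroupType) (S : {group gT}) : extremal_class S = Quaternion ->
  exists n x y, [/\ 2 < n, #|S| = (2 ^ n)%N, x \in S, #[x] = (2 ^ n.-1)%N & y \in S :\: <[x]>] /\
    [/\ <[x]> <| S, {in <[x]> & S :\: <[x]>, forall u t, u ^ t = u^-1},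
        {in S :\: <[x]>, forall t, #[t] = 4},
        S^`(1) = <[x ^+ 2]> & 'Z(S) = <[x ^+ (2 ^ n.-2)]>].
Proof.
case/quaternion_classP=> n n2 iso; have [[x y] gen [oy y2 xy]] := generators_quaternion n2 iso.
have [oS Sx ox X'y] := gen.
have [[_ o4 inv] [der _ _ _] [Z _ _ _ _] _ _] := quaternion_structure n2 gen iso.
have [_ _ nX _ _] := extremal_generators_facts (isT : prime 2) gen.
by exists n, x, y; split.
Qed.

Local Open Scope ring_scope.

Lemma irr_mul_center (gT : finGroupType) (G : {group gT}) (i : Iirr G) x y :
  x \in G -> y \in 'Z(G) -> 'chi_i 1%g * 'chi_i (x * y)%g = 'chi_i x * 'chi_i y.
Proof.
move=> Gx Zy; have : y \in 'Z('chi_i)%CF.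
  by apply: subsetP Zy; rewrite -cap_cfcenter_irr; apply: bigcap_inf.
rewrite -irrRepr cfcenter_repr !cfunE => /setIdP[Gy /is_scalar_mxP[e De]].
rewrite repr_mx1 group1 (groupM Gx Gy) (repr_mxM _ Gx Gy) Gx Gy De.
by rewrite ?mulr1n mul_mx_scalar mxtraceZ mxtrace1 mxtrace_scalar -[e *+ _]mulr_natr; ring.
Qed.

Section Involution.
Variables (gT : finGroupType) (L : {group gT}) (z : gT).
Hypotheses (Lz : z \in L) (oz : #[z] = 2%N) (cz : L \subset 'C[z]).

Let z2 : (z ^+ 2 = 1)%g. Proof. by rewrite -oz expg_order. Qed.
Let Zz : z \in 'Z(L). Proof. by rewrite inE Lz -sub_cent1. Qed.

Lemma odd_irr_z (i : Iirr L) : z \notin cfker 'chi_i -> 'chi_i z = - 'chi_i 1%g.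
Proof.
rewrite cfkerEirr inE; have [w wz ->] := irr_central_value i Zz.
move: wz; rewrite oz => /eqP; rewrite sqrf_eq1 => /orP[]/eqP->; first by rewrite mulr1 eqxx.
by rewrite mulrN1.
Qed.

Lemma odd_irr_zM (i : Iirr L) x : z \notin cfker 'chi_i -> x \in L -> 'chi_i (z * x)%g = - 'chi_i x.
Proof.
move=> ni Lx; apply: (mulfI (irr1_neq0 i)); rewrite -(cent1P (subsetP cz x Lx)).
by rewrite irr_mul_center // odd_irr_z // mulrN mulrC mulrN.
Qed.

(* On <i> the values of chi are chi(1), 0, -chi(1), 0, so a faithful linear character of <i> has
   multiplicity chi(1)/2 in chi. *)
Lemma odd_irr1_even (j : Iirr L) a b : a \in L -> b \in L -> (a ^+ 2 = z)%g -> (a ^ b = a^-1)%g ->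
  z \notin cfker 'chi_j -> exists m : nat, 'chi_j 1%g = (2 * m)%:R.
Proof.
move=> La Lb a2 ab nz.
have a4 : #[a] = 4%N by apply: (@orderXpfactor _ 2 1 2 a); rewrite ?expn1 ?a2.
have aV : (a^-1 = z * a)%g.
  by apply: (mulIg a); rewrite mulVg -mulgA -expg2 a2 -expg2 z2.
have chi_a : 'chi_j a = 0.
  have : 'chi_j a^-1%g = 'chi_j a by rewrite -ab cfunJ.
  by rewrite aV odd_irr_zM // => /eqP; rewrite eq_sym -addr_eq0 -mulr2n mulrn_eq0 => /eqP.
have chi_aV : 'chi_j a^-1%g = 0 by rewrite -ab cfunJ.
have za : z \in <[a]> by rewrite -a2 mem_cycle.
have [k nk] : exists k : Iirr <[a]>, z \notin cfker 'chi_k.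
  apply/existsP; apply: contraT; rewrite negb_exists => /forallP h.
  have : z \in \bigcap_i cfker 'chi[<[a]>]_i by apply/bigcapP=> i _; have := h i; rewrite negbK.
  by rewrite TI_cfker_irr inE -order_eq1 oz.
have lk : 'chi_k \is a linear_char by apply/char_abelianP/cycle_abelian.
have kz : 'chi_k z = -1.
  move: nk; rewrite cfkerEirr inE (lin_char1 lk) => nk.
  have : 'chi_k z ^+ 2 == 1 by rewrite -lin_charX // z2 lin_char1.
  by rewrite sqrf_eq1 (negPf nk) => /eqP.
have sub : <[a]> \subset L by rewrite cycle_subG.
have dot : '['Res[<[a]>] 'chi_j, 'chi_k] = 'chi_j 1%g / 2%:R.
  rewrite cfdotE -orderE a4 (bigD1 1%g) ?group1 //= (bigD1 z) /=; last first.
    by rewrite za -order_eq1 oz.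
  rewrite big1 ?addr0 => [|x /andP[/andP[ax n1] nxz]].
    rewrite (cfResE _ sub (group1 _)) (cfResE _ sub za) kz (lin_char1 lk) (odd_irr_z nz) !rmorphN !rmorph1.
    by field.
  rewrite cfResE //; have [->|->] : (x = a \/ x = a^-1)%g; last 2 first.
  - by rewrite chi_a mul0r.
  - by rewrite chi_aV mul0r.
  case/cycleP: ax n1 nxz => m ->; rewrite -(expg_mod m (_ : a ^+ 4 = 1)%g) -?a4 ?expg_order //.
  rewrite a4; case: (m %% 4)%N (ltn_pmod m (isT : 0 < 4)%N) => [|[|[|[|]]]] // _; rewrite ?a2 ?eqxx //.
    by left.
  by right; apply: (mulIg a); rewrite mulVg -expgSr -a4 expg_order.
have := Cnat_cfdot_char (cfRes_char <[a]> (irr_char j)) (irr_char k).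
rewrite dot => /natrP[m e]; exists m; rewrite natrM -e mulrC divfK //.
by rewrite pnatr_eq0.
Qed.
End Involution.
End OddCharacters.

(** * Degrees, kernels and the index of the derived group *)

Module GCstarIndex.
Import NcRing ClassEquation FpfRings GaloisConjugates Transfer FpfSylow FpfOdd OddCharacters.
Import GroupScope Order.TTheory GRing.Theory Num.Theory.
Local Open Scope ring_scope.

Lemma irr1_le_index (gT : finGroupType) (G A : {group gT}) (i : Iirr G) :
  A \subset G -> abelian A -> 'chi_i 1%g <= #|G : A|%:R.
Proof.
move=> sAG abA; have [k Ck] := constt_cfRes_irr A i.
have lk : 'chi_k \is a linear_char by apply/char_abelianP.
have := Ck; rewrite -constt_Ind_Res => /(char1_ge_constt (cfInd_char G (irr_char k))).
by rewrite cfInd1 // (lin_char1 lk) mulr1.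
Qed.

Lemma nonlinear_degree2 (gT : finGroupType) (G A : {group gT}) (i : Iirr G) :
  A \subset G -> abelian A -> #|G : A| = 2%N -> 'chi_i 1%g != 1 -> 'chi_i 1%g = 2%:R.
Proof.
move=> sAG abA i2 ni; have := irr1_le_index i sAG abA; rewrite i2.
have /natrP[m Dm] := Cnat_irr1 i; rewrite Dm ler_nat => m2.
have := irr1_gt0 i; rewrite Dm ltr0n => m0; rewrite Dm pnatr_eq1 in ni.
by case: m ni m2 m0 {Dm} => [|[|[|]]].
Qed.

(** With an abelian subgroup of index 2 all nonlinear characters have degree 2, so they are Galois
    conjugate and share one kernel, which contains W because one of them is inflated from [G / W].
    The linear ones contain W in their kernels since W is in G'. *)
Lemma GCstar_index2 (gT : finGroupType) (G A W : {group gT}) : GCstar G ->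
    A \subset G -> abelian A -> #|G : A| = 2%N ->
  W <| G -> W \subset G^`(1)%g -> ~~ abelian (G / W)%g -> W :=: 1%g.
Proof.
move=> GC sAG abA i2 nW sWD nab; apply/trivgP; rewrite -(TI_cfker_irr G); apply/bigcapsP=> i _.
have [/eqP i1|ni] := boolP ('chi_i 1%g == 1).
  apply: subset_trans sWD _; rewrite -cap_cfker_lin_irr; apply: bigcap_inf.
  by rewrite lin_irrE i1.
have [k nk] : exists k : Iirr (G / W)%g, 'chi_k 1%g != 1.
  apply/existsP; apply: contraNT nab; rewrite negb_exists => /forallP h.
  by apply/char_abelianP=> k; rewrite lin_irrE; have := h k; rewrite negbK.
have k1 : 'chi_(mod_Iirr k) 1%g = 'chi_k 1%g by rewrite mod_IirrE // cfMod1.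
have nk' : 'chi[G]_(mod_Iirr k) 1%g != 1 by rewrite k1.
have [|u ->] := GC _ _ nk' ni; first by rewrite (nonlinear_degree2 sAG abA i2 nk') (nonlinear_degree2 sAG abA i2 ni).
by rewrite cfker_aut mod_IirrE // cfker_mod.
Qed.

(** From order 16 on, the derived group properly contains the centre, so the quotient by the centre
    is nonabelian, contrary to [GCstar_index2]. *)
Lemma GCstar_quaternion_card (gT : finGroupType) (S : {group gT}) :
  extremal_class S = Quaternion -> GCstar S -> #|S| = 8%N.
Proof.
move=> ex GC; have [n [x [y [[n2 oS Sx ox X'y] [nX inv o4 der Z]]]]] := quaternion_facts ex.
have [n3|n4] := leqP n 3; first by rewrite oS (_ : n = 3)%N //; apply/eqP; rewrite eqn_leq n3.
have sX : <[x]>%g \subset S by rewrite cycle_subG.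
have i2 : #|S : <[x]>%g| = 2%N.
  rewrite -divgS //= oS -orderE ox -{1}(prednK (ltnW (ltnW n2))) expnS mulnK //.
  by rewrite expn_gt0.
have oxk k : (k < n)%N -> #[(x ^+ (2 ^ k))%g] = (2 ^ (n.-1 - k))%N.
  by move=> kn; apply: (orderXexp _ ox).
have sZD : 'Z(S)%g \subset S^`(1)%g.
  rewrite Z der cycle_subG.
  rewrite (_ : n.-2 = n.-2.-1.+1) ?expnS ?expgM ?mem_cycle //.
  by case: (n) n2 => [|[|[|]]].
have ntZ : 'Z(S)%g <> 1%g.
  move/(congr1 (fun B : {set gT} => #|B|)); rewrite Z -orderE oxk ?cards1 //.
    by case: (n) n2 => [|[|[|k]]] //= _; rewrite subSnn.
  by case: (n) n2 => [|[|]].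
have := GCstar_index2 GC sX (cycle_abelian x) i2 (center_normal S) sZD.
case: (boolP (abelian (S / 'Z(S))%g)) => [ab|_ /(_ isT)/ntZ//].
have := subset_leq_card (der1_min (normal_norm (center_normal S)) ab).
rewrite /= Z der -!orderE -[(x ^+ 2)%g]/(x ^+ (2 ^ 1))%g !oxk ?leq_exp2l //.
  by case: (n) n4 => [|[|[|[|k]]]] //= _; lia.
  by case: (n) n2 => [|[|]].
exact: ltnW n2.
Qed.

Lemma char1_dvd (gT : finGroupType) (G : {group gT}) (phi : 'CF(G)) (p m : nat) :
    phi \is a character -> phi 1%g = m%:R ->
    {in irr_constt phi, forall i, p %| Num.truncn ('chi_i 1%g)}%N ->
  (p %| m)%N.
Proof.
move=> Nphi phi1 dp.
have : m%:R = (\sum_(i in irr_constt phi) Num.truncn '[phi, 'chi_i] * Num.truncn ('chi_i 1%g))%N%:R :> algC.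
  rewrite -phi1 {1}[phi]cfun_sum_constt sum_cfunE natr_sum; apply: eq_bigr => i _.
  by rewrite cfunE natrM !truncnK ?Cnat_irr1 // Cnat_cfdot_char_irr.
move/eqP; rewrite eqr_nat => /eqP->; apply: dvdn_sum => i Ci.
by rewrite dvdn_mull ?dp.
Qed.

(** Induce from [P <*> <[z]>] a linear character nontrivial at z. Since z is in L', no constituent
    is linear, so p divides all their degrees and hence the index of [P <*> <[z]>], which is prime
    to p. *)
Lemma GCstar_odd_index (gT : finGroupType) (L P : {group gT}) z (p : nat) : GCstar L ->
    #[z] = 2%N -> z \in 'Z(L) -> z \in L^`(1)%g -> prime p -> odd p ->
  p.-Sylow(L) P -> abelian P -> ~~ (p %| #|L : L^`(1)|%g)%N.
Proof.
move=> GC oz Zz Dz pr_p op sylP abP; apply/negP=> dp.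
have [Lz cz] := setIP Zz; have [sPL pP p'i] := and3P sylP.
pose T := (P <*> <[z]>)%G.
have cPz : <[z]>%g \subset 'C(P).
  by rewrite cycle_subG; apply: subsetP cz; apply: centS.
have abT : abelian T.
  by rewrite /= cent_joinEr // abelianM abP cycle_abelian /=.
have sTL : T \subset L by rewrite /= join_subG sPL cycle_subG.
have Tz : z \in T by rewrite /= mem_gen // inE cycle_id orbT.
have [k nk] : exists k : Iirr T, z \notin cfker 'chi_k.
  apply/existsP; apply: contraT; rewrite negb_exists => /forallP h.
  have : z \in \bigcap_i cfker 'chi[T]_i by apply/bigcapP=> i _; have := h i; rewrite negbK.
  by rewrite TI_cfker_irr inE -order_eq1 oz.
have lk : 'chi_k \is a linear_char by apply/char_abelianP.
have : (p %| #|L : T|)%N.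
  have e1 : ('Ind[L] 'chi_k) 1%g = #|L : T|%:R by rewrite cfInd1 // (lin_char1 lk) mulr1.
  apply: (char1_dvd (cfInd_char L (irr_char k)) e1) => i; rewrite irr_consttE => ni.
  apply: (GCstar_dvd_irr1 GC pr_p dp); apply: contra ni => i1.
  have li : 'chi_i \is a linear_char by rewrite lin_irrE.
  rewrite -Frobenius_reciprocity; have /irrP[j Dj] := lin_char_irr (cfRes_lin_char T li).
  rewrite Dj cfdot_irr; have [kj|_] := eqVneq k j; last by rewrite eqxx.
  case/negP: nk.
  rewrite kj -Dj cfkerEchar ?cfRes_char ?irr_char // inE Tz !cfResE //= (lin_char1 li).
  have : z \in cfker 'chi_i by apply: subsetP Dz; rewrite -cap_cfker_lin_irr; apply: bigcap_inf.
  by rewrite cfkerEirr inE (lin_char1 li).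
apply/negP; rewrite -p'natE //; apply: pnat_dvd p'i; apply: indexgS.
exact: joing_subl.
Qed.
End GCstarIndex.

(** * Nonperfect groups with quaternion Sylow subgroups *)

Module NonPerfect.
Import NcRing ClassEquation FpfRings GaloisConjugates Transfer FpfSylow FpfOdd OddCharacters GCstarIndex.
Import GroupScope Order.TTheory GRing.Theory Num.Theory.

(** The nonlinear degrees are even, so the sum of squares makes the order of L and the index of L'
    congruent modulo 4. *)
Lemma GCstar_index_mod4 (gT : finGroupType) (L : {group gT}) : GCstar L ->
  2 %| #|L : L^`(1)| -> 4 %| #|L| -> 4 %| #|L : L^`(1)|.
Proof.
move=> GC d2 d4; pose f (i : Iirr L) := (Num.truncn ('chi_i 1%g) %/ 2)%N.
suff e : #|L| = (#|L : L^`(1)| + 4 * \sum_(i : Iirr L | ('chi_i 1%g != 1)%R) f i ^ 2)%N.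
  by move: d4; rewrite e dvdn_addl // dvdn_mulr.
apply/eqP; rewrite -(Num.Theory.eqr_nat algC) GRing.natrD -irr_sum_square.
rewrite (bigID [pred i : Iirr L | 'chi_i 1%g == 1]%R) /=; apply/eqP; congr (_ + _)%R.
  rewrite -card_lin_irr -sum1_card GRing.natr_sum; apply: eq_big => i; first by rewrite inE lin_irrE.
  by move=> /eqP->; rewrite GRing.expr1n.
rewrite GRing.natrM GRing.natr_sum GRing.mulr_sumr; apply: eq_bigr => i ni.
have := GCstar_dvd_irr1 GC (isT : prime 2) d2 ni => d.
rewrite -GRing.natrM (_ : 4 * f i ^ 2 = (Num.truncn ('chi_i 1%g)) ^ 2)%N.
  by rewrite GRing.natrX truncnK ?Cnat_irr1.
by rewrite -[4]/(2 ^ 2)%N -expnMn /f mulnC divnK.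
Qed.

Section FPF.
Variables (gT : finGroupType) (L : {group gT}) (R : unitRingType).
Variable rho : gT -> R.
Hypothesis rep : fpf_rep L rho.
Hypothesis uL : {in \pi(L), forall p, (p%:R)%R \is a @GRing.unit R}.
Hypothesis GC : GCstar L.
Variable z : gT.
Hypotheses (Lz : z \in L) (oz : #[z] = 2).
Variable S : {group gT}.
Hypotheses (sylS : 2.-Sylow(L) S) (exS : extremal_class S = Quaternion).

Let cz := z_central rep Lz oz.
Let Zz : z \in 'Z(L). Proof. by rewrite inE Lz -sub_cent1. Qed.
Let sSL := pHall_sub sylS.

Lemma center_quaternion_Sylow : 'Z(S) = <[z]> /\ z \in S^`(1).
Proof.
have [n [x [y [[n2 oS Sx ox X'y] [nX inv o4 der Z]]]]] := quaternion_facts exS.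
have n2E : n.-2 = n.-2.-1.+1 by case: (n) n2 => [|[|[|]]].
set w := x ^+ (2 ^ n.-2) in Z.
have ow : #[w] = 2.
  rewrite /w (orderXexp _ ox) (_ : n.-1 - n.-2 = 1)%N //.
  by case: (n) n2 => [|[|[|k]]] //= _; rewrite subSnn.
have Lw : w \in L by rewrite groupX // (subsetP sSL).
have wz : <[w]> = <[z]>.
  apply/eqP; rewrite eqEcard -!orderE ow oz leqnn andbT cycle_subG.
  by apply: (sq1 rep Lz oz) => //; rewrite -ow expg_order.
split; first by rewrite Z.
rewrite der -cycle_subG -wz cycle_subG /w n2E expnS expgM mem_cycle //.
Qed.

Lemma quaternion_index4 : (4 * #|S^`(1)|)%N = #|S|.
Proof.
have [n [x [y [[n2 oS Sx ox X'y] [nX inv o4 der Z]]]]] := quaternion_facts exS.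
rewrite der -orderE -[x ^+ 2]/(x ^+ (2 ^ 1)) (orderXexp _ ox) oS -[4]/(2 ^ 2)%N -expnD.
by congr (2 ^ _)%N; case: (n) n2 => [|[|[|k]]] //= _; rewrite subn1.
Qed.

Let S8 : 8 %| #|S|.
Proof.
have [n [x [y [[n2 oS Sx ox X'y] _]]]] := quaternion_facts exS.
by rewrite oS (@dvdn_exp2l 2 3).
Qed.

Let odd_cyclic (p : nat) (P : {group gT}) : p.-group P -> P \subset L -> odd p -> abelian P.
Proof. by move=> pP sPL op; apply/cyclic_abelian/(fpf_odd_cyclic rep uL pP sPL op). Qed.

Lemma index_der1_2nat : 2.-nat #|L : L^`(1)|.
Proof.
have [_ Dz] := center_quaternion_Sylow.
apply/pnatP=> [|p pr_p dp]; first exact: indexg_gt0.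
have [-> //|op] := even_prime pr_p.
have [P sylP] := Sylow_exists p L; have [sPL pP _] := and3P sylP.
have Dz' : z \in L^`(1) by apply: subsetP Dz; apply: dergS.
by have := GCstar_odd_index GC oz Zz Dz' pr_p op sylP (odd_cyclic pP sPL op); rewrite dp.
Qed.

(** S' has index 4 in S and lies in the intersection of S and L', whose index in S is that of L' in
    L, a multiple of 4. *)
Lemma der1_Sylow : L^`(1) != L -> 2.-Sylow(L^`(1)) S^`(1) /\ #|L : L^`(1)| = 4.
Proof.
move=> np; have n2 := index_der1_2nat.
have d2 : 2 %| #|L : L^`(1)|.
  have [k ek] := p_natP n2; rewrite ek; case: k ek => [/eqP|k _]; last by rewrite expnS dvdn_mulr.
  by rewrite indexg_eq1 => sLD; case/eqP: np; apply/eqP; rewrite eqEsubset der_sub.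
have d4 : 4 %| #|L : L^`(1)|.
  apply: (GCstar_index_mod4 GC d2); apply: dvdn_trans (cardSg sSL).
  exact: dvdn_trans S8.
have sylD := Sylow_setI_normal (der_normal 1 L) sylS.
have sSD : S^`(1) \subset L^`(1) :&: S by rewrite subsetI dergS ?der_sub.
have eS : #|S| = (#|L^`(1) :&: S| * #|L : L^`(1)|)%N.
  rewrite (card_Hall sylS) (card_Hall sylD) -(Lagrange (der_sub 1 L)) partnM ?cardG_gt0 //.
  by rewrite (part_pnat_id n2).
case/dvdnP: d4 => k ek; rewrite ek -quaternion_index4 mulnA [RHS]mulnC in eS.
move/eqP: eS; rewrite eqn_pmul2l // => /eqP eS.
have leD := subset_leq_card sSD; rewrite eS in leD.
have k1 : k = 1%N.
  have D0 := cardG_gt0 (L^`(1) :&: S); have S0 := cardG_gt0 S^`(1).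
  by move: eS leD D0 S0; rewrite /=; clear; move: #|_| #|_| => u v; nia.
have eD : S^`(1) = L^`(1) :&: S.
  by apply/eqP; rewrite eqEcard sSD eS k1 /= muln1 leqnn.
by rewrite ek k1 eD.
Qed.

(** L' has the cyclic Sylow 2-subgroup S', hence a normal 2-complement N, and L / N is isomorphic to
    S, which is Q_8. If N is nontrivial, factor out O_p'(N) for its smallest prime p: what remains
    of N is a cyclic p-group P with an abelian centraliser of index 2, and [GCstar_index2] gives P =
    1. *)
Lemma GCstar_nonperfect : L^`(1) != L -> #|L| = 8.
Proof.
case/der1_Sylow=> sylD i4; have [_ Dz] := center_quaternion_Sylow.
have cyD : cyclic S^`(1).
  by have [n [x [y [_ [_ _ _ -> _]]]]] := quaternion_facts exS; apply: cycle_cyclic.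
pose N := 'O_2^'(L^`(1))%G.
have hallN : 2^'.-Hall(L^`(1)) N.
  apply: (pcore_der1_Hall sylD); apply: (Sylow_der1_TI sylD (cyclic_abelian cyD)).
  by apply: (cyclic_Sylow_norm_cent sylD cyD) => r /prime_gt1.
have nN : N <| L by apply: gFnormal_trans; apply: der_normal.
have [sNL nNL] := andP nN.
have sND : N \subset L^`(1) := pHall_sub hallN.
have iDN : #|L^`(1)| = (#|N| * #|S^`(1)|)%N.
  by rewrite (card_Hall hallN) (card_Hall sylD) mulnC partnC ?cardG_gt0.
have oL : #|L| = (#|N| * #|S|)%N.
  by rewrite -(Lagrange (der_sub 1 L)) i4 iDN -mulnA -quaternion_index4 [(4 * _)%N]mulnC.
have oddN : odd #|N| by have := pHall_pgroup hallN; rewrite /pgroup p'natE // dvdn2 negbK.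
have coNS : coprime #|N| #|S|.
  by rewrite coprime_sym; apply: pnat_coprime (pHall_pgroup sylS) (pHall_pgroup hallN).
have nNS : S \subset 'N(N) := subset_trans sSL nNL.
have isoS : S \isog L / N.
  have -> : L / N = S / N.
    apply/esym/eqP; rewrite eqEcard quotientS //= card_quotient // -divgS // oL mulKn ?cardG_gt0 //.
    by rewrite card_quotient // -indexgI setIC coprime_TIg // indexg1.
  by apply: quotient_isog => //; rewrite coprime_TIg.
have GCN := GCstar_quotient nN GC.
have S8' : #|S| = 8 by apply: GCstar_quaternion_card exS (GCstar_isog _ GCN); rewrite isog_sym.
have [N1|ntN] := eqVneq (N : {set gT}) 1; first by rewrite oL N1 cards1 S8'.
pose p := pdiv #|N|; have pr_p : prime p by rewrite pdiv_prime ?cardG_gt1.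
have op : odd p by apply: dvdn_odd (pdiv_dvd _) oddN.
have [P0 sylP0] := Sylow_exists p N; have [sP0N pP0 _] := and3P sylP0.
have sP0L := subset_trans sP0N sNL.
have cyP0 := fpf_odd_cyclic rep uL pP0 sP0L op.
pose M := 'O_p^'(N)%G.
have hallM : p^'.-Hall(N) M.
  apply: (pcore_der1_Hall sylP0); apply: (Sylow_der1_TI sylP0 (cyclic_abelian cyP0)).
  by apply: (cyclic_Sylow_norm_cent sylP0 cyP0) => r pr_r; apply: pdiv_min_dvd (prime_gt1 pr_r).
have nM : M <| L by apply: gFnormal_trans.
have [sML nML] := andP nM; have sMN : M \subset N := pHall_sub hallM.
have nMN : N \subset 'N(M) := subset_trans sNL nML.
pose X := (L / M)%G; pose P := (N / M)%G.
have nP : P <| X := quotient_normal M nN.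
have tiM : P0 :&: M = 1 by rewrite coprime_TIg // (pnat_coprime pP0 (pHall_pgroup hallM)).
have c2 : #|P0 / M| = #|P0|.
  by rewrite card_quotient ?(subset_trans sP0N) // -indexgI tiM indexg1.
have c1 : #|P| = #|P0|.
  rewrite card_quotient // -divgS // (card_Hall hallM) (card_Hall sylP0).
  by rewrite -{1}(partnC p (cardG_gt0 N)) mulnK ?part_gt0.
have eP : P :=: P0 / M.
  by apply/esym/eqP; rewrite eqEcard quotientS //= c1 c2.
have cyP : cyclic P by rewrite eP quotient_cyclic.
have pP : p.-group P by rewrite eP quotient_pgroup.
have ntP : P :!=: 1.
  rewrite -subG1 quotient_sub1 //; apply: contraL (pdiv_dvd #|N|) => sNM.
  rewrite -p'natE //; apply: pnat_dvd (cardSg sNM) (pHall_pgroup hallM).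
have oX : #|X| = (#|P| * 8)%N.
  rewrite !card_quotient // -(Lagrange_index sNL sMN) mulnC; congr (_ * _)%N.
  by rewrite -divgS // oL mulKn.
have sPD : P \subset X^`(1) by rewrite /= -quotient_der // quotientS.
have nabXP : ~~ abelian (X / P).
  apply/negP=> /(der1_min (normal_norm nP)); rewrite /= -quotient_der // quotientSGK //; last first.
    exact: subset_trans (der_sub 1 L) nML.
  move/subsetP/(_ z); have -> : z \in L^`(1) by apply: subsetP Dz; apply: dergS.
  by move=> /(_ isT)/order_dvdG; rewrite oz dvdn2 oddN.
have [a Da] := cyclicP cyP; have Pa : a \in P by rewrite /= in Da *; rewrite Da cycle_id.
have abP := cyclic_abelian cyP.
have nta : a != 1 by apply: contra ntP => /eqP a1; rewrite /= in Da *; rewrite Da a1 cycle1.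
have defL : N * S = L.
  by apply/eqP; rewrite eqEcard mul_subG // TI_cardMg ?coprime_TIg // -oL leqnn.
have S4 t : t \in S -> t ^+ 2 \in <[z]>.
  move=> St; apply: (sq1 rep Lz oz); first by rewrite groupX ?(subsetP sSL).
  have [n [x [y [[n2 oS Sx ox X'y] [_ _ o4 _ _]]]]] := quaternion_facts exS.
  rewrite -expgM; apply/eqP; rewrite -order_dvdn.
  have n3 : n = 3 by apply/eqP; rewrite -(eqn_exp2l _ _ (isT : 1 < 2)) -oS S8'.
  have [xt|nxt] := boolP (t \in <[x]>); last by rewrite o4 // inE nxt.
  by apply: dvdn_trans (order_dvdG xt) _; rewrite -orderE ox n3.
(* The square of t is 1 or z, which is central, so t acts on P with square 1. If it does not invert
   a, it fixes [a * a ^ s], which is nontrivial; coprime action on the cyclic p-group P then makes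
   it fix P. *)
have inv1 t : t \in S -> a ^ coset M t \in [set a; a^-1].
  move=> St; set s := coset M t; have Lt := subsetP sSL t St.
  have nMt : t \in 'N(M) := subsetP nML t Lt.
  have Xs : s \in X by apply: mem_quotient.
  have nPs : s \in 'N(P) := subsetP (normal_norm nP) s Xs.
  have ass : (a ^ s) ^ s = a.
    rewrite -conjgM -expg2 -morphX //; apply/conjg_fixP/commgP.
    case/morphimP: (Pa) => g nMg Ng ->; rewrite /commute /= -!morphM ?groupX //; congr (coset M _).
    have zg : <[z]> \subset 'C[g] by rewrite cycle_subG cent1C (subsetP cz) ?(subsetP sNL).
    by rewrite (cent1P (subsetP zg _ (S4 t St))).
  have Pas : a ^ s \in P by rewrite memJ_norm.
  have fixc : a * a ^ s \in 'C[s].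
    by apply/cent1P/commgP/conjg_fixP; rewrite conjMg ass; apply: (centsP abP).
  have [c1'|nc] := eqVneq (a * a ^ s) 1.
    by rewrite (_ : a ^ s = a^-1) ?set22 //; apply: (mulgI a); rewrite c1' mulgV.
  rewrite !inE; apply/orP; left; apply/eqP/conjg_fixP/commgP.
  have nPA : <[s]> \subset 'N(P) by rewrite cycle_subG.
  have cop : coprime #|P| #|<[s]>|.
    apply: (pnat_coprime pP); have : 2.-elt s by apply: morph_p_elt => //; apply: mem_p_elt (pHall_pgroup sylS) St.
    by apply: sub_in_pnat => r _; rewrite !inE => /eqP->; apply: contraTneq op => <-.
  have ti := coprime_abel_cent_TI nPA cop abP.
  have [R1|ntR] := eqVneq [~: P, <[s]>] 1.
    by move/commG1P: R1; rewrite cent_cycle => /subsetP/(_ a Pa)/cent1P.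
  have sRP : [~: P, <[s]>] \subset P by rewrite commg_subl.
  have [_ dR _] := pgroup_pdiv (pgroupS sRP pP) ntR.
  have [u Ru ou] := Cauchy pr_p dR; have Pu := subsetP sRP u Ru.
  pose H := 'C_P[s]%G; have ntH : H :!=: 1.
    by apply/trivgPn; exists (a * a ^ s); rewrite // in_setI groupM.
  have [_ dH _] := pgroup_pdiv (pgroupS (subsetIl _ _) pP) ntH.
  have [v Hv ov] := Cauchy pr_p dH.
  have Pv : v \in P by case/setIP: Hv.
  have uv : <[u]> = <[v]>.
    by apply/eqP; rewrite (eq_subG_cyclic cyP) ?cycle_subG // -!orderE ou ov.
  have : u \in 'C_[~: P, <[s]>](<[s]>).
    rewrite inE Ru cent_cycle /= -cycle_subG uv cycle_subG.
    by case/setIP: Hv.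
  by rewrite ti inE -order_eq1 ou => /eqP p1; rewrite p1 in pr_p.
have inv2 s : s \in X -> a ^ s \in [set a; a^-1].
  case/morphimP=> l nMl Ll ->; move: Ll; rewrite -defL => /mulsgP[g t Ng St ->] /=.
  rewrite morphM ?(subsetP nMN g Ng) ?(subsetP (subset_trans sSL nML) t St) //= conjgM.
  have Pg : coset M g \in P by apply: mem_quotient.
  rewrite (_ : a ^ coset M g = a) ?inv1 //; apply/conjg_fixP/commgP; exact: (centsP abP).
pose C := 'C_X[a]%G.
have i12 : #|X : C| <= 2.
  rewrite index_cent1; apply: leq_trans (_ : #|[set a; a^-1]| <= 2); last by rewrite cards2; case: eqP.
  by apply: subset_leq_card; apply/subsetP=> _ /imsetP[s Xs ->]; apply: inv2.
have sPX := normal_sub nP.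
have coP : coprime #|P| #|X : P|.
  rewrite -divgS // oX mulKn //; apply: (pnat_coprime pP).
  rewrite p'natE //; apply/negP; rewrite (Euclid_dvdX 2 3 pr_p) // => /andP[d _].
  by move: d op; rewrite dvdn_prime2 // => /eqP->.
(* Otherwise P would be central in X and contained in X', against transfer to the abelian Hall
   subgroup P. *)
have nC1 : #|X : C| != 1%N.
  apply/negP; rewrite indexg_eq1 subsetI subxx /= sub_cent1 => ca.
  case/eqP: nta; apply: (transfer_central sPX abP coP Pa); last exact: (subsetP sPD).
  by rewrite inE (subsetP sPX).
have i2 : #|X : C| = 2.
  by apply/eqP; rewrite eqn_leq i12 ltn_neqAle eq_sym nC1 indexg_gt0.
have oC : #|C| = (#|P| * 4)%N.
  by have := Lagrange (subsetIl X 'C[a]); rewrite i2 oX => /eqP; rewrite -[8]/(4 * 2)%N mulnA eqn_pmul2r // => /eqP.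
have sPC : P \subset C by rewrite subsetI sPX sub_cent1; apply: (subsetP abP).
have cCP : C \subset 'C(P) by rewrite /= in Da *; rewrite Da cent_cycle subsetIr.
have [B sylB] := Sylow_exists 2 C; have [sBC pB _] := and3P sylB.
have p2 : p != 2 by apply: contraTneq op => ->.
have p2P : 2^'.-group P.
  by move: pP; rewrite /pgroup; apply: sub_in_pnat => r _; rewrite !inE => /eqP->.
have oB : #|B| = (2 ^ 2)%N.
  by rewrite (card_Hall sylB) oC partnM ?cardG_gt0 // (part_p'nat p2P) mul1n (@part_pnat_id 2 (2 ^ 2)) // pnatX.
have abC : abelian C.
  have -> : C :=: P * B.
    apply/esym/eqP; rewrite eqEcard mul_subG //= TI_cardMg ?oB ?oC //.
    by rewrite coprime_TIg // coprime_sym (pnat_coprime pB p2P).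
  by rewrite abelianM abP (card_p2group_abelian _ oB) //= (subset_trans sBC).
case/eqP: ntP.
exact: (GCstar_index2 (GCstar_quotient nM GC) (subsetIl X 'C[a]) abC i2 nP sPD nabXP).
Qed.
End FPF.
End NonPerfect.

(** * The prime 3 divides the order in the perfect case *)

Module ThreeDivides.
Import NcRing ClassEquation FpfRings OrderThreePairs QuaternionCoordinates GoldenValues Frames Points GaloisConjugates Transfer FpfSylow FpfOdd OddCharacters GCstarIndex NonPerfect.
Import GroupScope.

(** On the cosets of X the square of t acts trivially, being central and in X. Without a fixed
    coset, t would be an odd number of transpositions. *)
Lemma perfect_conj_in (gT : finGroupType) (G X : {group gT}) t : G^`(1) = G -> X \subset G ->
    t \in G -> t ^+ 2 \in X -> t ^+ 2 \in 'Z(G) -> odd (#|G : X|./2) ->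
  exists2 g, g \in G & t ^ g \in X.
Proof.
move=> pG sXG Gt Xt2 /setIP[_ /centP ct2] oi.
apply/exists_inP; apply: contraT; rewrite negb_exists_in => /forall_inP nf.
have aR : [acts G, on rcosets X G | 'Rs] := actsRs_rcosets X G.
pose s := restr_perm (rcosets X G) (actperm 'Rs t).
have nS : actperm 'Rs t \in 'N(rcosets X G | 'P).
  by apply/astabsP=> d; rewrite /= apermE actpermE; apply: (acts_act aR).
have sE d : d \in rcosets X G -> s d = d :* t.
  by move=> Dd; rewrite /s restr_permE // actpermE /= rcosetE.
have sout d : d \notin rcosets X G -> s d = d by move=> nd; apply: (out_perm (restr_perm_on _ _)).
have sin d : d \in rcosets X G -> d :* t \in rcosets X G.
  by move=> Dd; rewrite -rcosetE (acts_act aR).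
have ss : s * s = 1.
  apply/permP=> d; rewrite perm1 permM; have [Dd|nd] := boolP (d \in rcosets X G); last by rewrite !sout.
  rewrite !sE ?sin //; case/rcosetsP: Dd => g Gg ->; rewrite -!rcosetM -expg2 -ct2 //.
  by rewrite rcosetM rcoset_id.
have mov : [set d | s d != d] = rcosets X G.
  apply/setP=> d; rewrite inE; have [Dd|nd] := boolP (d \in rcosets X G); last by rewrite sout ?eqxx.
  rewrite sE //; case/rcosetsP: Dd => g Gg ->; apply: contraTN (nf g^-1 (groupVr Gg)) => /eqP e.
  rewrite negbK conjgE invgK mulgA -mem_rcoset -e -rcosetM; exact: rcoset_refl.
have := perfect_even_action pG aR Gt; rewrite -/s odd_perm_involution // mov.
by rewrite -/(#|G : X|) oi.
Qed.

(** Conjugation by A sends a to a b, a b to b and b to a, so A^3 fixes b. If 3 did not divide the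
    order, A would be a power of A^3 and fix b too. *)
Lemma dvd3_cycle (gT : finGroupType) (a b A : gT) : a ^+ 2 = 1 -> commute a b ->
  b ^ A = a -> a ^ A = a * b -> a != b -> 3 %| #[A].
Proof.
move=> a2 cab bA aA nab; apply: contraR nab => n3.
have fix3 : b ^ (A ^+ 3) = b.
  by rewrite expgS expg2 !conjgM bA aA conjMg bA aA -mulgA -cab mulgA -expg2 a2 mul1g.
have : A \in <[A ^+ 3]>.
  rewrite (_ : <[A ^+ 3]> = <[A]>) ?cycle_id //; apply/esym/eqP.
  by rewrite -[_ == _]/(generator _ _) generator_coprime coprime_sym prime_coprime.
case/cycleP=> m em; apply/eqP; rewrite -bA em.
by elim: m {em} => [|m IH]; rewrite ?conjg1 // expgS conjgM fix3.
Qed.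

Section Perfect.
Variables (gT : finGroupType) (L : {group gT}) (R : unitRingType).
Variable rho : gT -> R.
Hypothesis rep : fpf_rep L rho.
Variable z : gT.
Hypotheses (Lz : z \in L) (oz : #[z] = 2).
Hypothesis perfL : L^`(1) = L.
Variable S : {group gT}.
Hypotheses (sylS : 2.-Sylow(L) S) (exS : extremal_class S = Quaternion).

Let cz := z_central rep Lz oz.
Let Zz : z \in 'Z(L). Proof. by rewrite inE Lz -sub_cent1. Qed.
Let sSL := pHall_sub sylS.
Let nz : L \subset 'N(<[z]>).
Proof. by apply: subset_trans (cent_sub _); rewrite cent_cycle. Qed.
Let sq_z t : t \in L -> #[t] = 4 -> t ^+ 2 = z.
Proof.
move=> Lt ot; have : t ^+ 2 \in <[z]>.
  by apply: (sq1 rep Lz oz); rewrite ?groupX // -expgM; apply/eqP; rewrite -order_dvdn ot.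
case/cycleP=> n; rewrite -(expg_mod n (_ : z ^+ 2 = 1)) -?oz ?expg_order //.
rewrite oz; case: (n %% 2) (ltn_pmod n (isT : 0 < 2)) => [|[|]] // _ e.
by have : #[t] %| 2; [rewrite order_dvdn e | rewrite ot].
Qed.

(** The index of X in L is twice an odd number, so [perfect_conj_in] makes y conjugate to i. Modulo
    [<[z]>] these become two involutions of a four-group, and the fusion is turned into an element
    permuting its three involutions cyclically. *)
Lemma perfect_dvd3 : 3 %| #|L|.
Proof.
have [n [x [y [[n2 oS Sx ox X'y] [nX inv o4 _ _]]]]] := quaternion_facts exS.
pose q := coset <[z]>; pose X := <[x]>%G.
have nq t : t \in L -> t \in 'N(<[z]>) := fun Lt => subsetP nz t Lt.
have qL A : A \in L -> 3 %| #[q A] -> 3 %| #|L|.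
  by move=> LA d; apply: dvdn_trans d (dvdn_trans (morph_order _ (nq A LA)) (order_dvdG LA)).
pose i := x ^+ (2 ^ (n - 3)).
have oi : #[i] = 4.
  rewrite /i (orderXexp _ ox) (_ : n.-1 - (n - 3) = 2)%N //.
  by case: (n) n2 => [|[|[|k]]] //= _; rewrite !subSS subn0 subSn // subSnn.
have Xi : i \in X by apply: mem_cycle.
have sXS : X \subset S := normal_sub nX.
have Lx : x \in L := subsetP sSL x Sx.
have Li : i \in L by rewrite groupX.
have i2 := sq_z Li oi.
have [Sy nXy] := setDP X'y; have Ly := subsetP sSL y Sy.
have oy := o4 y X'y; have y2 := sq_z Ly oy.
have iy : i ^ y = i^-1 by apply: inv.
have iV : i^-1 = i * z by apply: (mulIg i); rewrite mulVg -mulgA -(cent1P (subsetP cz i Li)) mulgA -expg2 i2 -expg2 -oz expg_order.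
have iS : #|L : X|./2 = #|L : S|.
  rewrite -(Lagrange_index sSL sXS) (_ : #|S : X| = 2) ?muln2 ?doubleK //.
  rewrite -divgS // oS -orderE ox -{1}(prednK (ltnW (ltnW n2))) expnS mulnK // expn_gt0 //.
have [g Lg yg] : exists2 g, g \in L & y ^ g = i.
  have [|||||g Lg Xyg] := @perfect_conj_in _ L X y perfL; rewrite ?y2 //.
  - exact: subset_trans sXS sSL.
  - by rewrite -i2 groupX.
  - by rewrite iS; have /and3P[_ _] := sylS; rewrite p'natE // dvdn2 negbK.
  have oyg : #[y ^ g] = 4 by rewrite orderJ.
  have : <[y ^ g]> = <[i]>.
    by apply/eqP; rewrite (eq_subG_cyclic (cycle_cyclic x)) ?cycle_subG // -!orderE oyg oi.
  move=> e; have := cycle_id (y ^ g); rewrite e => /cycleP[k].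
  rewrite -(expg_mod k (_ : i ^+ 4 = 1)) -?oi ?expg_order //.
  rewrite oi; case: (k %% 4) (ltn_pmod k (isT : 0 < 4)) => [|[|[|[|]]]] // _ ek.
  - by rewrite ek order1 in oyg.
  - by exists g.
  - by rewrite ek -[2]/(2 ^ 1)%N (orderXexp _ (oi : _ = 2 ^ 2)%N) in oyg.
  exists (g * y); rewrite ?groupM // conjgM ek (conjXg i) iy expgVn.
  by apply: (mulgI (i ^+ 3)); rewrite mulgV -expgSr -oi expg_order.
have qz : coset <[z]> z = 1 by apply: coset_id; apply: cycle_id.
pose a := q i; pose b := q y.
have a2 : a ^+ 2 = 1 by rewrite -morphX ?nq //= i2.
have b2 : b ^+ 2 = 1 by rewrite -morphX ?nq //= y2.
have nab : a != b.
  apply: contraNneq nXy => e; have : y^-1 * i \in <[z]>.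
    by apply: coset_idr; rewrite ?groupM ?groupV ?nq // morphM ?groupV ?nq // morphV ?nq //= (e : coset _ i = coset _ y) mulVg.
  have Xz : <[z]> \subset X by rewrite cycle_subG -i2 groupX.
  by move/(subsetP Xz); rewrite groupMr ?groupV.
have cab : commute a b.
  apply/commgP/conjg_fixP; rewrite /a /b -morphJ ?nq //= iy iV morphM ?nq //= qz mulg1 //.
have iS1 t : t \in S -> t \in 'N(<[i]>).
  by move=> St; apply: (subsetP (char_norm_trans _ (normal_norm nX))) St; rewrite sub_cyclic_char ?cycle_cyclic // cycle_subG.
have ord4 u v : #[u] = 4 -> v \in <[u]> -> #[v] = 4 -> v = u \/ v = u^-1.
  move=> ou /cycleP[k ->]; rewrite -(expg_mod k (_ : u ^+ 4 = 1)) -?ou ?expg_order //.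
  rewrite ou; case: (k %% 4) (ltn_pmod k (isT : 0 < 4)) => [|[|[|[|]]]] // _ ov.
  - by rewrite order1 in ov.
  - by left.
  - by rewrite -[2]/(2 ^ 1)%N (orderXexp _ (ou : _ = 2 ^ 2)%N) in ov.
  by right; apply: (mulIg u); rewrite mulVg -expgSr -ou expg_order.
have sylSg h : h \in L -> 2.-Sylow(L) (S :^ h)%G by move=> Lh; rewrite pHallJ.
(* If S is Q_8, Sylow's theorem in the normaliser of [<[i]>] corrects the conjugating element so
   that it normalises S; its odd part still sends b to a, because S acts trivially on [S /
   <[z]>]. *)
have [n3|n4] := leqP n 3.
  have n3' : n = 3 by apply/eqP; rewrite eqn_leq n3.
  pose M := 'N_L(<[i]>)%G.
  have sMS : 2.-Sylow(M) S.
    apply: (pHall_subl _ (subsetIl _ _) sylS); rewrite subsetI sSL; exact/subsetP.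
  have nyS : S \subset 'N(<[y]>).
    apply: normal_norm; apply: (index2_normal (gT := gT)); rewrite ?cycle_subG //.
    by rewrite -divgS ?cycle_subG // -orderE oy oS n3'.
  have sMSg : 2.-Sylow(M) (S :^ g)%G.
    apply: (pHall_subl _ (subsetIl _ _) (sylSg g Lg)); rewrite subsetI conj_subG //=.
    by rewrite -yg cycleJ normJ conjSg.
  have [c Mc ec] := Sylow_trans sMSg sMS; have [Lc nic] := setIP Mc.
  pose m := g * c; have Lm : m \in L by rewrite groupM.
  have nSm : m \in 'N_L(S) by rewrite inE Lm inE /= conjsgM; move: ec => /= <-.
  have ym : y ^ m = i \/ y ^ m = i^-1.
    rewrite /m conjgM yg; apply: ord4 => //; last by rewrite orderJ.
    by rewrite memJ_norm ?cycle_id.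
  have qm : b ^ q m = a.
    rewrite /b -morphJ ?nq //=; case: ym => -> //.
    by rewrite iV morphM ?nq //= qz mulg1.
  pose m' := m.`_2^'.
  have Lm' : m' \in L by rewrite groupX.
  have m2S : m.`_2 \in S.
    have nS : S <| 'N_L(S) by rewrite normalSG.
    have sylN : 2.-Sylow('N_L(S)) S by apply: (pHall_subl _ (subsetIl _ _) sylS); rewrite normal_sub.
    by rewrite (mem_normal_Hall sylN nS) ?p_elt_constt ?groupX.
  have abS : {in S &, forall u v, (q u) ^ (q v) = q u}.
    move=> u v Su Sv.
    have abSz : abelian (S / <[z]>).
      apply: (card_p2group_abelian (isT : prime 2)); rewrite card_quotient ?(subset_trans sSL) // -divgS.
        by rewrite oS n3' -orderE oz.
      by rewrite cycle_subG -i2 groupX // (subsetP sXS).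
    by apply/conjg_fixP/commgP; apply: (centsP abSz); apply: mem_quotient.
  have qm' : b ^ q m' = a.
    have em : q m = q m.`_2 * q m' by rewrite -morphM ?nq ?groupX //= consttC.
    by rewrite -qm em conjgM (abS y m.`_2).
  apply: (qL m' Lm'); apply: (@dvd3_cycle _ a b) => //.
  have SVa : a ^ q m' \in S / <[z]>.
    rewrite /a -morphJ ?nq //=; apply: mem_quotient.
    have : m' \in 'N_L(S) by rewrite groupX.
    by case/setIP=> _ nSm'; rewrite memJ_norm // (subsetP sXS).
  have na : a != 1.
    apply/eqP=> /(coset_idr (nq i Li))/order_dvdG; rewrite -orderE oz oi //.
  have nb : b != 1.
    apply/eqP=> /(coset_idr (nq y Ly))/order_dvdG; rewrite -orderE oz oy //.
  have nab1 : 1 != a * b.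
    by apply: contra nab => /eqP e; apply/eqP; apply: (mulgI a); rewrite -e -expg2 a2.
  have nab2 : a * b != a by rewrite -{2}[a]mulg1 (inj_eq (mulgI a)).
  have nab3 : a * b != b by rewrite -{2}[b]mul1g (inj_eq (mulIg b)).
  have SzE : S / <[z]> = [set 1; a; b; a * b].
    apply/esym/eqP; rewrite eqEcard card_quotient ?(subset_trans sSL) // -divgS; last first.
      by rewrite cycle_subG -i2 groupX // (subsetP sXS).
    rewrite oS n3' -orderE oz; apply/andP; split.
      rewrite !subUset !sub1set group1 !groupM ?mem_quotient // (subsetP sXS) //.
    have u : uniq [:: 1; a; b; a * b].
      by rewrite /= !inE !negb_or nab1 nab (eq_sym _ a) na (eq_sym _ b) nb (eq_sym a) nab2 (eq_sym b) nab3.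
    apply: leq_trans (_ : size [:: 1; a; b; a * b] <= _) => //; rewrite -(card_uniqP u).
    by apply: subset_leq_card; apply/subsetP=> t; rewrite !inE -!orbA.
  (* Of the four candidates only a b survives: the image b would make [q m'] swap a and b, although
     its order is odd. *)
  move: SVa; rewrite SzE !inE -!orbA => /or4P[]/eqP e //.
  - by case/eqP: na; apply: (conjg_inj (q m')); rewrite e conj1g.
  - by case/eqP: nab; apply: (conjg_inj (q m')); rewrite e qm'.
  case/eqP: nab; have fix2 : b ^ (q m' ^+ 2) = b by rewrite expg2 conjgM qm' e.
  have : q m' \in <[q m' ^+ 2]>.
    rewrite (_ : <[q m' ^+ 2]> = <[q m']>) ?cycle_id //; apply/esym/eqP.
    rewrite -[_ == _]/(generator _ _) generator_coprime coprime_sym.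
    have : 2^'.-elt (q m') by apply: morph_p_elt; rewrite ?nq ?p_elt_constt.
    by rewrite /p_elt p'natE // prime_coprime.
  case/cycleP=> k ek; rewrite -qm' ek.
  by elim: k {ek} => [|k IH]; rewrite ?conjg1 // expgS conjgM fix2.
(* In larger S the square root w of i fixes a and sends b to b a, while a conjugate w' over y fixes
   b and sends a to a b; the product permutes the three involutions cyclically. *)
pose w := x ^+ (2 ^ (n - 4)).
have w2 : w ^+ 2 = i.
  rewrite /w /i -expgM -expnSr; congr (x ^+ (2 ^ _)).
  by rewrite -subSn // subSS.
have Lw : w \in L by rewrite groupX.
have Xw : w \in X by apply: mem_cycle.
have yi : y ^ i = y^-1.
  have e1 : y * i = i^-1 * y by rewrite [RHS]conjgC conjVg iy invgK.
  rewrite conjgE e1 mulgA -invMg -expg2 i2; apply: (mulIg y).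
  by rewrite mulVg -mulgA -expg2 y2 mulVg.
have iNy : i \in 'N(<[y]>) by rewrite inE -cycleJ yi cycleV.
have conj_inv (u v : gT) : u ^ v = u^-1 -> v ^ u = v * u ^+ 2.
  by move=> e; rewrite conjgE mulgA [u^-1 * v]conjgC conjVg e invgK -mulgA -expg2.
pose Q := (<[i]> <*> <[y]>)%G.
have sQS : Q \subset S by rewrite join_subG !cycle_subG (subsetP sXS) // Sy.
have sylN : 2.-Sylow('N_L(<[y]>)) (S :^ g^-1)%G.
  apply: (pHall_subl _ (subsetIl _ _) (sylSg _ (groupVr Lg))); rewrite subsetI conj_subG ?groupV //=.
  by rewrite -(conjgK g y) yg cycleJ normJ conjSg; apply/subsetP.
have [||c Nc sQ] := Sylow_Jsub sylN (_ : Q \subset _).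
- rewrite join_subG !cycle_subG !in_setI Li Ly iNy /=; exact: (subsetP (normG _)) (cycle_id y).
- exact: pgroupS sQS (pHall_pgroup sylS).
have [Lc nyc] := setIP Nc; pose h := c * g; have Lh : h \in L by rewrite groupM.
have yh : y ^ h = i \/ y ^ h = i^-1.
  have [||e|e] := @ord4 _ y (y ^ c) oy; rewrite ?orderJ ?memJ_norm ?cycle_id //.
    by left; rewrite conjgM e.
  by right; rewrite conjgM e conjVg yg.
have Sih : i ^ h \in S.
  have : i ^ c \in S :^ g^-1.
    by apply: (subsetP sQ); rewrite memJ_conjg mem_gen // inE cycle_id.
  by rewrite mem_conjg invgK -conjgM.
have nXih : i ^ h \notin X.
  apply/negP=> Xih.
  have Xyh : y ^ h \in X by case: yh => ->; rewrite ?groupV.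
  have : (i ^ h) ^ (y ^ h) = i ^ h by apply/conjg_fixP/commgP; apply: (centsP (cycle_abelian x)).
  rewrite -conjJg iy => /conjg_inj e; have : i ^+ 2 = 1 by rewrite expg2 -{1}e mulVg.
  by rewrite i2 => z1; move: oz; rewrite z1 order1.
pose w' := w ^ h^-1; have Lw' : w' \in L by rewrite groupJ ?groupV.
have w'i : w' ^ i = w'^-1.
  have X'ih : i ^ h \in S :\: <[x]> by apply/setDP.
  by rewrite -[X in _ ^ X](conjgK h i) /w' -conjJg (inv w (i ^ h) Xw X'ih) conjVg.
have qw'2 : q w' ^+ 2 = b.
  rewrite -morphX ?nq //= /w' -conjXg w2; case: yh => e; first by rewrite -e conjgK.
  rewrite -[i]invgK -e conjVg conjgK morphV ?nq //=; apply: (mulIg b).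
  by rewrite mulVg -expg2 b2.
have qw2' : coset <[z]> (w' ^+ 2) = b by rewrite -qw'2 -morphX ?nq.
have aw' : a ^ q w' = a * b.
  by rewrite /a -morphJ ?nq //= (conj_inv _ _ w'i) morphM ?nq ?groupX //= qw2'.
have bw' : b ^ q w' = b by rewrite -qw'2; apply/conjg_fixP/commgP/commute_sym/commuteX.
have bw : b ^ q w = b * a.
  rewrite /b -morphJ ?nq //= (conj_inv w y) ?inv // w2 morphM ?nq //.
have aw : a ^ q w = a.
  by rewrite /a -morphJ ?nq //= (_ : i ^ w = i) //; apply/conjg_fixP/commgP; apply: (centsP (cycle_abelian x)).
apply: (qL (w * w')); first by rewrite groupM.
have -> : q (w * w') = q w * q w' by rewrite -morphM ?nq.
apply: (@dvd3_cycle _ a b) => //.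
  by rewrite conjgM bw conjMg bw' aw' mulgA -cab -mulgA -expg2 b2 mulg1.
by rewrite conjgM aw.
Qed.
End Perfect.
End ThreeDivides.

(** * Counting the characters of a group of order 120 *)

Module IcosahedralCount.
Import NcRing ClassEquation FpfRings GaloisConjugates Transfer FpfSylow FpfOdd OddCharacters GCstarIndex.
Import GroupScope Order.TTheory GRing.Theory Num.Theory.

(** Over a class of the quotient with representative r lie at most the classes of r and z r. *)
Lemma card_classes_center2 (gT : finGroupType) (G : {group gT}) z : z \in 'Z(G) -> #[z] = 2 ->
  #|classes G| <= 2 * #|classes (G / <[z]>)|.
Proof.
move=> Zz oz; have [Gz cz] := setIP Zz.
have nz : G \subset 'N(<[z]>).
  by apply: subset_trans (cent_sub _); rewrite cent_cycle sub_cent1.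
pose rp (C : {set coset_of <[z]>}) := odflt 1 [pick x in G | coset <[z]> x \in C].
pose f (p : bool * {set coset_of <[z]>}) := ((if p.1 then z else 1) * rp p.2) ^: G.
have sub : classes G \subset f @: setX [set: bool] (classes (G / <[z]>)).
  apply/subsetP=> _ /imsetP[x Gx ->]; pose C := coset <[z]> x ^: (G / <[z]>).
  have CC : C \in classes (G / <[z]>) by apply: imset_f; apply: mem_quotient.
  have [r [er Gr Cr]] : exists r, [/\ rp C = r, r \in G & coset <[z]> r \in C].
    rewrite /rp; case: pickP => [r /andP[Gr Cr]|/(_ x)]; first by exists r.
    by rewrite Gx class_refl.
  case/imsetP: Cr => _ /morphimP[g nzg Gg ->] e.
  have zr : r * (x ^ g)^-1 \in <[z]>.
    have [nr nxg] : r \in 'N(<[z]>) /\ x ^ g \in 'N(<[z]>) by split; apply: (subsetP nz); rewrite ?groupJ.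
    apply: coset_idr; rewrite ?groupM ?groupV // morphM ?groupV // morphV //= morphJ ?(subsetP nz) //=.
    by rewrite e mulgV.
  have cx : x ^: G = (x ^ g) ^: G by rewrite classGidl.
  case/cycleP: zr => k; rewrite -(expg_mod k (_ : z ^+ 2 = 1)) -?oz ?expg_order // oz.
  have zz : z * z = 1 by rewrite -expg2 -oz expg_order.
  case: (k %% 2) (ltn_pmod k (isT : 0 < 2)) => [|[|]] // _ /(canRL (mulgKV _)) ek.
    apply/imsetP; exists (false, C); rewrite ?inE //= /f /= er mul1g cx; congr (_ ^: _).
    by rewrite ek mul1g.
  apply/imsetP; exists (true, C); rewrite ?inE //= /f /= er cx; congr (_ ^: _).
  by rewrite ek mulgA zz mul1g.
apply: leq_trans (subset_leq_card sub) _; apply: leq_trans (leq_imset_card _ _) _.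
by rewrite cardsX cardsT card_bool.
Qed.

Local Open Scope ring_scope.

Section Count.
Variables (gT : finGroupType) (B M : {group gT}) (z a b : gT).
Hypotheses (GC : GCstar B) (Zz : z \in 'Z(B)) (oz : #[z] = 2%N) (perfB : B^`(1)%g = B).
Hypotheses (oB : #|B| = 120%N) (sMB : M \subset B) (iM : #|B : M| = 5%N) (Mz : z \in M).
Hypotheses (Ba : a \in B) (Bb : b \in B) (a2 : (a ^+ 2 = z)%g) (ab : (a ^ b = a^-1)%g).

Let Bz : z \in B. Proof. by case/setIP: Zz. Qed.
Let cz : B \subset 'C[z]. Proof. by rewrite sub_cent1; case/setIP: Zz. Qed.
Let d (i : Iirr B) := Num.truncn ('chi_i 1%g).
Let ev (i : Iirr B) := z \in cfker 'chi_i.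
Let dE i : 'chi_i 1%g = (d i)%:R. Proof. by rewrite truncnK ?Cnat_irr1. Qed.
Let d0 i : (0 < d i)%N. Proof. by have := irr1_gt0 i; rewrite dE ltr0n. Qed.
Let H := <[z]>%G.
Let nH : H <| B.
Proof. by rewrite /normal cycle_subG Bz; apply: subset_trans (cent_sub _); rewrite cent_cycle. Qed.
Let evE i : ev i = (H \subset cfker 'chi_i). Proof. by rewrite cycle_subG. Qed.
Let oBH : #|(B / H)%g| = 60%N.
Proof. by rewrite card_quotient ?normal_norm // -divgS ?normal_sub // oB -orderE oz. Qed.

Let sum_all : (\sum_i d i ^ 2 = 120)%N.
Proof.
apply/eqP; rewrite -(eqr_nat algC) natr_sum -oB -irr_sum_square; apply/eqP.
by apply: eq_bigr => i _; rewrite natrX -dE.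
Qed.

Let sum_ev : (\sum_(i | ev i) d i ^ 2 = 60)%N.
Proof.
apply/eqP; rewrite -(eqr_nat algC) natr_sum -oBH -irr_sum_square; apply/eqP.
have := sum_norm_irr_quo (group1 B) nH; rewrite morph1 => e.
transitivity (\sum_(i | H \subset cfker 'chi[B]_i) `|'chi_i 1%g| ^+ 2).
  by apply: eq_big => [i|i _]; rewrite ?evE // dE normr_nat natrX.
by rewrite -e; apply: eq_bigr => i _; rewrite ger0_norm ?char1_ge0 ?irr_char.
Qed.

Let sum_od : (\sum_(i | ~~ ev i) (d i %/ 2) ^ 2 = 15)%N.
Proof.
apply/eqP; rewrite -(eqn_pmul2l (isT : 0 < 4)%N); apply/eqP.
have := sum_all; rewrite (bigID ev) /= sum_ev => /eqP; rewrite -[120%N]/(60 + 60)%N eqn_add2l => /eqP e.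
rewrite -[RHS]e big_distrr /=; apply: eq_bigr => i ni; rewrite -[4%N]/(2 ^ 2)%N -expnMn.
have [m Dm] := odd_irr1_even Bz oz cz Ba Bb a2 ab ni.
have -> : d i = (2 * m)%N by apply/eqP; rewrite -(eqr_nat algC) -dE Dm.
by rewrite mulKn.
Qed.

Let od_even i : ~~ ev i -> exists2 m, d i = (2 * m)%N & (0 < m)%N.
Proof.
move=> ni; have [m Dm] := odd_irr1_even Bz oz cz Ba Bb a2 ab ni.
have e : d i = (2 * m)%N by apply/eqP; rewrite -(eqr_nat algC) -dE Dm.
by exists m => //; have := d0 i; rewrite e muln_gt0.
Qed.

Let lin0 i : d i = 1%N -> i = 0.
Proof.
move=> d1; have li : 'chi_i \is a linear_char by rewrite lin_irrE dE d1.
apply/eqP; rewrite -irr_eq1; apply/eqP/cfun_inP=> x Bx; rewrite cfun1E Bx.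
have : x \in cfker 'chi_i by apply: (subsetP (lin_char_der1 li)); rewrite perfB.
by rewrite cfkerEirr inE dE d1 => /eqP.
Qed.

Let d_0 : d 0 = 1%N.
Proof. by apply/eqP; rewrite -(eqr_nat algC) -dE irr0 cfun11. Qed.

Let ev0 : ev 0. Proof. by rewrite /ev irr0 cfker_cfun1. Qed.

Let ev_od i j : ev i -> ~~ ev j -> d i != d j.
Proof.
move=> ei nj; apply/eqP=> e; have [m dj m0] := od_even nj.
have n1 k : d k = d j -> 'chi_k 1%g != 1.
  by move=> ek; rewrite dE pnatr_eq1 ek dj mul2n; case: (m) m0.
have [|u Du] := GC (n1 i e) (n1 j erefl); first by rewrite !dE e.
by case/negP: nj; rewrite /ev Du cfker_aut.
Qed.

(** Writing odd degrees as 2m, the equation [A 1 + 4 A 2 + 9 A 3 = 15] forces an odd character of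
    degree 2, so nontrivial even degrees are at least 3. The permutation character on the five
    cosets of M then has an even constituent of degree 4, which forbids odd characters of degree 4.
    This leaves at least seven odd characters and at most six even ones, against
    [card_classes_center2]. *)
Lemma icosahedral_count_absurd : False.
Proof.
pose m i := (d i %/ 2)%N.
have mE i : ~~ ev i -> d i = (2 * m i)%N /\ (0 < m i)%N.
  by move=> ni; have [k dk k0] := od_even ni; rewrite /m dk mulKn.
have m3 i : ~~ ev i -> (m i <= 3)%N.
  move=> ni; rewrite leqNgt; apply/negP=> m4; have := sum_od; rewrite (bigD1 i) //= -/(m i).
  by move: (\sum_(_ | _) _)%N => r; move: (m i) m4 => k; clear; nia.
pose A k := (\sum_(i | ~~ ev i) (m i == k))%N.
have A15 : (A 1 + 4 * A 2 + 9 * A 3 = 15)%N.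
  rewrite -sum_od /A !big_distrr -!big_split /=; apply: eq_bigr => i ni.
  by rewrite -/(m i); have [_] := mE i ni; have := m3 i ni; case: (m i) => [|[|[|[|]]]].
have card_od : #|[pred i | ~~ ev i]| = (A 1 + A 2 + A 3)%N.
  rewrite -sum1_card /A -!big_split /=; apply: eq_bigr => i ni.
  by have [_] := mE i ni; have := m3 i ni; case: (m i) => [|[|[|[|]]]].
have Aex k : (0 < A k)%N -> exists2 i, ~~ ev i & m i = k.
  move=> Ak; suff /exists_inP[i ni /eqP mi] : [exists (i | ~~ ev i), m i == k] by exists i.
  apply: contraLR Ak; rewrite negb_exists_in => /forall_inP h.
  by rewrite -leqNgt leqn0 /A big1 // => i /h/negPf->.
have [i2 n2 m2] : exists2 i, ~~ ev i & m i = 1%N by apply: Aex; move: A15; clear; move: (A _) (A _) (A _); lia.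
have dge3 i : ev i -> i != 0 -> (2 < d i)%N.
  move=> ei ni; have d1 : d i != 1%N by apply: contraNneq ni => /lin0->.
  have d2 : d i != 2%N by have := ev_od ei n2; have [-> _] := mE i2 n2; rewrite m2.
  by have := d0 i; move: d1 d2; case: (d i) => [|[|[|]]].
have [i4 e4 d4] : exists2 i, ev i & d i = 4%N.
  pose th := 'Ind[B] (1 : 'CF(M)); have Nth : th \is a character by apply/cfInd_char/rpred1.
  pose c i := Num.truncn '[th, 'chi_i].
  have cE i : '[th, 'chi_i] = (c i)%:R by rewrite truncnK // Cnat_cfdot_char_irr.
  have sum5 : (\sum_i c i * d i = 5)%N.
    apply/eqP; rewrite -(eqr_nat algC) natr_sum; apply/eqP.
    transitivity (th 1%g); last by rewrite cfInd1 // cfun11 mulr1 iM.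
    rewrite [in RHS](cfun_sum_cfdot th) sum_cfunE; apply: eq_bigr => i _.
    by rewrite cfunE cE dE natrM.
  have c0 : c 0 = 1%N.
    apply/eqP; rewrite -(eqr_nat algC) -cE irr0 -Frobenius_reciprocity cfRes_cfun1 //.
    by rewrite cfnorm1.
  (* For an odd character the sum over M changes sign under translation by z, which lies in M. *)
  have cev i : (0 < c i)%N -> ev i.
    move=> ci; apply: contraLR ci => ni; rewrite -leqNgt leqn0 -(eqr_nat algC) -cE.
    rewrite -Frobenius_reciprocity cfdotC conjC_eq0 cfdotE mulf_eq0; apply/orP; right.
    have e : \sum_(x in M) ('Res[M] 'chi_i) x * ((1 : 'CF(M)) x)^* = - \sum_(x in M) ('Res[M] 'chi_i) x * ((1 : 'CF(M)) x)^*.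
      rewrite {1}(reindex_inj (mulgI z)) /= -sumrN; apply: eq_big => [x|x Mx]; first by rewrite groupMl.
      have Mx' : x \in M by rewrite groupMl in Mx.
      by rewrite !cfResE // !cfun1E Mx Mx' (odd_irr_zM Bz oz cz ni (subsetP sMB x Mx')) mulNr.
    by set u := (\sum_(_ in _) _) in e *; have : u *+ 2 == 0 by [rewrite mulr2n {1}e addNr]; rewrite mulrn_eq0.
  have ge3 i : i != 0 -> (0 < c i)%N -> (2 < d i)%N by move=> ni /cev ei; apply: dge3.
  move: sum5; rewrite (bigD1 0) //= c0 d_0 mul1n => /eqP; rewrite -[5%N]/(1 + 4)%N eqn_add2l => /eqP s4.
  have [i1 n1 ci1] : exists2 i, i != 0 & (0 < c i)%N.
    apply/exists_inP; apply: contraT; rewrite negb_exists_in => /forall_inP h.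
    by move: s4; rewrite big1 // => i /h; rewrite -leqNgt leqn0 => /eqP->.
  have g1 := ge3 _ n1 ci1; exists i1; first exact: cev.
  move: s4; rewrite (bigD1 i1) //=.
  have [/exists_inP[j /andP[nj nj1] cj]|] := boolP [exists (j | (j != 0) && (j != i1)), (0 < c j)%N].
    rewrite (bigD1 j) ?nj //=; have gj := ge3 _ nj cj.
    by move: g1 gj ci1 cj; move: (c _) (c _) (d _) (d _) (\sum_(_ | _) _)%N; clear; nia.
  rewrite negb_exists_in => /forall_inP h; rewrite big1 => [|j /h]; last by rewrite -leqNgt leqn0 => /eqP->.
  by rewrite addn0; move: g1 ci1; move: (c _) (d _); clear; nia.
have A2 : A 2 = 0%N.
  apply/eqP; rewrite -leqn0 leqNgt; apply/negP=> /Aex[i ni mi].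
  by have := ev_od e4 ni; have [-> _] := mE i ni; rewrite d4 mi.
(* With [A 2 = 0] the pair of [A 1] and [A 3] is 15, 0 or 6, 1. *)
have od7 : (7 <= #|[pred i | ~~ ev i]|)%N.
  by rewrite card_od; move: A15; rewrite A2; clear; move: (A _) (A _); lia.
(* Beside 1 and 16 the squares of the even degrees fill 60 - 17 = 43, and each is at least 9. *)
have ev6 : (#|[pred i | ev i]| <= 6)%N.
  have n4 : i4 != 0 by apply/eqP=> e; move: d4; rewrite e d_0.
  have := sum_ev; rewrite (bigD1 0) //= d_0 (bigD1 i4) /= ?e4 // d4.
  have -> : #|[pred i | ev i]| = (\sum_(i | ev i && (i != 0%R) && (i != i4)) 1).+2.
    have e4' : ev i4 && (i4 != 0) by rewrite e4.
    rewrite -sum1_card (bigD1 0) ?inE //= (bigD1 i4) ?inE //=.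
  have : (\sum_(i | ev i && (i != 0%R) && (i != i4)) 9 <= \sum_(i | ev i && (i != 0%R) && (i != i4)) d i ^ 2)%N.
    apply: leq_sum => i /andP[/andP[ei ni] _]; have := dge3 i ei ni.
    by move: (d i) => k; rewrite -[9%N]/(3 ^ 2)%N leq_exp2r.
  rewrite -[9%N]/(9 * 1)%N -big_distrr /=.
  by move: (\sum_(_ | _) _)%N (\sum_(_ | _) _)%N; clear; lia.
have : (#|[pred i | ~~ ev i]| <= #|[pred i | ev i]|)%N.
  have eN : (#|[pred i | ev i]| + #|[pred i | ~~ ev i]|)%N = #|classes B|.
    by rewrite (cardC [pred i | ev i]) card_ord NirrE.
  have eE : #|[pred i | ev i]| = #|classes (B / H)%g|.
    rewrite -NirrE -[RHS]card_ord (eq_card (evE : ev =i [pred i | H \subset cfker 'chi[B]_i])).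
    rewrite -(on_card_preimset (mod_Iirr_bij nH)); apply: eq_card => i.
    by rewrite !inE mod_IirrE ?cfker_mod.
  have := card_classes_center2 Zz oz; rewrite -/H -eE -eN.
  by move: #|_| #|_|; clear; lia.
by move: od7 ev6; move: #|_| #|_|; clear; lia.
Qed.
End Count.
End IcosahedralCount.

(** * Structure of a fixed-point-free GC*-group *)

Module FpfStructure.
Import NcRing ClassEquation FpfRings OrderThreePairs QuaternionCoordinates GoldenValues Frames Points PerfectCentraliser IcosahedralQuotient GaloisConjugates Transfer FpfSylow FpfOdd OddCharacters GCstarIndex NonPerfect ThreeDivides IcosahedralCount.
Import GroupScope.

Lemma quaternion_pair (gT : finGroupType) (S : {group gT}) : extremal_class S = Quaternion ->
  8 %| #|S| /\ exists a b, [/\ a \in S, b \in S, #[a] = 4 & a ^ b = a^-1].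
Proof.
move=> exS; have [n [x [y [[n2 oS Sx ox X'y] [nX inv o4 _ _]]]]] := quaternion_facts exS.
split; first by rewrite oS (@dvdn_exp2l 2 3).
have [Sy _] := setDP X'y; exists (x ^+ (2 ^ (n - 3))), y; split; rewrite ?groupX //; last first.
  by apply: inv; rewrite ?mem_cycle.
rewrite (orderXexp _ ox) (_ : n.-1 - (n - 3) = 2)%N //.
by case: (n) n2 => [|[|[|k]]] //= _; rewrite !subSS subn0 subSn // subSnn.
Qed.

Section FPF.
Variables (gT : finGroupType) (L : {group gT}) (R : unitRingType).
Variable rho : gT -> R.
Hypothesis rep : fpf_rep L rho.
Hypothesis uL : {in \pi(L), forall p, (p%:R)%R \is a @GRing.unit R}.
Hypothesis GC : GCstar L.

Lemma fpf_abelian_cyclic : abelian L -> cyclic L.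
Proof.
move=> abL; apply: nil_Zgroup_cyclic (abelian_nil abL); apply/forall_inP=> V /SylowP[p pr_p sylV].
have [sVL pV _] := and3P sylV.
have [->|ntV] := eqVneq (V : {set gT}) 1; first exact: cyclic1.
case/orP: (fpf_pgroup rep uL pV sVL ntV) => // /andP[_ /eqP/quaternion_pair[_ [a [b [Va Vb oa ab]]]]].
have : a ^ b = a by apply/conjg_fixP/commgP; apply: (centsP abL); apply: (subsetP sVL).
rewrite ab => e; have : #[a] %| 2 by rewrite order_dvdn expg2 -{1}e mulVg.
by rewrite oa.
Qed.

(** If y commutes with all elements of order 3, its class lies in {y, y^-1}; by perfectness y is
    central, which transfer forbids. Otherwise there is a pair of trace 0. The resulting N has Sylow
    2-subgroup [<[z]>], and factoring out its normal 2-complement leaves order 120 with z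
    surviving. *)
Lemma perfect_absurd z (S : {group gT}) : z \in L -> #[z] = 2 -> 2.-Sylow(L) S ->
  extremal_class S = Quaternion -> L^`(1) = L -> False.
Proof.
move=> Lz oz sylS exS perfL; have cz := z_central rep Lz oz; have sSL := pHall_sub sylS.
have Zz : z \in 'Z(L) by rewrite inE Lz -sub_cent1.
have [S8 [a [b [Sa Sb oa ab]]]] := quaternion_pair exS.
have [La Lb] : a \in L /\ b \in L by split; apply: (subsetP sSL).
have L8 : 8 %| #|L| := dvdn_trans S8 (cardSg sSL).
have a2 : a ^+ 2 = z.
  have : a ^+ 2 \in <[z]>.
    by apply: (sq1 rep Lz oz); rewrite ?groupX // -expgM; apply/eqP; rewrite -order_dvdn oa.
  case/cycleP=> n; rewrite -(expg_mod n (_ : z ^+ 2 = 1)) -?oz ?expg_order //.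
  rewrite oz; case: (n %% 2) (ltn_pmod n (isT : 0 < 2)) => [|[|]] // _ e.
  by have : #[a] %| 2; [rewrite order_dvdn e | rewrite oa].
have [y Ly oy] := Cauchy (isT : prime 3) (perfect_dvd3 rep Lz oz perfL sylS exS).
have Yy : y \in order3 L by rewrite inE Ly oy.
have [/forall_inP call|] := boolP [forall (w | w \in order3 L), w \in 'C[y]].
  have cl : y ^: L \subset [set y; y^-1].
    apply/subsetP=> _ /imsetP[g Lg ->]; have Yg := order3J Lg Yy.
    by rewrite !inE; case: (comm3 rep Yy Yg (call _ Yg)) => ->; rewrite eqxx ?orbT.
  pose C := 'C_L[y]%G; have sCL : C \subset L := subsetIl _ _.
  have i2 : #|L : C| <= 2.
    rewrite index_cent1; apply: leq_trans (subset_leq_card cl) _.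
    by rewrite cards2; case: eqP.
  have cLy : L \subset 'C[y].
    suff: L \subset C by rewrite subsetI subxx.
    have [i1|i1] := eqVneq #|L : C| 1%N; first by rewrite -indexg_eq1 i1.
    have i2' : #|L : C| = 2 by apply/eqP; rewrite eqn_leq i2 ltn_neqAle eq_sym i1 indexg_gt0.
    have nC := index2_normal sCL i2'.
    rewrite -{1}perfL; apply: der1_min (normal_norm nC) _; apply/cyclic_abelian/prime_cyclic.
    by rewrite card_quotient ?normal_norm // i2'.
  have Zy : y \in 'Z(L) by rewrite inE Ly -sub_cent1.
  have [P sylP] := Sylow_exists 3 L; have [sPL pP _] := and3P sylP.
  have [||g Lg sy] := Sylow_Jsub sylP (_ : <[y]> \subset L).
  - by rewrite cycle_subG.
  - by rewrite /pgroup -orderE oy.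
  have Py : y \in P.
    move: sy; rewrite -cycleJ cycle_subG (_ : y ^ g = y) //.
    by apply/conjg_fixP/commgP; apply: (centP (subsetP (subsetIr _ _) y Zy)).
  have abP : abelian P by apply/cyclic_abelian/(fpf_odd_cyclic rep uL pP sPL).
  have := transfer_central sPL abP (Sylow_coindex sylP) Py Zy; rewrite perfL => /(_ Ly) y1.
  by move: oy; rewrite y1 order1.
rewrite negb_forall_in => /exists_inP[w Yw nc].
have [p [q [Yp Yq pq0]]] := exists_trace0 rep Lz oz Yy Yw nc.
have [N [M [nN Nz iN n4 [sNM sML iM]]]] := perfect_index5 rep Lz oz perfL L8 Yp Yq pq0.
have [sNL nNL] := andP nN.
have sylz : 2.-Sylow(N) <[z]>.
  rewrite pHallE cycle_subG Nz -orderE oz p_part.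
  have : 0 < logn 2 #|N| by rewrite -(@pfactor_dvdn 2 1) ?cardG_gt0 // -oz order_dvdG.
  move: n4; rewrite (@pfactor_dvdn 2 2) ?cardG_gt0 //.
  by case: (logn 2 #|N|) => [|[|]].
have ZNz : z \in 'Z(N) by rewrite inE Nz; case/setIP: Zz => _; apply: subsetP; apply: centS.
have tiz : <[z]> :&: N^`(1) = 1.
  rewrite prime_TIg -?orderE ?oz // cycle_subG; apply/negP=> Dz.
  have z1 := transfer_central (pHall_sub sylz) (cycle_abelian z) (Sylow_coindex sylz) (cycle_id z) ZNz Dz.
  by move: oz; rewrite z1 order1.
pose O := 'O_2^'(N)%G; have hallO : 2^'.-Hall(N) O := pcore_der1_Hall sylz tiz.
have nO : O <| L by apply: gFnormal_trans.
have [sOL nOL] := andP nO; have sON : O \subset N := pHall_sub hallO.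
have iO : #|N : O| = 2.
  rewrite -divgS // -(partnC 2 (cardG_gt0 N)) -(card_Hall sylz) -(card_Hall hallO) -orderE oz mulnK //.
have nq t : t \in L -> t \in 'N(O) := fun Lt => subsetP nOL t Lt.
have oB : #|L / O| = 120 by rewrite card_quotient // -(Lagrange_index sNL sON) iN iO.
have Oz : z \notin O.
  apply/negP=> /order_dvdG; rewrite oz => d2.
  by have := pHall_pgroup hallO; rewrite /pgroup p'natE // d2.
have oqz : #[coset O z] = 2.
  apply: nt_prime_order => //; first by rewrite -morphX ?nq //= -oz expg_order morph1.
  by apply: contra Oz => /eqP; apply: coset_idr; apply: nq.
have Zqz : coset O z \in 'Z(L / O).
  rewrite inE mem_quotient //=; apply/centP=> _ /morphimP[g nOg Lg ->].
  by rewrite /commute /= -!morphM ?nq // (centP (subsetP (subsetIr _ _) z Zz)).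
apply: (@icosahedral_count_absurd _ (L / O)%G (M / O)%G (coset O z) (coset O a) (coset O b)) => //.
- exact: GCstar_quotient.
- by rewrite /= -quotient_der // perfL.
- exact: quotientS.
- rewrite index_quotient_eq //; exact: subset_trans (subsetIr _ _) (subset_trans sON sNM).
- by rewrite mem_quotient // (subsetP sNM).
- exact: mem_quotient.
- exact: mem_quotient.
- by rewrite -morphX ?nq //= a2.
by rewrite -morphJ ?nq //= ab morphV ?nq.
Qed.

Theorem fpf_GCstar_structure : cyclic L \/ #|L| = 8 /\ extremal_class L = Quaternion.
Proof.
have [oddL|evL] := boolP (odd #|L|).
  by left; apply/fpf_abelian_cyclic/(fpf_odd_abelian rep uL).
have [|z Lz oz] := @Cauchy _ 2 L isT; first by rewrite dvdn2.
have cz := z_central rep Lz oz.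
have Zz : z \in 'Z(L) by rewrite inE Lz -sub_cent1.
have [S sylS] := Sylow_exists 2 L; have [sSL pS _] := and3P sylS.
have [||g Lg sz] := Sylow_Jsub sylS (_ : <[z]> \subset L).
- by rewrite cycle_subG.
- by rewrite /pgroup -orderE oz.
have Sz : z \in S.
  move: sz; rewrite -cycleJ cycle_subG (_ : z ^ g = z) //.
  by apply/conjg_fixP/commgP; apply: (centP (subsetP (subsetIr _ _) z Zz)).
have ntS : S :!=: 1 by apply/trivgPn; exists z; rewrite // -order_eq1 oz.
case/orP: (fpf_pgroup rep uL pS sSL ntS) => [cyS|/andP[_ /eqP exS]].
  left; apply: fpf_abelian_cyclic; apply: (GCstar_central_der GC Zz); rewrite ?oz //.
  apply/negP=> Dz; have z1 := transfer_central sSL (cyclic_abelian cyS) (Sylow_coindex sylS) Sz Zz Dz.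
  by move: oz; rewrite z1 order1.
have [perfL|np] := eqVneq (L^`(1)) L; first by case: (perfect_absurd Lz oz sylS exS perfL).
have oL := GCstar_nonperfect rep uL GC Lz oz sylS exS np; right; split=> //.
rewrite (_ : L :=: S) //; apply/esym/eqP; rewrite eqEcard sSL oL.
by have [S8 _] := quaternion_pair exS; rewrite dvdn_leq.
Qed.
End FPF.
End FpfStructure.

(** * Transitivity of an abelian group times the scalars *)

Module ScalarAction.
Import GroupScope GRing.Theory.
Local Open Scope ring_scope.

Lemma geometric_mod (q n d : nat) : (0 < q)%N -> (d %| q.-1)%N -> (\sum_(i < n) q ^ i = n %[mod d])%N.
Proof.
move=> q0 dq; have q1 : (q = 1 %[mod d])%N.
  by apply/eqP; rewrite -(prednK q0) -addn1 -[X in _ == X %[mod d]]add0n eqn_modDr mod0n.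
elim: n => [|n IH]; first by rewrite big_ord0.
by rewrite big_ord_recr /= -modnDm IH -modnXm q1 modnXm exp1n modnDm addn1.
Qed.

Section Scalars.
Variables (F : finFieldType) (gT : finGroupType) (L : {group gT}) (n : nat).
Variable rG : mx_representation F L n.+1.
Hypothesis abL : abelian L.
Hypothesis sr : forall l (v : 'rV[F]_n.+1), l \in L^# -> v *m rG l = v -> v = 0.

Let Q := #|F|.
Let m := #|L|.

Definition scalar_dom := [group of setX L [set: {unit F}]].
(** The default v outside L only makes the function total; it is an action of [scalar_dom]. *)
Definition scalar_act (v : 'rV[F]_n.+1) (a : gT * {unit F}) :=
  if a.1 \in L then val a.2 *: (v *m rG a.1) else v.

Lemma scalar_actP : is_action scalar_dom scalar_act.
Proof.
split=> [[l k] v w|v [l k] [l' k']].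
  rewrite /scalar_act /=; case: ifP => // Ll e; apply: (can_inj (mulmxK (repr_mx_unit rG Ll))).
  by apply: (scalerI _ e); rewrite -unitfE (valP k).
rewrite !inE !andbT /= => Ll Ll'; rewrite /scalar_act /= groupM // Ll Ll' -scalemxAl scalerA -mulmxA.
by rewrite -repr_mxM // mulrC.
Qed.
Canonical scalar_action := Action scalar_actP.

Local Notation D := (scalar_dom : {group _}).
Local Notation to := scalar_action.

Lemma card_scalar_dom : #|D| = (m * Q.-1)%N.
Proof. by rewrite /= cardsX card_finField_unit. Qed.

Lemma scalar_actE v l k : l \in L -> to v (l, k) = val k *: (v *m rG l).
Proof. by move=> Ll; rewrite /= /scalar_act /= Ll. Qed.

Let V := [set v : 'rV[F]_n.+1 | v != 0].

Lemma card_nz : #|V| = (Q ^ n.+1).-1.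
Proof.
have -> : V = [set~ 0] by apply/setP=> v; rewrite !inE.
by rewrite cardsC1 card_mx mul1n.
Qed.

Lemma scalar_acts : [acts D, on V | to].
Proof.
apply/subsetP=> [[l k] Da]; have Ll : l \in L by move: Da; rewrite !inE andbT.
apply/setIP; split; first by [].
rewrite inE; apply/subsetP=> v; rewrite !inE => nv; rewrite scalar_actE //.
rewrite scaler_eq0 negb_or -unitfE (valP k) /=; apply: contra nv => /eqP e.
by apply/eqP; apply: (can_inj (mulmxK (repr_mx_unit rG Ll))); rewrite e mul0mx.
Qed.

Let St v := 'C_D[v | to].

Lemma stabP v l k : reflect (l \in L /\ val k *: (v *m rG l) = v) ((l, k) \in St v).
Proof.
apply: (iffP setIP) => [[/setXP[Ll _] /setIP[_]]|[Ll e]].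
  by rewrite inE sub1set inE => /eqP; rewrite scalar_actE.
have Da : (l, k) \in D by rewrite !inE Ll.
split=> //; apply/setIP; split; first exact: Da.
by rewrite inE sub1set inE scalar_actE // e.
Qed.

Lemma stab_fst_inj v : v != 0 -> {in St v &, injective (fst : gT * {unit F} -> gT)}.
Proof.
move=> nv.
move=> [l k] [l' k'] /stabP[Ll e] /stabP[_ e'] /= el; rewrite -el in e' *; congr (_, _).
apply: val_inj => /=; apply/eqP; rewrite -subr_eq0; apply: contraT => nk.
have : (val k - val k') *: (v *m rG l) = 0 by rewrite scalerBl e e' subrr.
move/eqP; rewrite scaler_eq0 (negPf nk) /= => /eqP e0.
by case/eqP: nv; rewrite -e e0 scaler0.
Qed.

(** Either component of a stabilising pair determines the other, as L and the scalars both act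
    freely on nonzero vectors. *)
Lemma card_stab_dvd v : v != 0 -> (#|St v| %| m)%N /\ (#|St v| %| Q.-1)%N.
Proof.
move=> nv.
have inj1 := stab_fst_inj nv.
have inj2 : {in St v &, injective (snd : gT * {unit F} -> {unit F})}.
  move=> [l k] [l' k'] /stabP[Ll e] /stabP[Ll' e'] /= ek; rewrite -ek in e' *; congr (_, _).
  apply/eqP; rewrite eq_mulgV1; apply: contraT => nl.
  have e2 : v *m rG l = v *m rG l' by apply: (scalerI (_ : val k != 0)); rewrite ?e // -unitfE (valP k).
  case/eqP: nv; apply: (sr (l := (l * l'^-1)%g)); first by rewrite !inE nl groupM ?groupV.
  by rewrite repr_mxM ?groupV // mulmxA e2 -mulmxA -repr_mxM ?groupV // mulgV repr_mx1 mulmx1.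
have St_L : fst @: St v \subset L by apply/subsetP=> _ /imsetP[[l k] /stabP[Ll _] ->].
have g1 : group_set (fst @: St v).
  rewrite (_ : _ @: _ = fst_morphism gT {unit F} @* [group of St v]) ?groupP //.
  by rewrite morphimEsub ?subsetT.
have g2 : group_set (snd @: St v).
  rewrite (_ : _ @: _ = snd_morphism gT {unit F} @* [group of St v]) ?groupP //.
  by rewrite morphimEsub ?subsetT.
split.
  by rewrite -(card_in_imset inj1) (cardSg (_ : Group g1 \subset L)).
rewrite -(card_in_imset inj2) -card_finField_unit.
by rewrite (cardSg (_ : Group g2 \subset [set: {unit F}])) ?subsetT.
Qed.

Definition scalar_transitive :=
  forall v w : 'rV[F]_n.+1, v != 0 -> w != 0 -> exists l (k : {unit F}), l \in L /\ w = val k *: (v *m rG l).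

Lemma orbit_nz v : v != 0 -> scalar_transitive -> orbit to D v = V.
Proof.
move=> nv tr; apply/eqP; rewrite eqEsubset acts_sub_orbit ?scalar_acts // inE nv /=.
apply/subsetP=> w; rewrite inE => nw; have [l [k [Ll ->]]] := tr v w nv nw.
by apply/orbitP; exists (l, k); rewrite ?inE ?Ll // scalar_actE.
Qed.

Let numer : ((Q ^ n.+1).-1 = Q.-1 * \sum_(i < n.+1) Q ^ i)%N.
Proof. exact: predn_exp. Qed.

Let Q1 : (1 < Q)%N. Proof. exact: finNzRing_gt1. Qed.
Let Qp : (0 < Q.-1)%N. Proof. by rewrite -subn1 subn_gt0. Qed.
Let m0 : (0 < m)%N. Proof. exact: cardG_gt0. Qed.

(** As L is abelian, the vectors fixed by a pair form a submodule, so by irreducibility all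
    stabilisers agree and all orbits have one size. The number t of orbits divides d and
    [1 + Q + ... + Q^n], which is n + 1 modulo d; coprimality gives t = 1. *)
Lemma irreducible_transitive d : mx_irreducible rG -> (d %| Q.-1)%N -> coprime d n.+1 ->
  (m * d = (Q ^ n.+1).-1)%N -> scalar_transitive.
Proof.
move=> irr dq dn md.
have stE v w : v != 0 -> w != 0 -> St v = St w.
  suff sub v' w' : v' != 0 -> St v' \subset St w' by move=> nv nw; apply/eqP; rewrite eqEsubset !sub.
  move=> nv; apply/subsetP=> [[l k] /stabP[Ll e]]; apply/stabP; split=> //.
  pose U := kermx (val k *: rG l - 1%:M).
  have UP u : (u <= U)%MS = (val k *: (u *m rG l) == u).
    rewrite (sameP sub_kermxP eqP) mulmxBr -scalemxAr mulmx1 subr_eq0 //.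
  have modU : mxmodule rG U.
    apply/mxmoduleP=> g Lg; apply/row_subP=> i; rewrite row_mul UP -mulmxA -repr_mxM //.
    rewrite (centsP abL _ Lg _ Ll) repr_mxM // mulmxA scalemxAl.
    by have := row_sub i U; rewrite UP => /eqP->.
  have U0 : U != 0.
    apply: contra nv => /eqP U0; have : (v' <= U)%MS by rewrite UP e.
    by rewrite U0 submx0.
  have /mx_irrP[_ /(_ U modU U0)] := irr.
  by rewrite -sub1mx => /(submx_trans (submx1 w')); rewrite UP => /eqP.
have [v0 nv0] : exists v0 : 'rV[F]_n.+1, v0 != 0.
  exists (const_mx 1); apply/eqP=> /matrixP/(_ 0 0); rewrite !mxE => /eqP; by rewrite oner_eq0.
have oE v : v != 0 -> #|orbit to D v| = #|orbit to D v0|.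
  by move=> nv; rewrite !card_orbit_in //; congr #|_ : _|; apply: (stE v v0).
have [t Dt] : exists t, (#|orbit to D v0| * t = (Q ^ n.+1).-1)%N.
  exists #|orbit to D @: V|; rewrite -card_nz -(acts_sum_card_orbit scalar_acts).
  rewrite mulnC -sum_nat_const; apply: eq_bigr => _ /imsetP[v nv ->].
  by rewrite inE in nv; rewrite oE.
have [dm dQ] := card_stab_dvd nv0.
set s := #|orbit to D v0| in Dt oE.
have es : (#|St v0| * s = m * Q.-1)%N.
  by rewrite -card_scalar_dom /s card_orbit_in // Lagrange ?subsetIl.
have s0 : (0 < #|St v0|)%N by rewrite cardG_gt0.
have ms : (m %| s)%N.
  case/dvdnP: dQ => c ec; apply/dvdnP; exists c; apply/eqP; rewrite -(eqn_pmul2l s0) es ec.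
  by apply/eqP; ring.
have Qs : (Q.-1 %| s)%N.
  case/dvdnP: dm => c ec; apply/dvdnP; exists c; apply/eqP; rewrite -(eqn_pmul2l s0) es ec.
  by apply/eqP; ring.
have td : (t %| d)%N.
  case/dvdnP: ms => c ec; apply/dvdnP; exists c; apply/eqP; rewrite -(eqn_pmul2l m0) md -Dt ec.
  by apply/eqP; ring.
have te : (t %| \sum_(i < n.+1) Q ^ i)%N.
  case/dvdnP: Qs => c ec; apply/dvdnP; exists c; apply/eqP; rewrite -(eqn_pmul2l Qp) -numer -Dt ec.
  by apply/eqP; ring.
have t1 : t = 1%N.
  apply/eqP; rewrite -dvdn1 -(eqnP dn) dvdn_gcd td /=.
  have := geometric_mod n.+1 (ltnW Q1) (dvdn_trans td dq).
  by move/eqP: te => ->; move/esym/eqP.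
have oV v : v != 0 -> orbit to D v = V.
  move=> nv; apply/eqP; rewrite eqEcard acts_sub_orbit ?scalar_acts // inE nv /=.
  by rewrite card_nz -Dt t1 muln1 oE.
move=> v w nv nw; have : w \in orbit to D v by rewrite oV // inE.
case/orbitP=> [[l k]]; rewrite !inE andbT => Ll <-; exists l, k; split=> //.
by rewrite scalar_actE.
Qed.

(** Take d to be Q - 1 over the order of a stabiliser with projection L0 to L. If a prime r divided
    d and n + 1, some l outside L0 would have l^r in L0, hence scalar. A multiple u of l then
    satisfies u^r = 1 and has an eigenvector over F, which transitivity carries to v0; this puts l
    into L0. *)
Lemma transitive_arith : scalar_transitive ->
  exists d, [/\ (d %| Q.-1)%N, coprime d n.+1 & (m * d = (Q ^ n.+1).-1)%N].
Proof.
move=> tr.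
have [v0 nv0] : exists v0 : 'rV[F]_n.+1, v0 != 0.
  exists (const_mx 1); apply/eqP=> /matrixP/(_ 0 0); rewrite !mxE => /eqP; by rewrite oner_eq0.
have [dm dQ] := card_stab_dvd nv0.
have es : (#|St v0| * (Q ^ n.+1).-1 = m * Q.-1)%N.
  by rewrite -card_scalar_dom -card_nz -(orbit_nz nv0 tr) card_orbit_in // Lagrange ?subsetIl.
have s0 : (0 < #|St v0|)%N by rewrite cardG_gt0.
pose d := (Q.-1 %/ #|St v0|)%N; have dE : (d * #|St v0| = Q.-1)%N by rewrite divnK.
have dq : (d %| Q.-1)%N by rewrite -dE dvdn_mulr.
have md : (m * d = (Q ^ n.+1).-1)%N.
  by apply/eqP; rewrite -(eqn_pmul2l s0) es -dE; apply/eqP; ring.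
exists d; split=> //; rewrite coprime_sym coprime_has_primes ?(dvdn_gt0 Qp dq) //.
apply/hasPn=> r; rewrite mem_primes => /and3P[pr_r _ rd].
rewrite mem_primes pr_r /=; apply/negP=> rn.
pose L0 := (fst_morphism gT {unit F} @* [group of St v0])%G.
have L0P l : reflect (exists k, (l, k) \in St v0) (l \in L0).
  apply: (iffP idP) => [/morphimP[[l' k] _ Sa ->]|[k Sa]]; first by exists k.
  by apply/morphimP; exists (l, k) => //; apply: in_setT.
have sL0 : L0 \subset L by apply/subsetP=> l /L0P[k /stabP[]].
have oL0 : #|L0| = #|St v0|.
  by rewrite /= morphimEsub ?subsetT // (card_in_imset (stab_fst_inj nv0)).
have d0 : (0 < d)%N := dvdn_gt0 Qp dq.
have rL : (r %| #|L : L0|)%N.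
  have e : (m = #|St v0| * \sum_(i < n.+1) Q ^ i)%N.
    by apply/eqP; rewrite -(eqn_pmul2r d0) md numer -dE; apply/eqP; ring.
  rewrite -divgS // oL0 -/m e mulKn // /dvdn (geometric_mod n.+1 (ltnW Q1) (dvdn_trans rd dq)).
  exact: rn.
have [l [Ll nl lr]] : exists l, [/\ l \in L, l \notin L0 & (l ^+ r \in L0)%g].
  have nL0 : L0 <| L by rewrite /normal sL0 (sub_abelian_norm abL).
  have := rL; rewrite -card_quotient ?normal_norm // => /(Cauchy pr_r)[_ /morphimP[l nl Ll ->] ol].
  exists l; split=> //.
    apply/negP=> L0l; move: ol; rewrite /= coset_id // order1 => r1; by rewrite -r1 in pr_r.
  by apply: coset_idr; rewrite ?groupX // morphX // -ol expg_order.
have [k Sk] := L0P _ lr; have [_ ek] := stabP _ _ _ Sk.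
have /cyclicP[gam Dgam] := field_unit_group_cyclic [set: {unit F}]%G.
have ogam : #[gam] = Q.-1 by rewrite orderE -Dgam card_finField_unit.
have [a Da] : exists a, (k = gam ^+ a)%g by apply/cycleP; rewrite -Dgam inE.
(* k is killed by the order of the stabiliser and gam has order d times that order, so d divides
   a. *)
have ra : (r %| a)%N.
  have kS : (k ^+ #|St v0| = 1)%g.
    have e := expg_cardG (Sk : (_, _) \in [group of St v0]).
    by have := morphX (snd_morphism gT {unit F}) #|St v0| (in_setT ((l ^+ r)%g, k)); rewrite /= e => <-.
  have : (#[gam] %| a * #|St v0|)%N by rewrite order_dvdn expgM -Da kS.
  by rewrite ogam -dE dvdn_pmul2r //; apply: dvdn_trans.
have rQ : (r %| Q.-1)%N := dvdn_trans rd dq.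
pose kap := (gam ^+ (a %/ r))%g; have kapr : (kap ^+ r = k)%g by rewrite -expgM divnK.
pose zet := (gam ^+ (Q.-1 %/ r))%g.
have valX (b : {unit F}) i : val (b ^+ i)%g = val b ^+ i by rewrite FinRing.val_unitX.
have ozet : #[zet] = r.
  by rewrite /zet orderXdiv ogam ?dvdn_div // divnA // mulKn.
have prim : r.-primitive_root (val zet).
  apply/andP; split; first exact: prime_gt0.
  apply/forallP=> i; rewrite unity_rootE -valX -[1]/(val (1%g : {unit F})) val_eqE -order_dvdn ozet.
  apply/eqP; apply/idP/eqP=> [d'|->]; last exact: dvdnn.
  by apply/eqP; rewrite eqn_leq ltn_ord dvdn_leq.
pose u := val kap *: rG l.
have ur : u ^+ r = 1.
  have -> : u ^+ r = val k *: rG (l ^+ r)%g.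
    rewrite exprZn -valX kapr; congr (_ *: _); elim: (r) => [|i IH]; first by rewrite repr_mx1.
    by rewrite exprSr IH expgSr repr_mxM ?groupX.
  have fixv (v : 'rV_n.+1) : v *m (val k *: rG (l ^+ r)%g) = v.
    have [->|nv] := eqVneq v 0; first by rewrite mul0mx.
    have [l' [k' [Ll' ->]]] := tr v0 v nv0 nv.
    rewrite -scalemxAl -scalemxAr; congr (_ *: _).
    rewrite -mulmxA -repr_mxM ?groupX // (centsP abL _ Ll' _ (groupX r Ll)) repr_mxM ?groupX //.
    by rewrite mulmxA scalemxAl ek.
  by apply/row_matrixP=> i; rewrite !rowE fixv mulmx1.
(* [X^r - 1] splits over F, so one of the commuting factors [u - zet^i] is singular. *)
have [i ei] : exists i : nat, \det (u - (val zet ^+ i)%:M) == 0.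
  have := factor_Xn_sub_1 prim => /(congr1 (horner_mx u)).
  rewrite rmorphB rmorphXn /= horner_mx_X ur rmorph1 subrr rmorph_prod /= => /(congr1 determinant).
  rewrite det0 (big_morph _ (@det_mulmx _ n.+1) (det1 _ _)) => /eqP.
  rewrite prodf_seq_eq0 => /hasP[i _ /andP[_ e]]; exists i.
  by move: e; rewrite rmorphB /= horner_mx_X horner_mx_C.
have /det0P[w nw] := ei; rewrite mulmxBr mul_mx_scalar => /eqP; rewrite subr_eq0 -scalemxAr => /eqP ew.
have [l' [k' [Ll' ev]]] := tr w v0 nw nv0.
case/negP: nl; apply/L0P; exists (kap * (zet ^+ i)^-1)%g; apply/stabP; split=> //.
rewrite ev -scalemxAl scalerA mulrC -scalerA; congr (_ *: _).
rewrite -mulmxA -repr_mxM // (centsP abL _ Ll' _ Ll) repr_mxM // mulmxA.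
rewrite /= [val kap * _]mulrC -scalerA scalemxAl ew -scalemxAl scalerA.
by rewrite -[val zet ^+ i]valX mulVr ?scale1r ?(valP (zet ^+ i)%g).
Qed.
End Scalars.
End ScalarAction.

(** * Irreducible characters of the kernel *)

Module KernelCharacters.
Import GaloisConjugates.
Import GroupScope Order.TTheory GRing.Theory Num.Theory.
Local Open Scope ring_scope.

Section Kernel.
Variables (gT : finGroupType) (G K : {group gT}).
Hypotheses (frobGK : [Frobenius G with kernel K]) (abK : abelian K).

Let nK : K <| G. Proof. by case/Frobenius_kerP: frobGK. Qed.
Let sKG := normal_sub nK.
Let nKG x : x \in G -> x \in 'N(K). Proof. exact: (subsetP (normal_norm nK)). Qed.
Local Notation n := #|K|.
Let n1 : (1 < n)%N. Proof. by rewrite cardG_gt1; case/Frobenius_kerP: frobGK. Qed.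
Local Notation E := {unit 'Z_n}.

(** Conjugation and the units modulo the order of K act together; Galois automorphisms act on the
    characters of K through these units. *)
Definition pow_conj (x g : gT) (k : E) : gT := ((x ^ g) ^+ val k)%g.

Lemma pow_conj_in x g k : x \in K -> g \in G -> pow_conj x g k \in K.
Proof. by move=> Kx Gg; rewrite groupX // memJ_norm ?nKG. Qed.

Lemma pow_conj1 x : pow_conj x 1 1 = x.
Proof. by rewrite /pow_conj conjg1 /= expg1. Qed.

Lemma pow_conjM x g h k m : x \in K -> g \in G ->
  pow_conj (pow_conj x g k) h m = pow_conj x (g * h)%g (k * m)%g.
Proof.
move=> Kx Gg; rewrite /pow_conj conjXg -conjgM -expgM.
have e : ((x ^ (g * h)) ^+ n = 1)%g by rewrite -conjXg expg_cardG // conj1g.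
have vE : nat_of_ord (val (k * m)%g) = ((val k * val m) %% n)%N.
  by rewrite /=; congr (_ %% _)%N; apply: Zp_cast.
by rewrite vE expg_mod.
Qed.

Let lin (i : Iirr K) : 'chi_i \is a linear_char. Proof. exact/char_abelianP. Qed.
Let linX (i : Iirr K) x : x \in K -> 'chi_i x ^+ n = 1.
Proof. by move=> Kx; rewrite -lin_charX // expg_cardG // lin_char1. Qed.

Lemma coprime_unitZ (k : E) : coprime (val k) n.
Proof. by have := valP k; rewrite -[val k in X in X -> _]natr_Zp unitZpE // coprime_sym. Qed.

Lemma unitZ_of (k : nat) : coprime k n -> exists k' : E, forall z : algC, z ^+ n = 1 -> z ^+ k = z ^+ val k'.
Proof.
move=> co; have uk : (k%:R : 'Z_n) \is a GRing.unit by rewrite unitZpE // coprime_sym.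
exists (FinRing.unit _ uk) => z zn; rewrite /= val_Zp_nat //.
by rewrite [in LHS](divn_eq k n) exprD mulnC exprM zn expr1n mul1r.
Qed.

Lemma irr_pow_conj (i : Iirr K) g (k : E) : g \in G ->
  exists (u : {rmorphism algC -> algC}) (j : Iirr K),
    'chi_j = cfAut u ('chi_i ^ g^-1)%CF /\ {in K, forall x, 'chi_j x = 'chi_i (pow_conj x g k)}.
Proof.
move=> Gg; have [u Du] := Qn_aut_exists (coprime_unitZ k).
have /irrP[j Dj] : cfAut u ('chi_i ^ g^-1)%CF \in irr K by rewrite cfAut_irr cfConjg_irr ?mem_irr.
exists u, j; split=> // x Kx; rewrite -Dj cfunE cfConjgE ?groupV ?nKG // invgK.
have Kxg : (x ^ g)%g \in K by rewrite memJ_norm ?nKG.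
by rewrite Du ?linX // -lin_charX.
Qed.

Lemma aut_pow (u : {rmorphism algC -> algC}) :
  exists k : E, forall z : algC, z ^+ n = 1 -> u z = z ^+ val k.
Proof.
have [e pe] := C_prim_root_exists (ltnW n1); have [k co Dk] := aut_prim_rootP u pe.
have [k' Dk'] := unitZ_of co; exists k' => z zn; rewrite -Dk' //.
have [i ->] := prim_rootP pe zn; by rewrite rmorphXn /= Dk -!exprM mulnC.
Qed.

(** Nontrivial characters of K induce irreducibly, all to the degree of index K, so GC* gives an
    automorphism u relating the induced ones; restricting back to K makes chi_j a conjugate of the
    u-image of chi_i. *)
Lemma GCstar_irr_pow : GCstar G -> forall i j : Iirr K, i != 0 -> j != 0 ->
  exists g (k : E), g \in G /\ {in K, forall x, 'chi_j x = 'chi_i (pow_conj x g k)}.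
Proof.
move=> GC i j ni nj; have /irrP[i' Di] := irr_induced_Frobenius_ker frobGK ni.
have /irrP[j' Dj] := irr_induced_Frobenius_ker frobGK nj.
have ind1 (l : Iirr K) : 'Ind[G] 'chi_l 1%g = #|G : K|%:R by rewrite cfInd1 // (lin_char1 (lin l)) mulr1.
have iK : #|G : K|%:R != 1 :> algC.
  rewrite pnatr_eq1 indexg_eq1; case/Frobenius_kerP: frobGK => _ pKG _ _.
  exact: proper_subn.
have [|||u] := GC i' j'; rewrite -?Di -?Dj ?ind1 //.
rewrite cfAutInd -aut_IirrE; set i2 := aut_Iirr u i => e.
have : '['Res[K] ('Ind[G] 'chi_i2), 'chi_j] != 0.
  by rewrite cfdotC conjC_eq0 -e cfdot_Res_r Dj cfdot_irr eqxx oner_eq0.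
rewrite cfResInd // cfdotZl mulf_eq0 negb_or => /andP[_]; rewrite cfdot_suml => nz.
have [g Gg ng] : exists2 g, g \in G & '[('chi_i2 ^ g)%CF, 'chi_j] != 0.
  apply/exists_inP; apply: contraR nz; rewrite negb_exists_in => /forall_inP h.
  by rewrite big1 // => g /h; rewrite negbK => /eqP.
have ej : 'chi_j = ('chi_i2 ^ g)%CF.
  have /irrP[j2 Dj2] : ('chi_i2 ^ g)%CF \in irr K by rewrite cfConjg_irr ?mem_irr.
  by move: ng; rewrite Dj2 cfdot_irr; have [<-//|_] := eqVneq j2 j; rewrite eqxx.
have [k Dk] := aut_pow u; exists g^-1%g, k; split=> [|x Kx]; first by rewrite groupV.
rewrite ej cfConjgE ?nKG // aut_IirrE cfunE Dk; last by rewrite linX // memJ_norm ?groupV ?nKG.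
by rewrite -lin_charX // memJ_norm ?groupV ?nKG.
Qed.

Lemma pow_conj_sum (phi : gT -> algC) x g k : x \in K -> g \in G ->
  \sum_(h in G) \sum_(m : E) phi (pow_conj (pow_conj x g k) h m) =
  \sum_(h in G) \sum_(m : E) phi (pow_conj x h m).
Proof.
move=> Kx Gg; rewrite [RHS](reindex_inj (mulgI g)) /=; apply: eq_big => [h|h Gh]; first by rewrite groupMl.
rewrite [RHS](reindex_inj (mulgI k)) /=; apply: eq_bigr => m _.
by rewrite pow_conjM.
Qed.

Let sum_irr y : y \in K^#%g -> \sum_i ('chi[K]_i y)^* = 0.
Proof.
case/setD1P=> ny Ky; transitivity (\sum_i 'chi[K]_i 1%g * ('chi_i y)^*).
  by apply: eq_bigr => i _; rewrite (lin_char1 (lin i)) mul1r.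
rewrite second_orthogonality_relation // (_ : (1%g \in y ^: K) = false) ?mulr0n //.
by apply/negbTE; rewrite class_sym class1G inE.
Qed.

(* The transform of the orbit measure of x is constant off the trivial character, hence so is the
   measure off 1. *)
Lemma irr_transitive_pow :
  (forall i j : Iirr K, i != 0 -> j != 0 ->
    exists g (k : E), g \in G /\ {in K, forall x, 'chi_j x = 'chi_i (pow_conj x g k)}) ->
  forall x y, x \in K^#%g -> y \in K^#%g -> exists g (k : E), g \in G /\ y = pow_conj x g k.
Proof.
move=> tr x y Kx Ky; have [nx Kx'] := setD1P Kx; have [ny Ky'] := setD1P Ky.
pose fh (i : Iirr K) := \sum_(h in G) \sum_(m : E) 'chi_i (pow_conj x h m).
pose cnt w := (\sum_(h in G) \sum_(m : E) (pow_conj x h m == w))%N.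
have fhE w : w \in K -> \sum_i fh i * ('chi_i w)^* = n%:R * (cnt w)%:R.
  move=> Kw; rewrite /cnt natr_sum mulr_sumr /fh.
  under eq_bigr do rewrite mulr_suml; rewrite exchange_big /=; apply: eq_bigr => h Gh.
  under eq_bigr do rewrite mulr_suml; rewrite exchange_big /= natr_sum mulr_sumr; apply: eq_bigr => m _.
  have Kp := pow_conj_in m Kx' Gh.
  rewrite second_orthogonality_relation // (setIidPl _) ?sub_cent1 ?(subsetP abK) //.
  rewrite (_ : (_ \in w ^: K) = (pow_conj x h m == w)); last first.
    apply/imsetP/eqP=> [[u Ku ->]|->]; last by exists 1%g; rewrite ?group1 ?conjg1.
    by apply/conjg_fixP/commgP; apply: (centsP abK).
  by case: eqP; rewrite ?mulr1 ?mulr0.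
have ch0 i : i != 0 -> forall j, j != 0 -> fh j = fh i.
  move=> ni j nj; have [g [k [Gg e]]] := tr i j ni nj.
  rewrite [RHS](reindex_inj (mulIg g)) /=; apply: eq_big => [h|h Gh]; first by rewrite groupMr.
  rewrite [RHS](reindex_inj (mulIg k)) /=; apply: eq_bigr => m _.
  by rewrite e ?pow_conj_in // pow_conjM.
have [i0 ni0] : exists i : Iirr K, i != 0.
  have : (1 < #|Iirr K|)%N.
    by rewrite card_ord NirrE (eqP (_ : #|classes K| == n)) // -card_classes_abelian.
  by rewrite (cardD1 0) inE ltnS => /card_gt0P[i]; rewrite !inE andbT; exists i.
pose c := fh i0.
have cntE w : w \in K^#%g -> n%:R * (cnt w)%:R = fh 0 - c.
  move=> Kw; have [_ Kw'] := setD1P Kw; rewrite -fhE // (bigD1 0) //=.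
  have := sum_irr Kw; rewrite (bigD1 0) //= => /eqP; rewrite addr_eq0 => /eqP e.
  rewrite (eq_bigr (fun i => c * ('chi_i w)^*)) => [|i ni]; last by rewrite (ch0 _ ni0 _ ni).
  rewrite -mulr_sumr -[\sum_(i | i != 0) _]opprK -e irr0 cfun1E Kw' rmorph1; ring.
have n0 : n%:R != 0 :> algC by rewrite pnatr_eq0 -lt0n.
have cxy : cnt y = cnt x.
  by apply/eqP; rewrite -(eqr_nat algC) -(inj_eq (mulfI n0)) !cntE.
have cx : (0 < cnt x)%N.
  by rewrite /cnt (bigD1 1%g) //= (bigD1 1%g) //= pow_conj1 eqxx.
rewrite -cxy lt0n /cnt sum_nat_eq0 negb_forall in cx; case/existsP: cx => g.
rewrite negb_imply sum_nat_eq0 negb_forall => /andP[Gg /existsP[k]].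
by rewrite negb_imply /= eqb0 negbK => /eqP <-; exists g, k.
Qed.

(** The Fourier argument with K and its characters exchanged: the orbit sum of chi_i is constant off
    1, so all nontrivial characters are hit equally often, and chi_i is hit. *)
Lemma pow_transitive_Ind :
  (forall x y, x \in K^#%g -> y \in K^#%g -> exists g (k : E), g \in G /\ y = pow_conj x g k) ->
  forall i j : Iirr K, i != 0 -> j != 0 ->
  exists u : {rmorphism algC -> algC}, 'Ind[G] 'chi_j = cfAut u ('Ind[G] 'chi_i).
Proof.
move=> tr i j ni nj.
suff [g [k [Gg e]]] : exists g (k : E), g \in G /\ {in K, forall x, 'chi_j x = 'chi_i (pow_conj x g k)}.
  have [u [j' [Dj' ej']]] := irr_pow_conj i k Gg; exists u.
  have -> : 'chi_j = 'chi_j' by apply/cfun_inP=> x Kx; rewrite e // ej'.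
  rewrite Dj' -cfAutInd; congr (cfAut u _); apply/esym; apply: cfclass_Ind => //.
  by apply/cfclassP; exists g^-1%g; rewrite ?groupV.
pose Fs x := \sum_(h in G) \sum_(m : E) 'chi_i (pow_conj x h m).
pose cnt l := (\sum_(h in G) \sum_(m : E) [forall x in K, 'chi[K]_l x == 'chi_i (pow_conj x h m)])%N.
have cntE l : \sum_(x in K) Fs x * ('chi_l x)^* = n%:R * (cnt l)%:R.
  rewrite /Fs /cnt natr_sum mulr_sumr; under eq_bigr do rewrite mulr_suml.
  rewrite exchange_big /=; apply: eq_bigr => h Gh; under eq_bigr do rewrite mulr_suml.
  rewrite exchange_big /= natr_sum mulr_sumr; apply: eq_bigr => m _.
  have [u [j' [_ ej']]] := irr_pow_conj i m Gh.
  have n0 : n%:R != 0 :> algC by rewrite pnatr_eq0 -lt0n (ltnW n1).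
  transitivity (n%:R * '['chi_j', 'chi_l]).
    by rewrite cfdotE mulVKf //; apply: eq_bigr => x Kx; rewrite ej'.
  rewrite cfdot_irr; congr (_ * _%:R); congr nat_of_bool; apply/eqP/forall_inP=> [<- x Kx|h'].
    by rewrite ej'.
  by apply: irr_inj; apply/cfun_inP=> x Kx; rewrite (eqP (h' x Kx)) ej'.
have [x0 Kx0] : exists x0, x0 \in K^#%g.
  have /trivgPn[x0 Kx nx] : K :!=: 1%g by rewrite -cardG_gt1.
  by exists x0; rewrite !inE nx.
have Fc x : x \in K^#%g -> Fs x = Fs x0.
  move=> Kx; have [g [k [Gg ->]]] := tr x0 x Kx0 Kx.
  by rewrite /Fs (pow_conj_sum (fun w => 'chi_i w)) //; case/setD1P: Kx0.
have cE l : l != 0 -> n%:R * (cnt l)%:R = Fs 1%g - Fs x0.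
  move=> nl; rewrite -cntE (bigD1 1%g) //= (lin_char1 (lin l)) rmorph1 mulr1.
  rewrite (eq_bigr (fun x => Fs x0 * ('chi_l x)^*)) => [|x /andP[Kx nx]]; last by rewrite Fc // !inE nx.
  have : '[1, 'chi_l] = 0 by rewrite -irr0 cfdot_irr eq_sym (negPf nl).
  rewrite cfdotE => /eqP; rewrite mulf_eq0 invr_eq0 pnatr_eq0 eqn0Ngt (ltnW n1) /=.
  rewrite (bigD1 1%g) //= (lin_char1 (lin l)) cfun11 rmorph1 mulr1 addrC addr_eq0 => /eqP e.
  rewrite -mulr_sumr (eq_bigr (fun x => (1 : 'CF(K)) x * ('chi_l x)^*)) ?e ?mulrN1 // => x /andP[Kx _].
  by rewrite cfun1E Kx mul1r.
have n0 : n%:R != 0 :> algC by rewrite pnatr_eq0 -lt0n (ltnW n1).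
have cij : cnt j = cnt i.
  by apply/eqP; rewrite -(eqr_nat algC) -(inj_eq (mulfI n0)) !cE.
have ci : (0 < cnt i)%N.
  rewrite /cnt (bigD1 1%g) //= (bigD1 1%g) //= (_ : [forall x in K, _] = true) //.
  by apply/forall_inP=> w _; rewrite pow_conj1.
rewrite -cij lt0n /cnt sum_nat_eq0 negb_forall in ci; case/existsP: ci => g.
rewrite negb_imply sum_nat_eq0 negb_forall => /andP[Gg /existsP[k]].
rewrite negb_imply /= eqb0 negbK => /forall_inP e; exists g, k; split=> // x Kx.
exact/eqP/e.
Qed.
End Kernel.
End KernelCharacters.

(** * The presentation of the group of order 72 *)

Module Presentation72.
Import GroupScope.

Definition pres72 (gT : finGroupType) (a b x y : gT) :=
  [/\ [/\ a ^+ 3 = 1, b ^+ 3 = 1 & [~ a, b] = 1],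
      [/\ x ^+ 4 = 1, y ^+ 2 = x ^+ 2 & x ^ y = x^-1]
    & [/\ a ^ x = b^-1, b ^ x = a, a ^ y = a * b & b ^ y = a * b^-1]].

Lemma homg72P (gT : finGroupType) (G : {group gT}) :
  reflect (exists a b x y, G :=: <[a]> <*> <[b]> <*> <[x]> <*> <[y]> /\ pres72 a b x y)
    (G \homg Grp (a : b : x : y :
        a ^+ 3, b ^+ 3, [~ a, b], x ^+ 4, y ^+ 2 = x ^+ 2, x ^ y = x^-1,
        a ^ x = b^-1, b ^ x = a, a ^ y = a * b, b ^ y = a * b^-1)).
Proof.
apply: (iffP existsP) => [[[[[a b] x] y]] /= /eqP[<- ? ? ? ? ? ? ? ? ? ?]|[a [b [x [y [-> [[? ? ?] [? ? ?] [? ? ? ?]]]]]]]].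
  by exists a, b, x, y.
by exists (a, b, x, y); rewrite /= !xpair_eqE; do ?[apply/andP; split]; apply/eqP.
Qed.

Section Pres.
Variables (gT : finGroupType) (a b x y : gT).
Hypothesis P : pres72 a b x y.
Let A := <[a]> <*> <[b]>.
Let T := <[x]> <*> <[y]>.

Lemma pres72_cent : <[b]> \subset 'C(<[a]>).
Proof.
case: P => [[_ _ /eqP/commgP cab] _ _]; rewrite cycle_subG /= cent_cycle; apply/cent1P.
by first [exact: cab | exact: commute_sym cab].
Qed.

Lemma pres72_norm : T \subset 'N(A).
Proof.
case: P => _ _ [ax bx ay by_].
have [Aa Ab] : a \in A /\ b \in A by split; rewrite mem_gen // inE cycle_id ?orbT.
have AJ g : A :^ g = <[a ^ g]> <*> <[b ^ g]> by rewrite /A joingE -genJ conjUg -!cycleJ.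
have gA : group_set A by apply: groupP.
have [AM AV] : {in A &, forall u v, u * v \in A} /\ {in A, forall u, u^-1 \in A}.
  by split=> [u v Au Av|u Au]; [apply: (@groupM _ (Group gA))|rewrite (@groupV _ (Group gA))].
rewrite gen_subG subUset !cycle_subG !inE !AJ ax bx ay by_ !join_subG !cycle_subG.
by rewrite -/A Aa AV // !AM ?AV.
Qed.

Lemma pres72_card : #|A| %| 9 /\ #|T| %| 8.
Proof.
case: P => [[a3 b3 _] [x4 y2 xy] _]; split.
  rewrite /A cent_joinEr ?pres72_cent //; apply: dvdn_trans (dvdn_cardMg _ _) _.
  by rewrite -!orderE (@dvdn_mul _ _ 3 3) ?order_dvdn ?a3 ?b3.
have nx : <[y]> \subset 'N(<[x]>) by rewrite cycle_subG inE -cycleJ xy cycleV.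
have o4 : #[x] %| 4 by rewrite order_dvdn x4.
rewrite /T norm_joinEr // -(@dvdn_pmul2r #|<[x]> :&: <[y]>|) ?cardG_gt0 // -mul_cardG -!orderE.
have oy : #[y] %| #|<[x]> :&: <[y]>| * 2.
  have : y ^+ 2 \in <[x]> :&: <[y]> by rewrite inE mem_cycle y2 mem_cycle.
  by move/order_dvdG; rewrite order_dvdn -expgM mulnC -order_dvdn.
by rewrite -[8]/(4 * 2)%N -mulnA (dvdn_mul o4) // mulnC.
Qed.

Lemma pres72_mul : <[a]> <*> <[b]> <*> <[x]> <*> <[y]> = A * T.
Proof. by rewrite -norm_joinEr ?pres72_norm // joingA. Qed.

Lemma pres72_dvd : #|<[a]> <*> <[b]> <*> <[x]> <*> <[y]>| %| 72.
Proof.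
have [dA dT] := pres72_card; rewrite pres72_mul; apply: dvdn_trans (dvdn_cardMg _ _) _.
exact: (@dvdn_mul _ _ 9 8).
Qed.

(** x^2 inverts a, so for a nontrivial the relations cannot collapse: x has order 4, b is outside
    [<[a]>] and y outside [<[x]>], and the bounds 9 and 8 are attained. *)
Lemma pres72_eq : a != 1 -> #|<[a]> <*> <[b]> <*> <[x]> <*> <[y]>| = 72.
Proof.
move=> na; have [dA dT] := pres72_card; case: P => [[a3 b3 cab] [x4 y2 xy] [ax bx ay by_]].
have x2a : a ^ (x ^+ 2) = a^-1 by rewrite expg2 conjgM ax conjVg bx.
have oa : #[a] = 3 by apply: nt_prime_order.
have nx2 : x ^+ 2 != 1.
  apply: contraNneq na => e; move: x2a; rewrite e conjg1 => aV.
  by rewrite -order_eq1 -dvdn1 -[1%N]/(gcdn 2 3) dvdn_gcd !order_dvdn a3 expg2 {1}aV mulVg !eqxx.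
have ox : #[x] = 4.
  by apply: (@orderXpfactor _ 2 1 2 x) => //; apply: nt_prime_order => //; rewrite -expgM.
have nba : b \notin <[a]>.
  have cyc c : c \in <[a]> -> [\/ c = 1, c = a | c = a^-1].
    case/cycleP=> k ->; rewrite -(expg_mod k a3).
    case: (k %% 3) (ltn_pmod k (isT : 0 < 3)) => [|[|[|]]] // _; [constructor 1|constructor 2|constructor 3] => //.
    by apply: (mulIg a); rewrite mulVg -expgSr a3.
  have aV : a^-1 = a -> False.
    move=> e; case/negP: na; rewrite -order_eq1 -dvdn1 -[1%N]/(gcdn 2 3) dvdn_gcd !order_dvdn a3 eqxx andbT.
    by rewrite expg2 -{1}e mulVg.
  apply/negP=> /cyc[] e; move: bx ax; rewrite e ?conj1g ?conjVg => bx' ax'.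
  - by rewrite -bx' eqxx in na.
  - by apply: aV; rewrite -ax'.
  by move: bx'; rewrite ax' invgK; apply: aV.
have nb : b != 1 by apply: contraNneq nba => ->.
have ob : #[b] = 3 by apply: nt_prime_order.
have oA : #|A| = 9.
  rewrite /A cent_joinEr ?pres72_cent // TI_cardMg -?orderE ?oa ?ob // setIC.
  by rewrite prime_TIg -?orderE ?ob // cycle_subG.
have nyx : y \notin <[x]>.
  apply/negP=> Xy; have : x ^ y = x by apply/conjg_fixP/commgP; apply: (centsP (cycle_abelian x)); rewrite ?cycle_id.
  by rewrite xy => e; case/eqP: nx2; rewrite expg2 -{1}e mulVg.
have oT : #|T| = 8.
  have sXT : <[x]> \subset T by apply: joing_subl.
  have Ty : y \in T by rewrite mem_gen // inE cycle_id orbT.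
  have i1 : #|T : <[x]>| != 1%N by rewrite indexg_eq1; apply: contra nyx => /subsetP/(_ y Ty).
  have := Lagrange sXT; rewrite -orderE ox => e; move: dT; rewrite -e -[8]/(4 * 2)%N dvdn_pmul2l //.
  by case/primeP: (isT : prime 2) => _ h /h/pred2P[i1'|->] //; rewrite i1' in i1.
by rewrite pres72_mul TI_cardMg ?oA ?oT // coprime_TIg // oA oT.
Qed.
End Pres.

(** If H satisfies the relations, so does the diagonal subgroup D of the product. Its order divides
    72 and it maps onto G, so the first projection is an isomorphism and the second one yields the
    map onto H. *)
Lemma isog72 (gT : finGroupType) (G : {group gT}) (a b x y : gT) :
    G :=: <[a]> <*> <[b]> <*> <[x]> <*> <[y]> -> pres72 a b x y -> a != 1 ->
  G \isog Grp (a : b : x : y :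
        a ^+ 3, b ^+ 3, [~ a, b], x ^+ 4, y ^+ 2 = x ^+ 2, x ^ y = x^-1,
        a ^ x = b^-1, b ^ x = a, a ^ y = a * b, b ^ y = a * b^-1).
Proof.
move=> defG P na; have oG : #|G| = 72 by rewrite defG pres72_eq.
move=> rT H; apply/idP/homg72P.
  case/homgP=> f Df; exists (f a), (f b), (f x), (f y); rewrite -Df.
  have [[Ga Gb] [Gx Gy]] : (a \in G /\ b \in G) /\ (x \in G /\ y \in G).
    have := subxx G; rewrite {1}defG !join_subG !cycle_subG.
    by case/andP=> /andP[/andP[]].
  split.
    rewrite (congr1 (fun S : {set gT} => f @* S) defG) !morphimY ?join_subG ?cycle_subG ?Ga ?Gb ?Gx ?Gy //=.
    by rewrite !morphim_cycle.
  case: P => [[p1 p2 p3] [p4 p5 p6] [p7 p8 p9 p10]].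
  split; split; rewrite -?morphX ?p1 ?p2 ?p4 ?p5 ?morph1 //.
  - by rewrite -morphR // p3 morph1.
  - by rewrite -morphJ // p6 morphV.
  - by rewrite -morphJ // p7 morphV.
  - by rewrite -morphJ // p8.
  - by rewrite -morphJ // p9 morphM.
  by rewrite -morphJ // p10 morphM ?groupV // morphV.
case=> a' [b' [x' [y' [defH P']]]].
pose A := (a, a'); pose B := (b, b'); pose X := (x, x'); pose Y := (y, y').
have PD : pres72 A B X Y.
  case: P => [[p1 p2 p3] [p4 p5 p6] [p7 p8 p9 p10]]; case: P' => [[q1 q2 q3] [q4 q5 q6] [q7 q8 q9 q10]].
  by do !split; congr (_, _).
pose D := (<[A]> <*> <[B]> <*> <[X]> <*> <[Y]>)%G.
have dD : #|D| %| 72 := pres72_dvd PD.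
have sT (C : {set gT * rT}) : C \subset [set: gT * rT] by apply: subsetT.
have im1 : fst_morphism gT rT @* D = G.
  by rewrite defG /= !morphimY ?sT // !morphim_cycle ?inE.
have im2 : snd_morphism gT rT @* D = H.
  by rewrite defH /= !morphimY ?sT // !morphim_cycle ?inE.
have oD : #|D| = 72.
  apply/eqP; rewrite eqn_dvd dD -oG -im1; exact: dvdn_morphim.
have isoD : D \isog G.
  apply/isogP; exists (restrm_morphism (subsetT D) (fst_morphism gT rT)).
    apply/injmP; apply/imset_injP; rewrite -morphimEdom /= morphim_restrm setIid im1 oG -oD //.
  by rewrite /= morphim_restrm setIid.
rewrite -(eq_homgr _ isoD); apply/homgP; exists (restrm_morphism (subsetT D) (snd_morphism gT rT)).
by rewrite /= morphim_restrm setIid.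
Qed.
End Presentation72.

(** * The action of L on K *)

Module KernelAction.
Import NcRing ClassEquation FpfRings GaloisConjugates FpfSylow FpfStructure ScalarAction KernelCharacters.
Import GroupScope GRing.Theory.

(** The common form of transitivity: on characters the exponents are Galois automorphisms, on
    elementary abelian K they are scalars. *)
Definition pow_transitive (gT : finGroupType) (K L : {group gT}) :=
  forall x y, x \in K^# -> y \in K^# -> exists l k, [/\ l \in L, coprime k #|K| & y = (x ^ l) ^+ k].

Section Frobenius.
Variables (gT : finGroupType) (G K L : {group gT}).
Hypotheses (frobG : [Frobenius G = K ><| L]) (abK : abelian K).

Let frobGK := FrobeniusWker frobG.
Let defG : K ><| L = G. Proof. by case: (Frobenius_context frobG). Qed.
Let ntK : K :!=: 1. Proof. by case: (Frobenius_context frobG). Qed.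
Let nKL : L \subset 'N(K). Proof. by case/sdprodP: defG. Qed.
Let sLG : L \subset G. Proof. by case/sdprodP: defG => _ /mulG_sub[]. Qed.
Let sKG : K \subset G. Proof. by case/sdprodP: defG => _ /mulG_sub[]. Qed.
Let n1 : 1 < #|K|. Proof. by rewrite cardG_gt1. Qed.

Lemma Frobenius_fix l x : l \in L^# -> x \in K -> x ^ l = x -> x = 1.
Proof.
move=> Ll Kx /conjg_fixP/commgP c; have : x \in 'C_K[l].
  by rewrite in_setI Kx; apply/cent1P; first [exact: c | exact: commute_sym c].
by rewrite (Frobenius_reg_ker frobG Ll) => /set1P.
Qed.

Lemma pow_transitiveP :
  (forall x y, x \in K^# -> y \in K^# ->
     exists g (k : {unit 'Z_#|K|}), g \in G /\ y = pow_conj x g k) <-> pow_transitive K L.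
Proof.
split=> tr x y Kx Ky.
  have [g [k [Gg ->]]] := tr x y Kx Ky; have [_ Kx'] := setD1P Kx.
  have : g \in K * L by rewrite (sdprodW defG).
  case/mulsgP=> h l Kh Ll ->; exists l, (val k); split=> //; first exact: coprime_unitZ frobGK k.
  rewrite /pow_conj conjgM (_ : x ^ h = x) //; apply/conjg_fixP/commgP; exact: (centsP abK).
have [l [k [Ll co ->]]] := tr x y Kx Ky; have [_ Kx'] := setD1P Kx.
have uk : (k%:R : 'Z_#|K|)%R \is a GRing.unit by rewrite unitZpE // coprime_sym.
exists l, (FinRing.unit _ uk); split; first exact: (subsetP sLG).
rewrite /pow_conj /= val_Zp_nat // expg_mod //.
by rewrite -conjXg expg_cardG // conj1g.
Qed.

Lemma pow_transitive_order : pow_transitive K L -> {in K^# &, forall x y, #[y] %| #[x]}.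
Proof.
move=> tr x y Kx Ky; have [l [k [Ll _ ->]]] := tr x y Kx Ky.
by rewrite -(orderJ x l); apply: orderXdvd.
Qed.

Lemma pow_transitive_abelem : pow_transitive K L -> (pdiv #|K|).-abelem K.
Proof.
move=> tr; have pr : prime (pdiv #|K|) by rewrite pdiv_prime.
have [x Kx ox] := Cauchy pr (pdiv_dvd _).
rewrite abelemE // abK; apply/exponentP=> y Ky; have [->|ny] := eqVneq y 1; first by rewrite expg1n.
apply/eqP; rewrite -order_dvdn -ox; apply: (pow_transitive_order tr); rewrite !inE ?ny ?Ky //.
by rewrite Kx -order_eq1 ox neq_ltn prime_gt1 ?orbT.
Qed.

Lemma pow_transitive_minnormal : pow_transitive K L -> minnormal K G.
Proof.
move=> tr; have nKG : G \subset 'N(K) by case/sdprod_context: defG => /andP[].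
apply/mingroupP; split=> [|H /andP[ntH nHG] sHK]; first by rewrite ntK.
apply/eqP; rewrite eqEsubset sHK; apply/subsetP=> y Ky.
have [x Hx nx] := trivgPn _ ntH; have [->|ny] := eqVneq y 1; first exact: group1.
have Kx : x \in K^# by rewrite !inE nx (subsetP sHK).
have Ky' : y \in K^# by rewrite !inE ny.
have [l [k [Ll _ ->]]] := tr x y Kx Ky'.
by rewrite groupX // memJ_norm // (subsetP nHG) ?(subsetP sLG).
Qed.

Lemma GCstar_pow_transitive : GCstar G -> pow_transitive K L.
Proof.
move=> GC; apply/pow_transitiveP; apply: (irr_transitive_pow frobGK abK).
exact: (GCstar_irr_pow frobGK abK GC).
Qed.

Lemma minnormal_abelem (q n : nat) : minnormal K G -> prime q -> #|K| = (q ^ n)%N -> q.-abelem K.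
Proof.
move=> /mingroupP[/andP[_ nKG] min] pr_q oK.
have qK : q.-group K by rewrite /pgroup oK pnatX pnat_id.
have O1 : 'Ohm_1(K) = K.
  apply: min; last exact: Ohm_sub.
  by rewrite Ohm1_eq1 ntK (char_norm_trans (Ohm_char 1 K)).
by rewrite -O1 Ohm1_abelem.
Qed.

Local Notation dK := (abelem_dim' K).

Section Abelem.
Variable q : nat.
Hypothesis abelK : q.-abelem K.

Let pr_q : prime q. Proof. by case/pgroup_pdiv: (abelem_pgroup abelK) => //. Qed.
Let rG := abelem_repr abelK ntK nKL.
Let V := (rVabelem abelK ntK).
Let W := (abelem_rV abelK ntK).

Lemma abelem_semireg l (v : 'rV['F_q]_dK.+1) : l \in L^# -> (v *m rG l = v)%R -> v = 0%R.
Proof.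
move=> Ll e; have [_ Ll'] := setD1P Ll; apply: (@rVabelem_inj _ _ _ abelK ntK).
rewrite rVabelem0; apply: (Frobenius_fix Ll); first exact: mem_rVabelem.
by rewrite -(rVabelemJ abelK ntK nKL) // e.
Qed.

Lemma abelem_fpf : fpf_rep L (fun l => rG l : 'M['F_q]_dK.+1).
Proof.
split=> [|x y Lx Ly|x Lx]; [exact: repr_mx1|exact: repr_mxM|].
rewrite unitmxE unitfE; apply/negP=> /det0P[v nv]; rewrite mulmxBr mulmx1 => /eqP.
by rewrite subr_eq0 => /eqP/(abelem_semireg Lx) v0; rewrite v0 eqxx in nv.
Qed.

Lemma abelem_unit : {in \pi(L), forall p, (p%:R)%R \is a @GRing.unit 'M['F_q]_dK.+1}.
Proof.
move=> p; rewrite mem_primes => /and3P[pr_p _ pL].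
have np : q != p.
  apply: contraTneq (Frobenius_coprime frobG) => e; have [_ dq _] := pgroup_pdiv (abelem_pgroup abelK) ntK.
  apply/negP=> co; have : q %| gcdn #|K| #|L| by rewrite dvdn_gcd dq e.
  by rewrite (eqnP co) dvdn1 => /eqP q1; have := pr_q; rewrite q1.
have u : (p%:R : 'F_q)%R \is a GRing.unit.
  by rewrite unitfE -(dvdn_pcharf (pchar_Fp pr_q)) dvdn_prime2.
by rewrite -[(p%:R)%R](rmorph_nat (@scalar_mx 'F_q _)) rmorph_unit.
Qed.

Lemma pow_scalar_transitive : pow_transitive K L <-> scalar_transitive rG.
Proof.
have oFq : #|'F_q| = q by rewrite card_Fp.
have nzW x : x \in K^# -> W x != 0%R.
  case/setD1P=> nx Kx; apply: contra nx => /eqP e; apply/eqP.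
  by rewrite -(abelem_rV_K abelK ntK Kx) -/W e rVabelem0.
have nzV v : v != 0%R -> V v \in K^#.
  move=> nv; rewrite !inE mem_rVabelem andbT; apply: contra nv => /eqP e.
  by rewrite -(inj_eq (@rVabelem_inj _ _ _ abelK ntK)) rVabelem0; apply/eqP.
have qK : q.-group K := abelem_pgroup abelK.
have copr k : coprime k #|K| = coprime k q.
  by have [_ _ [m oK]] := pgroup_pdiv qK ntK; rewrite oK coprime_pexpr.
split=> tr.
  move=> v w nv nw; have [l [k [Ll co e]]] := tr _ _ (nzV v nv) (nzV w nw).
  have uk : (k%:R : 'F_q)%R \is a GRing.unit.
    by rewrite unitfE -(dvdn_pcharf (pchar_Fp pr_q)) -prime_coprime // coprime_sym -copr.
  exists l, (FinRing.unit _ uk); split=> //=.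
  rewrite -(rVabelemK abelK ntK w) -/V e abelem_rV_X ?memJ_norm ?mem_rVabelem ?(subsetP nKL) //.
  by rewrite -/V (abelem_rV_J abelK ntK nKL) ?mem_rVabelem // rVabelemK.
move=> x y Kx Ky; have [l [k [Ll e]]] := tr _ _ (nzW x Kx) (nzW y Ky).
have [_ Kx'] := setD1P Kx; have [_ Ky'] := setD1P Ky.
exists l, (val k : 'F_q); split=> //.
  by rewrite copr coprime_sym prime_coprime // (dvdn_pcharf (pchar_Fp pr_q)) natr_Zp -unitfE (valP k).
rewrite -(abelem_rV_K abelK ntK Ky') -/W e -(abelem_rV_J abelK ntK nKL) // rVabelemZ abelem_rV_K //.
by rewrite memJ_norm ?(subsetP nKL).
Qed.

Lemma minnormal_irr : minnormal K G -> mx_irreducible rG.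
Proof.
move/mingroupP=> [/andP[_ nKG] min]; apply/abelem_mx_irrP/mingroupP; split; first by rewrite ntK.
move=> H /andP[ntH nHL] sHK; apply: min => //; rewrite ntH -(sdprodW defG) mul_subG //.
by apply: subset_trans (cent_sub _); apply: subset_trans abK (centS sHK).
Qed.

Lemma card_kernel : #|K| = (q ^ dK.+1)%N.
Proof. by rewrite -(card_abelem_rV abelK ntK) card_mx mul1n card_Fp. Qed.
End Abelem.
End Frobenius.
End KernelAction.

(** * Sufficiency of the conditions *)

Module Sufficiency.
Import NcRing ClassEquation FpfRings GaloisConjugates FpfSylow OddCharacters FpfStructure ScalarAction KernelCharacters Presentation72 KernelAction.
Import GroupScope Order.TTheory GRing.Theory Num.Theory.

Section Frobenius.
Variables (gT : finGroupType) (G K L : {group gT}).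
Hypotheses (frobG : [Frobenius G = K ><| L]) (abK : abelian K).

Let frobGK := FrobeniusWker frobG.
Let defG : K ><| L = G. Proof. by case: (Frobenius_context frobG). Qed.
Let ntK : K :!=: 1. Proof. by case: (Frobenius_context frobG). Qed.
Let nKL : L \subset 'N(K). Proof. by case/sdprodP: defG. Qed.
Let sLG : L \subset G. Proof. by case/sdprodP: defG => _ /mulG_sub[]. Qed.
Let sKG : K \subset G. Proof. by case/sdprodP: defG => _ /mulG_sub[]. Qed.
Let nK : K <| G. Proof. by case/sdprod_context: defG. Qed.
Let oG : #|G| = (#|K| * #|L|)%N. Proof. by rewrite (sdprod_card defG). Qed.

Lemma Frobenius_reg_transitive : #|L| = #|K|.-1 -> {in K^# &, forall x y, exists2 l, l \in L & y = x ^ l}.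
Proof.
move=> oL x y Kx Ky; have [nx Kx'] := setD1P Kx.
have orb : x ^: L = K^#.
  apply/eqP; rewrite eqEcard; apply/andP; split.
    by apply/subsetP=> _ /imsetP[l Ll ->]; rewrite !inE conjg_eq1 nx memJ_norm ?(subsetP nKL).
  rewrite -index_cent1 (_ : 'C_L[x] = 1) ?indexg1 ?oL; first by rewrite (cardsD1 1 K) group1.
  apply/trivgP/subsetP=> l /setIP[Ll /cent1P c]; apply/set1P/eqP; apply: contraT => nl.
  case/eqP: nx; apply: (Frobenius_fix frobG (l := l)) => //; first by rewrite !inE nl.
  by apply/conjg_fixP/commgP; first [exact: c | exact: commute_sym c].
by move: Ky; rewrite -orb => /imsetP[l Ll ->]; exists l.
Qed.

(** Irreducible characters nontrivial on K are induced from K, hence conjugate by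
    [pow_transitive_Ind]; the second hypothesis handles pairs with a member trivial on K. *)
Lemma Ind_GCstar : pow_transitive K L ->
    (forall i j : Iirr G, K \subset cfker 'chi_i -> 'chi_i 1%g != 1 -> 'chi_j 1%g != 1 ->
      'chi_i 1%g = 'chi_j 1%g -> 'chi_i = 'chi_j)%R ->
  GCstar G.
Proof.
move=> tr h i j ni nj ij.
have [Ki|nKi] := boolP (K \subset cfker 'chi_i)%R.
  by exists idfun; rewrite (h i j) //; apply/cfunP=> x; rewrite cfunE.
have [Kj|nKj] := boolP (K \subset cfker 'chi_j)%R.
  by exists idfun; rewrite (h j i) //; apply/cfunP=> x; rewrite cfunE.
have [i' ni' ->] := Frobenius_Ind_irrP frobGK i nKi; have [j' nj' ->] := Frobenius_Ind_irrP frobGK j nKj.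
by apply: (pow_transitive_Ind frobGK abK) => //; apply/(pow_transitiveP frobG abK).
Qed.

Lemma cyclic_GCstar (q n d : nat) : minnormal K G -> prime q -> #|K| = (q ^ n)%N -> cyclic L ->
  d %| q.-1 -> coprime d n -> #|L| = ((q ^ n).-1 %/ d)%N -> GCstar G.
Proof.
move=> minK pr_q oK cyL dq dn oL.
have abelK := minnormal_abelem frobG abK minK pr_q oK.
have en : n = (abelem_dim' K).+1.
  by have := card_kernel frobG abelK; rewrite oK => /eqP; rewrite eqn_exp2l ?prime_gt1 // => /eqP.
have abL := cyclic_abelian cyL.
apply: Ind_GCstar => [|i j Ki ni].
  apply/(pow_scalar_transitive frobG abelK).
  apply: (irreducible_transitive (d := d) abL (@abelem_semireg _ _ _ _ frobG _ abelK)).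
  - exact: (minnormal_irr frobG abK abelK).
  - by rewrite card_Fp.
  - by rewrite -en.
  rewrite card_Fp // -en oL divnK //; apply: dvdn_trans dq _.
  by rewrite predn_exp dvdn_mulr.
case/negP: ni; rewrite -lin_irrE lin_irr_der1; apply: subset_trans Ki.
apply: der1_min (normal_norm nK) _; by rewrite -(isog_abelian (sdprod_isog defG)).
Qed.

(** The squares of the degrees of [G / K] sum to 8, so at most one of its characters is nonlinear
    and its degree is below 8, the degree of the induced ones. *)
Lemma card72_GCstar : #|K| = 9 -> #|L| = 8 -> GCstar G.
Proof.
move=> oK oL; have iK : #|G : K| = 8 by rewrite -divgS // oG oK oL.
apply: Ind_GCstar => [x y Kx Ky|i j Ki ni nj ij].
  have [|l Ll ->] := Frobenius_reg_transitive _ Kx Ky; first by rewrite oK oL.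
  by exists l, 1%N; rewrite coprime1n.
have oB : #|G / K| = 8 by rewrite card_quotient ?normal_norm.
pose d (B : {group coset_of K}) (i : Iirr B) := Num.truncn ('chi_i 1%g)%R.
have dE (k : Iirr (G / K)) : ('chi_k 1%g = (d _ k)%:R)%R by rewrite truncnK ?Cnat_irr1.
have d0 (k : Iirr (G / K)) : 0 < d _ k by have := irr1_gt0 k; rewrite dE ltr0n.
have s8 : (\sum_(k : Iirr (G / K)) d _ k ^ 2 = 8)%N.
  apply/eqP; rewrite -(eqr_nat algC) natr_sum -oB -irr_sum_square; apply/eqP.
  by apply: eq_bigr => k _; rewrite natrX -dE.
have qi k : (K \subset cfker 'chi[G]_k -> 'chi_(quo_Iirr K k) 1%g = 'chi_k 1%g)%R.
  by move=> Kk; rewrite quo_IirrE // cfQuo1.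
have d2 k : (K \subset cfker 'chi[G]_k)%R -> ('chi_k 1%g != 1)%R -> 1 < d _ (quo_Iirr K k).
  move=> Kk nk; have := d0 (quo_Iirr K k); rewrite leq_eqVlt => /orP[/eqP e|//].
  by case/eqP: nk; rewrite -qi // dE -e.
have [Kj|nKj] := boolP (K \subset cfker 'chi_j)%R.
  have [-> //|nij] := eqVneq i j; have := s8.
  have ne : quo_Iirr K j != quo_Iirr K i.
    by apply: contra nij => /eqP e; rewrite -(quo_IirrK nK Ki) -e (quo_IirrK nK Kj).
  have := d2 i Ki ni; have := d2 j Kj nj; set i' := quo_Iirr K i; set j' := quo_Iirr K j => dj di.
  have z1 : d _ (0%R : Iirr (G / K)) = 1%N.
    by apply/eqP; rewrite -(eqr_nat algC) -dE irr0 cfun11.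
  have ni' : i' != 0%R by apply: contraTneq di => ->; rewrite z1.
  have nj' : j' != 0%R by apply: contraTneq dj => ->; rewrite z1.
  rewrite (bigD1 0%R) //= (bigD1 i') //= (bigD1 j') /= ?nj' //.
  by move: (d _ i') (d _ j') di dj => u v; rewrite z1; move: (\sum_(_ | _) _)%N; clear; nia.
have [j' nj' ej] := Frobenius_Ind_irrP frobGK j nKj.
have lj : ('chi_j' \is a linear_char)%R by apply/char_abelianP.
have := ij; rewrite ej cfInd1 // (lin_char1 lj) mulr1 iK -(qi i Ki) dE => /eqP; rewrite eqr_nat => /eqP e.
by have := s8; rewrite (bigD1 (quo_Iirr K i)) //= e.
Qed.

(** If a were 1, the order of G would divide 8, against the coprimality of K and L. So it is 72, and
    only 9 and 8 satisfy that the order of L divides that of K minus 1. *)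
Lemma isog72_GCstar (q n : nat) : prime q -> #|K| = (q ^ n)%N ->
  G \homg Grp (a : b : x : y :
        a ^+ 3, b ^+ 3, [~ a, b], x ^+ 4, y ^+ 2 = x ^+ 2, x ^ y = x^-1,
        a ^ x = b^-1, b ^ x = a, a ^ y = a * b, b ^ y = a * b^-1) -> GCstar G.
Proof.
move=> pr_q oK /homg72P[a [b [x [y [eG P]]]]].
have co := Frobenius_coprime frobG; have dL := Frobenius_dvd_ker1 frobG.
have K1 : 1 < #|K| by rewrite cardG_gt1.
have L1 : 1 < #|L| by rewrite cardG_gt1; case: (Frobenius_context frobG).
have na : a != 1.
  apply/eqP=> a1; have [_ dT] := pres72_card P.
  have b1 : b = 1 by case: P => _ _ [_ bx _ _]; apply/eqP; rewrite -(conjg_eq1 b x) bx a1.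
  have d8 : #|K| * #|L| %| 8.
    by rewrite -oG eG (pres72_mul P) a1 b1 cycle1 joing1G mul1g.
  have even m : m %| 8 -> 1 < m -> 2 %| m.
    by rewrite -[8]/(2 ^ 3)%N => /(dvdn_pfactor _ _ (isT : prime 2))[[|k] _ ->] // _; rewrite expnS dvdn_mulr.
  have : 2 %| gcdn #|K| #|L|.
    rewrite dvdn_gcd !even //; first exact: dvdn_trans (dvdn_mull _ (dvdnn _)) d8.
    exact: dvdn_trans (dvdn_mulr _ (dvdnn _)) d8.
  by rewrite (eqnP co).
have o72 : (#|K| * #|L|)%N = 72 by rewrite -oG eG pres72_eq.
have : #|K| %| 72 by rewrite -o72 dvdn_mulr.
rewrite dvdn_divisors // (_ : divisors 72 = [:: 1; 2; 3; 4; 6; 8; 9; 12; 18; 24; 36; 72]%N) //.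
have lE m : #|K| = m.+1 -> #|L| = 72 %/ m.+1 by move=> e; rewrite -o72 e mulKn.
rewrite !inE => /or4P[|||/or4P[|||/or4P[|||/or3P[]]]] /eqP e; move: (lE _ e) K1 L1 dL; rewrite e => ->.
all: try by move=> h1 h2 h3; exfalso; move: h1 h2 h3; vm_compute.
by move=> *; apply: card72_GCstar => //; rewrite (lE _ e).
Qed.
End Frobenius.
End Sufficiency.

(** * The quaternion complement *)

Module QuaternionComplement.
Import NcRing ClassEquation FpfRings GaloisConjugates FpfSylow OddCharacters FpfStructure ScalarAction KernelCharacters Presentation72 KernelAction Sufficiency.
Import GroupScope.

Section Quaternion.
Variables (gT : finGroupType) (G K L : {group gT}) (q : nat).
Hypotheses (frobG : [Frobenius G = K ><| L]) (abK : abelian K) (abelK : q.-abelem K).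
Hypotheses (tr : pow_transitive K L) (oL : #|L| = 8) (exL : extremal_class L = Quaternion).

Let defG : K ><| L = G. Proof. by case: (Frobenius_context frobG). Qed.
Let ntK : K :!=: 1. Proof. by case: (Frobenius_context frobG). Qed.
Let nKL : L \subset 'N(K). Proof. by case/sdprodP: defG. Qed.
Let sLG : L \subset G. Proof. by case/sdprodP: defG => _ /mulG_sub[]. Qed.
Let sKG : K \subset G. Proof. by case/sdprodP: defG => _ /mulG_sub[]. Qed.
Let KJ x l : x \in K -> l \in L -> x ^ l \in K.
Proof. by move=> Kx Ll; rewrite memJ_norm ?(subsetP nKL). Qed.
Let fixK := @Frobenius_fix _ _ _ _ frobG.

Lemma involution_inverts t : t \in L -> #[t] = 2 -> {in K, forall x, x ^ t = x^-1}.
Proof.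
move=> Lt ot x Kx; have nt : t != 1 by rewrite -order_eq1 ot.
have t2 : t * t = 1 by rewrite -expg2 -ot expg_order.
have Lt' : t \in L^# by rewrite !inE nt.
apply: (mulgI x); rewrite mulgV; apply: (fixK Lt'); first by rewrite groupM ?KJ.
by rewrite conjMg -conjgM t2 conjg1; apply: (centsP abK); rewrite ?KJ.
Qed.

(** K is the union of the conjugates of [<[a]>] under L. The involution inverts K, so there are at
    most 4 of them and K has order at most 4q, with q odd: it is 9 or q. If it is q, automorphisms
    of K commute, but L is nonabelian and acts faithfully. *)
Lemma card_kernel9 : #|K| = 9.
Proof.
have [pr_q _ [m oK]] := pgroup_pdiv (abelem_pgroup abelK) ntK.
have [a Ka na] := trivgPn _ ntK.
have oa : #[a] = q by apply: (abelem_order_p abelK).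
have [_ [i [j [Li Lj oi ij]]]] := quaternion_pair exL.
have oz : #[i ^+ 2] = 2 by rewrite (@orderXexp _ 2 1 2 i oi).
have q2 : q != 2.
  apply/eqP=> e; have := Frobenius_coprime frobG; rewrite oK oL e expnS coprimeMl.
  by [].
have le : #|K| <= 4 * q.
  have iN : #|L : 'N_L(<[a]>)| <= 4.
    rewrite -(leq_pmul2l (cardG_gt0 'N_L(<[a]>))) Lagrange ?subsetIl // oL.
    rewrite -[8]/(2 * 4)%N leq_pmul2r // -oz dvdn_leq ?cardG_gt0 // order_dvdG //.
    by rewrite !inE groupX //= -cycleJ (involution_inverts (groupX 2 Li) oz) // cycleV.
  have sub : K \subset cover (<[a]> :^: L).
    apply/subsetP=> y Ky; have [->|ny] := eqVneq y 1.
      by apply/bigcupP; exists <[a]>; rewrite ?group1 //; apply/imsetP; exists 1; rewrite ?conjsg1.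
    have Ka' : a \in K^# by rewrite !inE na.
    have Ky' : y \in K^# by rewrite !inE ny.
    have [l [k [Ll _ ->]]] := tr Ka' Ky'.
    apply/bigcupP; exists (<[a]> :^ l); first exact: imset_f.
    by rewrite -conjXg memJ_conjg mem_cycle.
  apply: leq_trans (subset_leq_card sub) _; apply: leq_trans (leq_card_cover _) _.
  rewrite (eq_bigr (fun=> q)) => [|_ /imsetP[l Ll ->]]; last by rewrite cardJg -orderE.
  by rewrite sum_nat_const card_conjugates leq_mul2r iN orbT.
have m0 : m != 0%N.
  apply/eqP=> m0; have eK : K :=: <[a]>.
    by apply/esym/eqP; rewrite eqEcard cycle_subG Ka -orderE oa oK m0 /=.
  have act l : l \in L -> exists k, a ^ l = a ^+ k.
    by move=> Ll; apply/cycleP; rewrite -eK KJ.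
  have [[k1 e1] [k2 e2]] := (act i Li, act j Lj).
  have com : a ^ (i * j) = a ^ (j * i).
    by rewrite !conjgM e1 e2 !conjXg e1 e2 -!expgM mulnC.
  have : [~ i, j] = 1.
    apply/eqP; apply: contraT => nc; case/eqP: na.
    have Lc : [~ i, j] \in L^# by rewrite !inE nc groupR.
    apply/eqP; rewrite -(conjg_eq1 a (j * i)); apply/eqP; apply: (fixK Lc); first by rewrite KJ ?groupM.
    by rewrite -conjgM -commgC com.
  move/eqP/commgP=> c; have : i ^ j = i by apply/conjg_fixP/commgP.
  rewrite ij => e; have : #[i] %| 2 by rewrite order_dvdn expg2 -{1}e mulVg.
  by rewrite oi.
have q3 : q = 3.
  have := le; rewrite oK; case: (m) m0 => // m' _.
  have : q * q <= q ^ m'.+2 by rewrite !expnS mulnA leq_pmulr // expn_gt0 prime_gt0.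
  move=> h1 h2; have : q * q <= 4 * q := leq_trans h1 h2.
  rewrite leq_pmul2r ?prime_gt0 //; move: q2; have := pr_q; clear.
  by case: q => [|[|[|[|[|]]]]].
move: le m0; rewrite oK q3; case: m {oK} => [|[|m]] // h _.
by move: h; rewrite !expnS; have : 0 < 3 ^ m by [rewrite expn_gt0]; move: (3 ^ m)%N => u; clear; lia.
Qed.

(** L acts regularly on the eight nontrivial elements of K. So a is arbitrary, b is read off from
    [a ^ x = b^-1], and y is chosen by [a ^ y = a * b]; the other relations follow. *)
Lemma quaternion_isog72 :
  G \isog Grp (a : b : x : y :
        a ^+ 3, b ^+ 3, [~ a, b], x ^+ 4, y ^+ 2 = x ^+ 2, x ^ y = x^-1,
        a ^ x = b^-1, b ^ x = a, a ^ y = a * b, b ^ y = a * b^-1).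
Proof.
have oK := card_kernel9.
have [n [x [y0 [[n2 oS Lx ox X'y] [nX inv o4 _ _]]]]] := quaternion_facts exL.
have n3 : n = 3 by apply/eqP; rewrite -(eqn_exp2l _ _ (isT : 1 < 2)) -oS oL.
have ox4 : #[x] = 4 by rewrite ox n3.
have ox2 : #[x ^+ 2] = 2 by rewrite (@orderXexp _ 2 1 2 x ox4).
have Lx2 : x ^+ 2 \in L by rewrite groupX.
have inv2 := involution_inverts Lx2 ox2.
have [a Ka na] := trivgPn _ ntK.
have q3 : q = 3.
  have [pr_q dq _] := pgroup_pdiv (abelem_pgroup abelK) ntK.
  by move: dq; rewrite oK (Euclid_dvdX 3 2 pr_q) // dvdn_prime2 // => /andP[/eqP].
have e3 u : u \in K -> u ^+ 3 = 1 by case/and3P: abelK => _ _ ex Ku; rewrite -q3; apply: (exponentP ex).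
have sqV u : u \in K -> u * u = u^-1 by move=> Ku; apply: (mulIg u); rewrite mulVg -(e3 u Ku) expgS expg2 mulgA.
have naV : a^-1 <> a.
  by move=> e; case/negP: na; rewrite -(inj_eq (mulgI a)) mulg1 sqV // e.
pose b := (a ^ x)^-1; have Kb : b \in K by rewrite groupV KJ.
have ax : a ^ x = b^-1 by rewrite invgK.
have bx : b ^ x = a by rewrite /b conjVg -conjgM -expg2 inv2 // invgK.
have ba : b <> a.
  by move=> e; apply: naV; rewrite -{2}bx e ax e.
have nb : b <> 1 by move=> e; move: bx; rewrite e conj1g => a1; rewrite a1 eqxx in na.
have nab : a * b != 1.
  apply/eqP=> e; apply: naV; have bV : b = a^-1 by apply: (mulgI a); rewrite e mulgV.
  have axa : a ^ x = a by rewrite ax bV invgK.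
  by rewrite -[RHS]axa -{2}axa -conjgM -expg2 inv2.
have oLK : #|L| = #|K|.-1 by rewrite oK oL.
have [Ka' Kab'] : a \in K^# /\ a * b \in K^# by rewrite !inE na nab groupM.
have [y Ly ay] := Frobenius_reg_transitive frobG oLK Ka' Kab'.
have nXy : y \notin <[x]>.
  apply/negP=> /cycleP[k]; rewrite -(expg_mod k (_ : x ^+ 4 = 1)) -?ox4 ?expg_order // ox4.
  case: (k %% 4) (ltn_pmod k (isT : 0 < 4)) => [|[|[|[|]]]] // _ ek; move: ay; rewrite ek.
  - by rewrite conjg1 -{2}[a]mulg1 => /mulgI.
  - rewrite expg1 ax => e; apply: ba; apply: (mulIg b); rewrite sqV // e //.
  - rewrite inv2 // -sqV // => /mulgI; exact: ba.
  rewrite expgSr conjgM inv2 // conjVg ax invgK -{2}[b]mul1g => /mulIg a1.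
  by rewrite a1 eqxx in na.
have X'y' : y \in L :\: <[x]> by rewrite inE nXy.
have xy : x ^ y = x^-1 by apply: inv; rewrite ?cycle_id.
have oy : #[y] = 4 by apply: o4.
have y2 : y ^+ 2 = x ^+ 2.
  have oy2 : #[y ^+ 2] = 2 by rewrite (@orderXexp _ 2 1 2 y oy).
  have Ly2 : y ^+ 2 \in L by rewrite groupX.
  apply/eqP; rewrite eq_mulgV1; apply: contraT => nt; case/eqP: na.
  have Lt : y ^+ 2 * (x ^+ 2)^-1 \in L^# by rewrite !inE nt groupM ?groupV.
  apply: (fixK Lt) => //; rewrite conjgM (involution_inverts Ly2 oy2) // conjVg; apply: (canLR invgK).
  have e : a = a^-1 ^ (x ^+ 2) by rewrite conjVg inv2 // invgK.
  by rewrite {1}e conjgK.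
have b_y : b ^ y = a * b^-1.
  have xV u v : u ^ x = v -> v ^ x^-1 = u by move=> <-; rewrite conjgK.
  rewrite /b conjVg -conjgM conjgC xy conjgM -ay conjMg (xV b a bx) (xV a^-1 b); last by rewrite conjVg ax invgK.
  by rewrite invMg invgK.
have P : pres72 a b x y.
  have cab : [~ a, b] = 1 by apply/eqP/commgP; apply: (centsP abK).
  have x4 : x ^+ 4 = 1 by rewrite -ox4 expg_order.
  by do !split; rewrite ?e3.
apply: (isog72 _ P na); apply/esym/eqP; rewrite eqEcard !join_subG !cycle_subG.
have [Ga Gb] : a \in G /\ b \in G by split; apply: (subsetP sKG).
have [Gx Gy] : x \in G /\ y \in G by split; apply: (subsetP sLG).
by rewrite Ga Gb Gx Gy (pres72_eq P) // -(sdprod_card defG) oK oL.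
Qed.
End Quaternion.
End QuaternionComplement.

Import GaloisConjugates FpfStructure ScalarAction KernelAction Sufficiency QuaternionComplement.

(* (C_3 x C_3) ><| Q_8 is given by the presentation with generators a, b
   (generating C_3 x C_3) and x, y (generating Q_8, acting faithfully). *)
Theorem theorem3p5 (gT : finGroupType) (G K L : {group gT}) :
  [Frobenius G = K ><| L]%g -> abelian K ->
  GCstar G <->
  (minnormal K G /\
   exists q n : nat, prime q /\ #|K| = (q ^ n)%N /\
     ((G \isog Grp (a : b : x : y :
                      a ^+ 3, b ^+ 3, [~ a, b],
                      x ^+ 4, y ^+ 2 = x ^+ 2, x ^ y = x^-1,
                      a ^ x = b^-1, b ^ x = a,
                      a ^ y = a * b, b ^ y = a * b^-1))%g
      \/
      (cyclic L /\ exists d : nat,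
          (d %| q.-1)%N /\ coprime d n /\ #|L| = ((q ^ n).-1 %/ d)%N))).
Proof.
move=> frobG abK; split=> [GC|[minK [q [n [pr_q [oK [iso|[cyL [d [dq [dn oL]]]]]]]]]]]; last first.
- exact: (cyclic_GCstar frobG abK minK pr_q oK cyL dq dn oL).
- by apply: (isog72_GCstar frobG abK pr_q oK); rewrite -iso homg_refl.
have tr := GCstar_pow_transitive frobG abK GC.
have abelK := pow_transitive_abelem frobG abK tr; set q := pdiv #|K| in abelK.
have [defG ntK _ _ _] := Frobenius_context frobG.
have [pr_q _ _] := pgroup_pdiv (abelem_pgroup abelK) ntK.
split; first exact: (pow_transitive_minnormal frobG tr).
exists q, (abelem_dim' K).+1; split=> //; split; first exact: (card_kernel frobG abelK).
have nK : (K <| G)%g by case/sdprod_context: defG.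
have GCL : GCstar L.
  apply: GCstar_isog (GCstar_quotient nK GC); rewrite isog_sym; exact: sdprod_isog defG.
have [cyL|[oL exL]] := fpf_GCstar_structure (abelem_fpf frobG abelK) (abelem_unit frobG abelK) GCL; last first.
  by left; apply: (quaternion_isog72 frobG abK abelK tr oL exL).
right; split=> //.
have [d [dq dn md]] := transitive_arith (cyclic_abelian cyL) (@abelem_semireg _ _ _ _ frobG _ abelK)
  ((pow_scalar_transitive frobG abelK).1 tr).
rewrite card_Fp // in dq md; exists d; split=> //; split=> //.
by rewrite -md mulnK // (dvdn_gt0 _ dq) // -subn1 subn_gt0 prime_gt1.
Qed.
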